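(* Let $\xi$ be a model and let $\bar h\ge 0$. For each $\beta>0$ let $h=h(\beta)\ge 0$ and let $\xi_\beta$ be a model, and suppose that $h/\beta\to\bar h$ and $\xi_\beta''\to\xi''$ uniformly on $[0,1]$ as $\beta\to\infty$. Then $F_{\beta,h,\xi_\beta}$ sequentially $\Gamma$-converges to $GS_{\bar h,\xi}$ on $\mathcal{A}$ as $\beta\to\infty$. In particular, $GS_{\bar h,\xi}$ attains its minimum on $\mathcal{A}$ and $$\lim_{\beta\to\infty}\ \min_{\mu\in\Pr([0,1])}\frac{1}{\beta}\mathcal{P}_{\beta,h,\xi_\beta}(\mu)=\min_{\nu\in\mathcal{A}}\frac12 GS_{\bar h,\xi}(\nu).$$ Furthermore, if $\nu_\beta$ denotes the (unique) minimizer of $F_{\beta,h,\xi_\beta}$, then $\nu_\beta\to\nu$ weakly as measures, where $\nu$ is the unique minimizer of $GS_{\bar h,\xi}$.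
   Context: A model is a function $\xi(t)=\sum_{p\ge2}\beta_p^2t^p$ with real coefficients $\beta_p$, not all zero, such that $\xi(1+\epsilon)<\infty$ for some $\epsilon>0$. For $\mu\in\Pr([0,1])$ (Borel probability measures on $[0,1]$) let $\hat\mu(t)=\int_t^1\mu[0,s]\,ds$. For $\beta>0,h\ge0$ and a model $\xi$, the Crisanti–Sommers functional is $$\mathcal{P}_{\beta,h,\xi}(\mu)=\frac12\Big(\int_0^1\beta^2\xi''(s)\hat\mu(s)\,ds+\int_0^1\Big(\frac1{\hat\mu(s)}-\frac1{1-s}\Big)ds+h^2\hat\mu(0)\Big)$$ (the second integrand is nonnegative since $\hat\mu(s)\le 1-s$). Let $\mathscr{M}([0,1])$ be the finite signed Borel measures on $[0,1]$ and $\mathcal{A}=\{\nu\in\mathscr{M}([0,1]):\nu=m(t)\,dt+c\,\delta_1,\ m\ge0 \text{ non-decreasing and càdlàg},\ c\ge 0\}$, with the topology of weak convergence of measures (relative weak-$*$ topology). Let $X_\beta=\{\nu\in\mathcal{A}: d\nu=\beta\,\mu[0,t]\,dt \text{ for some }\mu\in\Pr([0,1])\}$ and define $F_{\beta,h,\xi}:\mathcal{A}\to[0,\infty]$ by $F_{\beta,h,\xi}(\nu)=\frac2\beta\mathcal{P}_{\beta,h,\xi}(\mu)$ if $\nu\in X_\beta$ with $d\nu=\beta\mu[0,t]dt$, and $+\infty$ otherwise. Define $GS_{h,\xi}:\mathcal{A}\to[0,\infty]$ by $GS_{h,\xi}(\nu)=\int_0^1\big(\xi''(s)\nu[s,1]+\frac1{\nu[s,1]}\big)ds+h^2\nu[0,1]$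 if $\nu\ne0$ and $+\infty$ if $\nu=0$. Sequential $\Gamma$-convergence: functionals $F_n$ on a topological space $X$ sequentially $\Gamma$-converge to $F$ if (i) for every $x$ and every sequence $x_n\to x$, $\liminf_n F_n(x_n)\ge F(x)$, and (ii) for every $x$ there is a sequence $x_n\to x$ with $\limsup_n F_n(x_n)\le F(x)$; a family $F_\beta$ indexed by $\beta>0$ sequentially $\Gamma$-converges to $F$ as $\beta\to\infty$ if this holds along every sequence $\beta_n\to\infty$. *)

(* Defs.v *)
From HB Require Import structures.
From mathcomp Require Import all_boot all_order all_algebra.
From mathcomp Require Import all_classical all_reals all_analysis.
Set Implicit Arguments. Unset Strict Implicit. Unset Printing Implicit Defensive.
Import Order.TTheory GRing.Theory Num.Theory.
Import numFieldNormedType.Exports.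
Local Open Scope ring_scope.
Local Open Scope classical_set_scope.

Section Defs.
Variable R : realType.

(* A model is given by its coefficients b : nat -> R (only p >= 2 is used):
   xi(t) = sum_{p >= 2} (b p)^2 t^p. *)
Definition xi (b : nat -> R) (t : R) : R :=
  limn (fun n => \sum_(2 <= p < n) (b p ^+ 2 * t ^+ p)).

Definition xi2 (b : nat -> R) : R -> R := derive1 (derive1 (xi b)).

Definition model (b : nat -> R) : Prop :=
  (exists p, (2 <= p)%N /\ b p != 0) /\
  (exists e : R, 0 < e /\
     (\sum_(2 <= p <oo) ((b p ^+ 2 * (1 + e) ^+ p)%:E) < +oo)%E).

(* Borel probability measures on [0,1], seen as Borel probability measures
   on R giving full mass to [0,1]. *)
Definition PrI (mu : probability R R) : Prop := mu `[0, 1] = 1%E.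

Definition muhat (mu : probability R R) (t : R) : \bar R :=
  (\int[lebesgue_measure]_(s in `[t, 1%R]) mu `[0%R, s])%E.

(* Crisanti--Sommers functional; 1/0 = +oo (ereal inverse). *)
Definition CS (beta h : R) (b : nat -> R) (mu : probability R R) : \bar R :=
  ((2^-1)%:E *
   ((\int[lebesgue_measure]_(s in `[0%R, 1%R]) ((beta ^+ 2 * xi2 b s)%:E * muhat mu s))
    + (\int[lebesgue_measure]_(s in `[0%R, 1%R[) ((muhat mu s)^-1 - ((1 - s)%:E)^-1))
    + (h ^+ 2)%:E * muhat mu 0%R))%E.

(* An element nu = m(t) dt + c delta_1 is represented by the pair (m, c). *)
Record Aelt := MkA { dens : R -> R ; atom : R }.

Definition inA (nu : Aelt) : Prop :=
  (forall t, 0 <= t <= 1 -> 0 <= dens nu t) /\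
  (forall s t, 0 <= s -> s <= t -> t <= 1 -> dens nu s <= dens nu t) /\
  (forall t, 0 <= t < 1 -> dens nu @ at_right t --> dens nu t) /\
  (forall t, 0 < t <= 1 -> cvg (dens nu @ at_left t)) /\
  0 <= atom nu.

Definition Ameas (nu : Aelt) (B : set R) : \bar R :=
  ((\int[lebesgue_measure]_(x in B `&` `[0%R, 1%R]) (dens nu x)%:E)
   + (atom nu * (\1_B 1 : R))%:E)%E.

Definition Aint (nu : Aelt) (f : R -> R) : R :=
  fine (\int[lebesgue_measure]_(x in `[0%R, 1%R]) (f x * dens nu x)%:E)
  + atom nu * f 1.

Definition Aeq (nu nu' : Aelt) : Prop :=
  forall B : set R, measurable B -> Ameas nu B = Ameas nu' B.

Definition wconv (nus : nat -> Aelt) (nu : Aelt) : Prop :=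
  forall f : R -> R, {within `[0, 1], continuous f} ->
    (fun n => Aint (nus n) f) @ \oo --> Aint nu f.

Definition wconvR (nus : R -> Aelt) (nu : Aelt) : Prop :=
  forall f : R -> R, {within `[0, 1], continuous f} ->
    (fun beta => Aint (nus beta) f) @ +oo --> Aint nu f.

Definition inXwith (beta : R) (nu : Aelt) (mu : probability R R) : Prop :=
  inA nu /\ PrI mu /\
  forall B : set R, measurable B ->
    Ameas nu B =
    (\int[lebesgue_measure]_(x in B `&` `[0%R, 1%R]) ((beta)%:E * mu `[0%R, x]))%E.

(* F(nu) = (2/beta) P(mu) if nu in X_beta (mu is then unique), +oo otherwise *)
Definition Ffun (beta h : R) (b : nat -> R) (nu : Aelt) : \bar R :=
  ereal_inf [set ((2 / beta)%:E * CS beta h b mu)%E | mu in inXwith beta nu].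

Definition nuint (nu : Aelt) (s : R) : \bar R := Ameas nu `[s, 1].

Definition GS (h : R) (b : nat -> R) (nu : Aelt) : \bar R :=
  if `[< exists2 B : set R, measurable B & Ameas nu B != 0%E >] then
    ((\int[lebesgue_measure]_(s in `[0%R, 1%R]) ((xi2 b s)%:E * nuint nu s + (nuint nu s)^-1))
     + (h ^+ 2)%:E * nuint nu 0%R)%E
  else +oo%E.

Definition GammaSeq (F : nat -> Aelt -> \bar R) (G : Aelt -> \bar R) : Prop :=
  (forall nu (nus : nat -> Aelt), inA nu -> (forall n, inA (nus n)) ->
     wconv nus nu -> (G nu <= limn_einf (fun n => F n (nus n)))%E) /\
  (forall nu, inA nu -> exists nus : nat -> Aelt,
     (forall n, inA (nus n)) /\ wconv nus nu /\
     (limn_esup (fun n => F n (nus n)) <= G nu)%E).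

Definition isminA (G : Aelt -> \bar R) (nu : Aelt) : Prop :=
  inA nu /\ forall nu', inA nu' -> (G nu <= G nu')%E.

End Defs.

(* Main.v *)
(* Everything is expressed through the tail phi(s) = nu[s,1] = c + int_s^1 m, a
   nonincreasing concave function that determines nu. Up to the factor 2/beta,
   the Crisanti-Sommers functional and GS are the cases k = 1/beta and k = 0 of
     J(phi) = int_0^1 (w phi + 1/phi - k/(1-s)) ds + H phi(0),
   with w = xi'' and the constraint k phi(s) <= 1 - s.

   Strict convexity of 1/x gives the quantitative inequality
     2 J((phi+psi)/2) + int (phi-psi)^2 / (2K^3) <= J(phi) + J(psi)
   for tails bounded by K. Hence minimizing sequences are Cauchy in L^2, and thus
   pointwise by monotonicity and concavity; with Fatou's lemma this yields existence
   and uniqueness of minimizers without compactness arguments. Since a density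
   in A is bounded, GS is first minimized among densities bounded by a constant M;
   a competitor with a larger density is improved by replacing its tail with a line
   of slope -M near 1, because the pointwise minimizer (xi'')^(-1/2) is Lipschitz there.

   For beta large, replacing m by beta on the last interval of length
   (c + beta^(-1/2))/beta turns nu into an element of X_beta with almost the same
   value; conversely, adding a small atom at 1 to an element of X_beta makes its GS
   value at most its F_beta value plus a small error. So the minimal values converge,
   and the convexity inequality turns this into convergence of the minimizers. *)
Require Import Defs.
From HB Require Import structures.
From mathcomp Require Import all_boot all_order all_algebra.
From mathcomp Require Import all_classical all_reals all_analysis.
From mathcomp Require Import measurable_realfun ring lra.
Set Implicit Arguments.
Unset Strict Implicit.
Unset Printing Implicit Defensive.
Import Order.TTheory GRing.Theory Num.Theory.
Import numFieldNormedType.Exports.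
Local Open Scope ring_scope.
Local Open Scope classical_set_scope.

(** * The second derivative of a model *)

(** Two degeneracies shape the argument. At 0, xi'' vanishes when [b 2 = 0], so lower bounds on xi''
    and the pointwise minimizer (xi'')^(-1/2) are available only on [1/2, 1]. Concavity of the tail
    makes this enough to bound the mass phi(0), and the truncation is arranged to act past 1/2 only.
    At 1, weak limits may gain an atom, since densities bounded by beta can concentrate there as
    beta grows. Convergence of tails as beta grows is therefore asserted on [0,1) only, where a
    bound on the mass bounds the density locally, and weak convergence is recovered from grid sums
    that never evaluate a tail at 1. The term k/(1-s) is not integrable at 1, so it cannot be
    dropped at a small cost; this is why a small atom is added before comparing F_beta with GS. The
    constraint k phi(s) <= 1 - s keeps the integrand nonnegative, so J is always the integral of a
    nonnegative extended function. *)

Section PowerSeries.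
Variable R : realType.
Implicit Types (a : nat -> R) (x z : R).

Lemma pseries_diffs_ge0 a : (forall n, 0 <= a n) ->
  forall n, 0 <= pseries_diffs a n.
Proof. by move=> a0 n; rewrite /pseries_diffs mulr_ge0. Qed.

(** The tangent of t^(n+1) at z lies below the graph. Dropping z^(n+1) leaves a bound of a term of
    the differentiated series at z by (x - z)^-1 times a term of the original series at x. *)
Lemma expr_tangent_le x z n : 0 <= z -> z <= x ->
  n.+1%:R * z ^+ n * (x - z) <= x ^+ n.+1.
Proof.
move=> z0 zx; have x0 := le_trans z0 zx.
have -> : x ^+ n.+1 = x ^+ n.+1 - z ^+ n.+1 + z ^+ n.+1 by rewrite subrK.
rewrite subrXX mulrC.
apply: ler_wpDr; first exact: exprn_ge0.
apply: ler_wpM2l; first by rewrite subr_ge0.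
rewrite mulr_natl -[X in _ *+ X](card_ord n.+1) -sumr_const.
apply: ler_sum => i _ /=.
rewrite -[X in z ^+ X](subnK (_ : (i <= n)%N)) -1?ltnS// exprD.
by apply: ler_wpM2r; rewrite ?exprn_ge0// lerXn2r// nnegrE.
Qed.

Lemma is_cvg_pseries_diffs a x z : (forall n, 0 <= a n) -> 0 <= z -> z < x ->
  cvgn (pseries a x) -> cvgn (pseries (pseries_diffs a) z).
Proof.
move=> a0 z0 zx cx.
have xz : 0 < x - z by rewrite subr_gt0.
have x0 : 0 <= x by rewrite (le_trans z0)// ltW.
have cs : cvgn (series (fun n => a n.+1 * x ^+ n.+1)).
  move: cx; rewrite /pseries => cx.
  have -> : series (fun n => a n.+1 * x ^+ n.+1) =
      (fun n => series (fun i => a i * x ^+ i) n.+1 - a 0%N * x ^+ 0).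
    by apply/funext => n; rewrite /series/= [in RHS]big_nat_recl//= addrAC subrr add0r.
  move/cvg_ex: cx => [l cl]; apply/cvg_ex; exists (l - a 0%N * x ^+ 0).
  apply: cvgB; last exact: cvg_cst.
  by rewrite (cvg_shiftS (series (fun i => a i * x ^+ i))).
apply: (series_le_cvg (v_ := (x - z)^-1 *: (fun n => a n.+1 * x ^+ n.+1))).
- by move=> n; rewrite mulr_ge0 ?exprn_ge0 ?pseries_diffs_ge0.
- by move=> n; rewrite mulr_ge0 ?invr_ge0 ?mulr_ge0 ?exprn_ge0// ltW.
- move=> n; rewrite /pseries_diffs /= [in leRHS]/GRing.scale/=.
  rewrite ler_pdivlMl//.
  have -> : (x - z) * (n.+1%:R * a n.+1 * z ^+ n) =
    a n.+1 * (n.+1%:R * z ^+ n * (x - z)) by ring.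
  by rewrite ler_wpM2l// expr_tangent_le// ltW.
- exact: is_cvg_seriesZ.
Qed.

Lemma is_derive_pseries a x z : (forall n, 0 <= a n) -> `|z| < x ->
  cvgn (pseries a x) ->
  is_derive z (1 : R) (fun y => limn (pseries a y)) (limn (pseries (pseries_diffs a) z)).
Proof.
move=> a0 zx cx; have n0 := normr_ge0 z.
(* Each formal differentiation costs some radius: the second one is reached at [k] by passing
   through [k']. *)
pose k := (`|z| + x) / 2; pose k' := (k + x) / 2.
have [k0 zk kk' k'x] : [/\ 0 <= k, `|z| < k, k < k' & k' < x] by rewrite /k' /k; split; lra.
have x0 : 0 <= x by lra.
apply: (@pseries_snd_diffs _ _ k); last by rewrite (ger0_norm k0).
- by apply: is_cvg_pseries_inside cx _; rewrite !ger0_norm//; lra.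
- by apply: is_cvg_pseries_diffs cx => //; lra.
- apply: (@is_cvg_pseries_diffs _ k') => //; first exact: pseries_diffs_ge0.
  by apply: is_cvg_pseries_diffs cx => //; lra.
Qed.

Lemma pseries_lim_ge0 a x : (forall n, 0 <= a n) -> 0 <= x ->
  cvgn (pseries a x) -> 0 <= limn (pseries a x).
Proof.
move=> a0 x0 cx; apply: limr_ge => //; near=> n.
by rewrite sumr_ge0// => i _; rewrite mulr_ge0// exprn_ge0.
Unshelve. all: by end_near. Qed.

Lemma le_pseries_lim a x y : (forall n, 0 <= a n) -> 0 <= x -> x <= y ->
  cvgn (pseries a y) -> limn (pseries a x) <= limn (pseries a y).
Proof.
move=> a0 x0 xy cy; have y0 := le_trans x0 xy.
have cx : cvgn (pseries a x).
  move: xy; rewrite le_eqVlt => /predU1P[->//|xy].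
  by apply: is_cvg_pseries_inside cy _; rewrite !ger0_norm.
apply: lim_series_le => // n.
by rewrite ler_wpM2l// lerXn2r// nnegrE.
Qed.

Lemma pseries_term_le a x n : (forall n, 0 <= a n) -> 0 <= x ->
  cvgn (pseries a x) -> a n * x ^+ n <= limn (pseries a x).
Proof.
move=> a0 x0 cx; apply: (le_trans _ (nondecreasing_cvgn_le _ cx n.+1)).
  rewrite /pseries /series/= big_nat_recr//= lerDr sumr_ge0// => i _.
  by rewrite mulr_ge0// exprn_ge0.
apply/nondecreasing_seqP => k; rewrite /pseries /series/= big_nat_recr//= lerDl.
by rewrite mulr_ge0// exprn_ge0.
Qed.

End PowerSeries.

Section ModelSecondDerivative.
Variables (R : realType) (b : nat -> R).
Hypothesis bmodel : model b.

Let a p : R := if (2 <= p)%N then b p ^+ 2 else 0.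

Let a_ge0 p : 0 <= a p.
Proof. by rewrite /a; case: ifP => // _; exact: sqr_ge0. Qed.

Let xiE : xi b = (fun t => limn (pseries a t)).
Proof.
apply/funext => t; rewrite /xi; congr (limn _); apply/funext => n.
rewrite /pseries /series/= (big_nat_widenl 2 0)//= big_mkcond/=.
by apply: eq_bigr => i _; rewrite /a; case: ifP => // _; rewrite mul0r.
Qed.

Let cvg_model : exists2 r : R, 1 < r & cvgn (pseries a r).
Proof.
case: bmodel => _ [e [e0 fin]]; exists (1 + e); first by rewrite ltrDl.
have t0 p : 0 <= a p * (1 + e) ^+ p.
  by rewrite mulr_ge0// exprn_ge0// addr_ge0// ltW.
apply: nondecreasing_is_cvgn.
  by apply/nondecreasing_seqP => k; rewrite /pseries /series/= big_nat_recr//= lerDl.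
set S := (X in (X < +oo)%E) in fin.
exists (fine S) => _ [n _ <-].
have S0 : (0 <= S)%E.
  by apply: nneseries_ge0 => p _ _; rewrite lee_fin mulr_ge0 ?sqr_ge0// exprn_ge0// addr_ge0// ltW.
rewrite -lee_fin fineK ?ge0_fin_numE//.
apply: le_trans (@nneseries_lim_ge _ _ _ _ n _); last first.
  by move=> p _ _; rewrite lee_fin mulr_ge0 ?sqr_ge0// exprn_ge0// addr_ge0// ltW.
rewrite sumEFin lee_fin /pseries /series/= (big_nat_widenl 2 0)//= [leRHS]big_mkcond/=.
by apply: ler_sum => i _; rewrite /a; case: ifP => // _; rewrite mul0r.
Qed.

(** All later facts on xi'' are read off from this form: nonnegative coefficients, radius beyond 1,
    and one positive coefficient, at index p - 2 for some p with [b p] nonzero. *)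
Let xi2_pseries : exists (c : nat -> R) (r : R),
  [/\ forall n, 0 <= c n, 1 < r, cvgn (pseries c r),
      forall z, `|z| < r -> xi2 b z = limn (pseries c z) & exists n, 0 < c n].
Proof.
have [r r1 cr] := cvg_model.
pose r' := (1 + r) / 2; pose r'' := (1 + r') / 2.
have [h1 h2 h3] : [/\ 1 < r'', r'' < r' & r' < r] by rewrite /r'' /r'; split; lra.
have c' : cvgn (pseries (pseries_diffs a) r').
  by apply: is_cvg_pseries_diffs cr => //; lra.
exists (pseries_diffs (pseries_diffs a)), r''; split => //.
- by do 2 apply: pseries_diffs_ge0.
- apply: is_cvg_pseries_diffs c' => //; last lra.
  exact: pseries_diffs_ge0.
- move=> z zr; rewrite /xi2 xiE.
rewrite derive1E.
have D1 : {near z, derive1 (fun t => limn (pseries a t)) =1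
                  (fun t => limn (pseries (pseries_diffs a) t))}.
  near=> y; rewrite derive1E.
  apply: derive_val; apply: is_derive_pseries cr => //.
  apply: lt_trans h3; apply: lt_trans h2.
  near: y; apply: (cvgr_lt `|z|) => //; exact: cvg_norm.
rewrite (near_eq_derive _ D1) ?oner_eq0//.
apply: derive_val; apply: is_derive_pseries c'; first exact: pseries_diffs_ge0.
exact: lt_trans zr h2.
- have [[p [p2 bp]] _] := bmodel; exists p.-2.
  have b2 : 0 < b p ^+ 2 by rewrite exprn_even_gt0.
  rewrite /pseries_diffs /a.
  have -> : p.-2.+2 = p by case: p p2 {bp b2} => // -[].
  by rewrite p2 mulr_gt0// mulr_gt0// ltr0n ltnW.
Unshelve. all: by end_near. Qed.

Lemma xi2_ge0 s : 0 <= s <= 1 -> 0 <= xi2 b s.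
Proof.
move=> /andP[s0 s1]; have [c [r [c0 r1 cr E _]]] := xi2_pseries.
rewrite E; last by rewrite ger0_norm//; lra.
apply: pseries_lim_ge0 => //.
by apply: is_cvg_pseries_inside cr _; rewrite !ger0_norm//; lra.
Qed.

Lemma xi2_gt0 : exists2 w : R, 0 < w & forall s, 2^-1 <= s <= 1 -> w <= xi2 b s.
Proof.
have [c [r [c0 r1 cr E [n cn]]]] := xi2_pseries.
exists (c n * 2^-1 ^+ n); first by rewrite mulr_gt0// exprn_gt0// invr_gt0.
move=> s /andP[s0 s1]; rewrite E; last by rewrite ger0_norm; lra.
have cs : cvgn (pseries c s).
  by apply: is_cvg_pseries_inside cr _; rewrite !ger0_norm//; lra.
apply: (le_trans _ (pseries_term_le n c0 _ cs)); last lra.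
by rewrite ler_wpM2l// lerXn2r// nnegrE; lra.
Qed.

(** The constant is the third derivative at 1: with nonnegative coefficients it bounds the
    derivative of [xi2 b] on [0,1], and the mean value theorem applies. *)
Lemma xi2_lipschitz : exists2 L : R, 0 <= L &
  forall s t, 0 <= s -> s <= t -> t <= 1 -> `|xi2 b t - xi2 b s| <= L * (t - s).
Proof.
have [c [r [c0 r1 cr E _]]] := xi2_pseries.
have d3_ge0 := pseries_diffs_ge0 c0.
pose r' := (1 + r) / 2.
have [h1 h2] : 1 < r' /\ r' < r by rewrite /r'; split; lra.
have cr' : cvgn (pseries (pseries_diffs c) r').
  by apply: is_cvg_pseries_diffs cr => //; lra.
have c1 : cvgn (pseries (pseries_diffs c) 1).
  by apply: is_cvg_pseries_inside cr' _; rewrite !ger0_norm//; lra.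
exists (limn (pseries (pseries_diffs c) 1)).
  by apply: pseries_lim_ge0 => //.
move=> s t s0 st t1.
move: st; rewrite le_eqVlt => /predU1P[->|st].
  by rewrite !subrr normr0 mulr0.
have zr z : z \in `[s, t]%R -> `|z| < r.
  by rewrite in_itv/= => /andP[sz zt]; rewrite ger0_norm; lra.
have dz z (zst : z \in `[s, t]%R) := is_derive_pseries c0 (zr z zst) cr.
have [|z zst] := @MVT R _ _ s t st (fun z zst => dz z (subset_itv_oo_cc zst)).
  by apply: derivable_within_continuous => z /dz [].
rewrite !E; [|by rewrite ger0_norm; lra..] => ->; move: zst; rewrite in_itv/= => /andP[sz zt].
have z0 : 0 <= z by lra.
rewrite normrM (ger0_norm (_ : 0 <= t - s)); last lra.
rewrite ler_wpM2r//; first lra.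
rewrite ger0_norm; last first.
  apply: pseries_lim_ge0 => //.
  by apply: is_cvg_pseries_inside cr' _; rewrite !ger0_norm//; lra.
by apply: le_pseries_lim => //; lra.
Qed.

End ModelSecondDerivative.

(** * Tails of measures in A *)

Section UnitInterval.
Variable R : realType.
Local Notation leb := lebesgue_measure.
Implicit Types (g : R -> R) (s t : R).

Lemma nondecreasing_in_measurable g :
  (forall s t, 0 <= s -> s <= t -> t <= 1 -> g s <= g t) ->
  measurable_fun (`[0, 1] : set R) g.
Proof.
(* Composition with the projection of the line onto [0,1] makes [g] monotone everywhere. *)
move=> gnd; pose cl x : R := Num.max 0 (Num.min x 1).
have cl01 x : 0 <= cl x /\ cl x <= 1.
  by rewrite /cl le_max lexx ge_max ler01 ge_min lexx orbT.
apply: (eq_measurable_fun (g \o cl)).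
  move=> x; rewrite inE/= in_itv/= => /andP[x0 x1].
  by rewrite /cl min_l// max_r.
apply: nondecreasing_measurable; first exact: measurable_itv.
move=> x y xy /=; have [x0 x1] := cl01 x; have [y0 y1] := cl01 y.
apply: gnd => //; rewrite /cl ge_max le_max lexx/= le_max.
by apply/orP; right; rewrite le_min !ge_min xy lexx !orbT.
Qed.

Lemma nonincreasing_in_measurable g :
  (forall s t, 0 <= s -> s <= t -> t <= 1 -> g t <= g s) ->
  measurable_fun (`[0, 1] : set R) g.
Proof.
move=> gni; rewrite -(opprK g); apply/measurable_funN.
by apply: nondecreasing_in_measurable => s t s0 st t1; rewrite lerN2 gni.
Qed.

Lemma lebesgue_itvE (b1 b2 : bool) s t : s <= t ->
  leb [set` Interval (BSide b1 s) (BSide b2 t)] = (t - s)%:E.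
Proof.
move=> st; rewrite lebesgue_measure_itv/= lte_fin.
case: ltP => [_|ts]; first by rewrite EFinB.
have -> : t = s by apply/eqP; rewrite eq_le st ts.
by rewrite subrr.
Qed.

Lemma bounded_integrable g (A : set R) M : measurable A -> (leb A < +oo)%E ->
  measurable_fun A g -> (forall x, A x -> `|g x| <= M) ->
  leb.-integrable A (EFin \o g).
Proof.
move=> mA finA mg gM; apply: measurable_bounded_integrable => //.
exists M; split; first by rewrite num_real.
by move=> M' MM' x Ax; apply: le_trans (gM x Ax) _; exact: ltW.
Qed.

End UnitInterval.

Section Tail.
Variable R : realType.
Local Notation leb := lebesgue_measure.
Implicit Types (nu : Aelt R) (s t : R).

(* [phi nu s] is the paper's nu[s,1]. *)
Definition phi nu s : R := atom nu + \int[leb]_(x in `[s, 1]) dens nu x.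

Section Fixed.
Variable nu : Aelt R.
Hypothesis nuA : inA nu.

Lemma dens_ge0 t : 0 <= t -> t <= 1 -> 0 <= dens nu t.
Proof. by case: nuA => d0 _ t0 t1; rewrite d0// t0. Qed.

Lemma dens_nd s t : 0 <= s -> s <= t -> t <= 1 -> dens nu s <= dens nu t.
Proof. by case: nuA => _ [+ _]; exact. Qed.

Lemma atom_ge0 : 0 <= atom nu.
Proof. by case: nuA => _ [_ [_ []]]. Qed.

Lemma dens_rcont t : 0 <= t < 1 -> dens nu @ at_right t --> dens nu t.
Proof. by case: nuA => _ [_ [+ _]]; exact. Qed.

Lemma measurable_dens : measurable_fun (`[0, 1] : set R) (dens nu).
Proof. exact: nondecreasing_in_measurable dens_nd. Qed.

Lemma integrable_dens b1 b2 s t : 0 <= s -> t <= 1 ->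
  leb.-integrable [set` Interval (BSide b1 s) (BSide b2 t)] (EFin \o dens nu).
Proof.
move=> s0 t1; have sub : [set` Interval (BSide b1 s) (BSide b2 t)] `<=` (`[0, 1] : set R).
  move=> x /=; rewrite in_itv => /andP[]; case: b1 b2 => -[] /= h1 h2.
  - by rewrite in_itv/=; lra.
  - by rewrite in_itv/=; lra.
  - by rewrite in_itv/=; lra.
  - by rewrite in_itv/=; lra.
apply: (@bounded_integrable _ _ _ (dens nu 1)) => //.
- apply: (@le_lt_trans _ _ (leb (`[0, 1] : set R))).
    by apply: le_measure => //; rewrite inE//=; exact: measurable_itv.
  by rewrite lebesgue_itvE ?ler01// ltry.
- exact: measurable_funS sub measurable_dens.
- move=> x /sub /=; rewrite in_itv/= => /andP[x0 x1].
  by rewrite ger0_norm ?dens_ge0// dens_nd.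
Qed.

Lemma phiB s t : 0 <= s -> s <= t -> t <= 1 ->
  phi nu s - phi nu t = \int[leb]_(x in `[s, t[) dens nu x.
Proof.
move=> s0 st t1; rewrite /phi.
have -> : (`[s, 1] : set R) = `[s, t[ `|` `[t, 1].
  by rewrite -itv_bndbnd_setU// bnd_simp.
rewrite Rintegral_setU//=.
- by rewrite opprD addrACA subrr add0r addrK.
- by rewrite -itv_bndbnd_setU ?bnd_simp//; exact: integrable_dens.
- apply/disj_setPS => x /=; rewrite !in_itv/= => -[/andP[_ xt] /andP[tx _]].
  by rewrite ltNge tx in xt.
Qed.

Lemma le_phiB M s t : 0 <= s -> s <= t -> t <= 1 ->
  (forall x, s <= x < t -> dens nu x <= M) -> phi nu s - phi nu t <= M * (t - s).
Proof.
move=> s0 st t1 dM; rewrite phiB//.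
have -> : M * (t - s) = \int[leb]_(x in `[s, t[) (cst M x).
  by rewrite Rintegral_cst//= lebesgue_itvE.
apply: le_Rintegral => //; first exact: integrable_dens.
  apply: (@bounded_integrable _ _ _ `|M|) => //.
  by rewrite /= lebesgue_itvE// ltry.
Qed.

Lemma ge_phiB M s t : 0 <= s -> s <= t -> t <= 1 ->
  (forall x, s <= x < t -> M <= dens nu x) -> M * (t - s) <= phi nu s - phi nu t.
Proof.
move=> s0 st t1 dM; rewrite phiB//.
have -> : M * (t - s) = \int[leb]_(x in `[s, t[) (cst M x).
  by rewrite Rintegral_cst//= lebesgue_itvE.
apply: le_Rintegral => //.
- apply: (@bounded_integrable _ _ _ `|M|) => //.
  by rewrite /= lebesgue_itvE// ltry.
- exact: integrable_dens.
Qed.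

Lemma phi_chord_ge s t : 0 <= s -> s <= t -> t <= 1 ->
  dens nu s * (t - s) <= phi nu s - phi nu t.
Proof.
move=> s0 st t1; apply: ge_phiB => // x /andP[sx xt].
by rewrite dens_nd// (le_trans _ t1)// ltW.
Qed.

Lemma phi_chord_le s t : 0 <= s -> s <= t -> t <= 1 ->
  phi nu s - phi nu t <= dens nu t * (t - s).
Proof.
move=> s0 st t1; apply: le_phiB => // x /andP[sx xt].
by rewrite dens_nd// ?(le_trans s0)// ltW.
Qed.

Lemma phi_ni s t : 0 <= s -> s <= t -> t <= 1 -> phi nu t <= phi nu s.
Proof.
move=> s0 st t1; rewrite -subr_ge0 (le_trans _ (phi_chord_ge s0 st t1))//.
by rewrite mulr_ge0 ?subr_ge0// dens_ge0// (le_trans st).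
Qed.

Lemma phi1 : phi nu 1 = atom nu.
Proof. by rewrite /phi set_itv1 Rintegral_set1 addr0. Qed.

Lemma atom_le_phi s : 0 <= s -> s <= 1 -> atom nu <= phi nu s.
Proof. by move=> s0 s1; rewrite -phi1 phi_ni. Qed.

Lemma phi_ge0 s : 0 <= s -> s <= 1 -> 0 <= phi nu s.
Proof. by move=> s0 s1; rewrite (le_trans atom_ge0)// atom_le_phi. Qed.

Lemma measurable_phi : measurable_fun (`[0, 1] : set R) (phi nu).
Proof. exact: nonincreasing_in_measurable phi_ni. Qed.

(** The density at t separates the slopes of the chords on its two sides. *)
Lemma phi_concave s t u : 0 <= s -> s <= t -> t <= u -> u <= 1 ->
  (phi nu s - phi nu t) * (u - t) <= (phi nu t - phi nu u) * (t - s).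
Proof.
move=> s0 st tu u1.
apply: (@le_trans _ _ (dens nu t * (t - s) * (u - t))).
  by rewrite ler_wpM2r ?subr_ge0// phi_chord_le// (le_trans tu).
by rewrite mulrAC ler_wpM2r ?subr_ge0// phi_chord_ge// (le_trans s0).
Qed.

(** A nondecreasing density is at most its mean over [t,1]. Hence a bound on the mass bounds the
    density on compact subsets of [0,1), though not up to 1. *)
Lemma dens_phi0 t : 0 <= t -> t < 1 -> dens nu t <= phi nu 0 / (1 - t).
Proof.
move=> t0 t1; rewrite ler_pdivlMr ?subr_gt0//.
apply: (le_trans (phi_chord_ge t0 (ltW t1) (lexx _))).
apply: (@le_trans _ _ (phi nu t)); last by rewrite phi_ni// ltW.
by rewrite gerBl phi1 atom_ge0.
Qed.

Lemma phi_lipschitz M s t : 0 <= s -> s <= t -> t <= 1 ->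
  (forall x, s <= x < t -> dens nu x <= M) -> `|phi nu t - phi nu s| <= M * (t - s).
Proof.
move=> s0 st t1 dM; rewrite distrC ger0_norm ?le_phiB// subr_ge0.
exact: phi_ni.
Qed.

Lemma nuintE s : 0 <= s -> s <= 1 -> nuint nu s = (phi nu s)%:E.
Proof.
move=> s0 s1; rewrite /nuint /Ameas.
have -> : `[s, 1] `&` `[0, 1] = (`[s, 1] : set R).
  by apply/setIidl => x /=; rewrite !in_itv/=; lra.
rewrite indicE mem_set/= ?in_itv/= ?s1 ?lexx// mulr1 /phi EFinD addeC.
rewrite /Rintegral fineK//; apply: integrable_fin_num => //.
exact: integrable_dens.
Qed.

End Fixed.

(** Chord slopes shrinking to s recover the right-continuous density, and the atom is the left limit
    of the tail at 1, because the density is bounded by its value at 1. *)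
Lemma phi_inj nu nu' : inA nu -> inA nu' ->
  (forall s, 0 <= s < 1 -> phi nu s = phi nu' s) ->
  (forall s, 0 <= s < 1 -> dens nu s = dens nu' s) /\ atom nu = atom nu'.
Proof.
move=> nuA nuA' E.
have le_dens m m' : inA m -> inA m' ->
    (forall s, 0 <= s < 1 -> phi m s = phi m' s) ->
    forall s, 0 <= s < 1 -> dens m s <= dens m' s.
  move=> mA mA' E' s /andP[s0 s1].
  have ms : 0 <= s < 1 by rewrite s0.
  apply: (cvgr_to_ge (dens_rcont mA' ms)); near=> t.
  have st : s < t by near: t; exact: nbhs_right_gt.
  have t1 : t < 1 by near: t; exact: nbhs_right_lt.
  have ts : 0 < t - s by rewrite subr_gt0.
  rewrite -(ler_pM2r ts) (le_trans (phi_chord_ge mA s0 (ltW st) (ltW t1)))//.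
  rewrite !E' ?(ltW st) ?t1 ?s0 ?(le_trans s0 (ltW st))//.
  by apply: phi_chord_le => //; exact: ltW.
have le_atom m m' : inA m -> inA m' ->
    (forall s, 0 <= s < 1 -> phi m s = phi m' s) -> atom m <= atom m'.
  move=> mA mA' E'; apply/ler_addgt0Pr => e e0.
  have D0 : 0 <= dens m' 1 by rewrite dens_ge0.
  (* On [1 - u, 1] the absolutely continuous part of [m'] has mass at most e. *)
  pose u := Num.min 1 (e / (dens m' 1 + 1)).
  have eD : 0 < e / (dens m' 1 + 1) by rewrite divr_gt0// ltr_wpDl.
  have u0 : 0 < u by rewrite lt_min ltr01 eD.
  have u1 : u <= 1 by rewrite ge_min lexx.
  have ue : u <= e / (dens m' 1 + 1) by rewrite ge_min lexx orbT.
  have t1 : 1 - u < 1 by rewrite ltrBlDr ltrDl.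
  have t0 : 0 <= 1 - u by rewrite subr_ge0.
  rewrite (le_trans (atom_le_phi mA t0 (ltW t1)))// E' ?t0//.
  have := phi_chord_le mA' t0 (ltW t1) (lexx _).
  rewrite phi1//; move: ue; rewrite ler_pdivlMr ?ltr_wpDl// => ue.
  have -> : dens m' 1 * (1 - (1 - u)) = u * (dens m' 1 + 1) - u by ring.
  lra.
split=> [s s01|]; apply/eqP; rewrite eq_le; apply/andP; split.
- exact: le_dens.
- by apply: le_dens => // t t01; rewrite E.
- exact: le_atom.
- by apply: le_atom => // t t01; rewrite E.
Unshelve. all: by end_near. Qed.

(** The densities may differ at 1; this null point is removed before the integrals are compared. *)
Lemma Aeq_dens nu nu' : inA nu -> inA nu' ->
  (forall s, 0 <= s < 1 -> dens nu s = dens nu' s) -> atom nu = atom nu' ->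
  Aeq nu nu'.
Proof.
move=> nuA nuA' E1 E2 B mB; rewrite /Ameas E2; congr (_ + _)%E.
have m01 : measurable (`[0, 1] : set R) by exact: measurable_itv.
have mI m : inA m -> measurable_fun ((B `&` `[0, 1]) `\ 1) (EFin \o dens m).
  move=> mA; apply/measurable_EFinP; apply: measurable_funS (measurable_dens mA) => //.
  by move=> x [[]].
have mD : measurable ((B `&` `[0, 1]) `\ (1 : R)).
  by apply: measurableD => //; exact: measurableI.
rewrite -[LHS](@integral_setD1 _ _ 1)//; last exact: mI.
rewrite -[RHS](@integral_setD1 _ _ 1)//; last exact: mI.
apply: eq_integral => x; rewrite inE/= in_itv/= => -[[_ /andP[x0 x1]] xn1].
by rewrite E1// x0 lt_neqAle x1 andbT; apply/eqP.
Qed.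

Lemma Aeq_phi nu nu' : inA nu -> inA nu' ->
  (forall s, 0 <= s < 1 -> phi nu s = phi nu' s) -> Aeq nu nu'.
Proof.
by move=> nuA nuA' /(phi_inj nuA nuA')[E1 E2]; exact: Aeq_dens.
Qed.

End Tail.

(** * Shifts, midpoints and splices inside A *)

Section Constructions.
Variable R : realType.
Local Notation leb := lebesgue_measure.
Implicit Types (nu : Aelt R) (s t c M tau : R).

(* Left limits are automatic for a monotone density. *)
Lemma inA_intro (m : R -> R) c :
  (forall t, 0 <= t <= 1 -> 0 <= m t) ->
  (forall s t, 0 <= s -> s <= t -> t <= 1 -> m s <= m t) ->
  (forall t, 0 <= t < 1 -> m @ at_right t --> m t) ->
  0 <= c -> inA (MkA m c).
Proof.
move=> m0 mnd mrc c0; split=> //; split=> //; split=> //; split=> //= t /andP[t0 t1].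
have near0 : \forall u \near t^'-, 0 < u by exact: nbhs_left_gt.
apply: nondecreasing_at_left_is_cvgr; apply: filterS near0 => u u0.
  move=> x y; rewrite !in_itv/= => /andP[ux xt] /andP[uy yt] xy.
  by apply: mnd => //; lra.
exists (m t); move=> y [x /=]; rewrite in_itv/= => /andP[ux xt] <-.
by apply: mnd; lra.
Qed.

Lemma inA_shift nu c : inA nu -> 0 <= c -> inA (MkA (dens nu) (atom nu + c)).
Proof.
move=> [m0 [mnd [mrc [mlc a0]]]] c0; split=> //; split=> //; split=> //.
by split=> //=; rewrite addr_ge0.
Qed.

Lemma phi_shift nu c s : phi (MkA (dens nu) (atom nu + c)) s = phi nu s + c.
Proof. by rewrite /phi/= addrAC. Qed.

Definition Amid nu nu' :=
  MkA (fun x => (dens nu x + dens nu' x) / 2) ((atom nu + atom nu') / 2).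

Lemma inA_mid nu nu' : inA nu -> inA nu' -> inA (Amid nu nu').
Proof.
move=> nuA nuA'; apply: inA_intro.
- by move=> t /andP[t0 t1]; rewrite divr_ge0// addr_ge0// dens_ge0.
- by move=> s t s0 st t1; rewrite ler_wpM2r// lerD// dens_nd.
- move=> t t01; apply: cvgMl; apply: cvgD; exact: dens_rcont.
- by rewrite divr_ge0// addr_ge0// atom_ge0.
Qed.

Lemma phi_mid nu nu' s : inA nu -> inA nu' -> 0 <= s ->
  phi (Amid nu nu') s = (phi nu s + phi nu' s) / 2.
Proof.
move=> nuA nuA' s0; rewrite /phi/=.
have i1 := integrable_dens nuA true false s0 (lexx 1).
have i2 := integrable_dens nuA' true false s0 (lexx 1).
rewrite RintegralZr//; last first.
  by apply: (integrableD _ i1 i2); exact: measurable_itv.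
by rewrite RintegralD//; field.
Qed.

(** Serves twice: with the density bound M of the truncation, and with M = beta and c = 0 for the
    recovery sequence. *)
Definition splice nu tau M c := MkA (fun x => if x < tau then dens nu x else M) c.

Section Splice.
Variables (nu : Aelt R) (tau M c : R).
Hypotheses (nuA : inA nu) (M0 : 0 <= M) (c0 : 0 <= c) (tau1 : tau <= 1).
Hypothesis nuM : forall x, 0 <= x -> x < tau -> dens nu x <= M.

Lemma inA_splice : inA (splice nu tau M c).
Proof.
apply: inA_intro => //.
- by move=> t /andP[t0 t1]; case: ifP => // _; rewrite dens_ge0.
- move=> s t s0 st t1; case: (ltP s tau) => stau; case: (ltP t tau) => ttau //.
  + by rewrite dens_nd.
  + by rewrite nuM.
  + by have := lt_le_trans ttau (le_trans stau st); rewrite ltxx.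
- move=> t /andP[t0 t1]; case: ifPn => ttau.
    have t01 : 0 <= t < 1 by rewrite t0.
    apply: cvg_trans (dens_rcont nuA t01).
    apply: near_eq_cvg; near=> u.
    have ut : u < tau by near: u; exact: nbhs_right_lt.
    by rewrite ut.
  apply: cvg_near_cst; near=> u.
  have tu : t < u by near: u; exact: nbhs_right_gt.
  by rewrite ifF//; apply: contraNF ttau => /(lt_trans tu).
Unshelve. all: by end_near. Qed.

Lemma phi_splice_ge s : 0 <= s -> tau <= s -> s <= 1 ->
  phi (splice nu tau M c) s = c + M * (1 - s).
Proof.
move=> s0 ts s1.
have H x : s <= x < 1 -> dens (splice nu tau M c) x = M.
  by move=> /andP[sx _] /=; rewrite ifF//; apply/negbTE; rewrite -leNgt (le_trans ts).
have p1 := phi1 (splice nu tau M c).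
have := @le_phiB _ _ inA_splice M s 1 s0 s1 (lexx _).
have := @ge_phiB _ _ inA_splice M s 1 s0 s1 (lexx _).
rewrite p1/= => h1 h2.
have {}h1 : M * (1 - s) <= phi (splice nu tau M c) s - c by apply: h1 => x /H /= ->.
have {}h2 : phi (splice nu tau M c) s - c <= M * (1 - s) by apply: h2 => x /H /= ->.
lra.
Qed.

Lemma phi_splice_le s : 0 <= s -> s <= tau ->
  phi (splice nu tau M c) s = c + M * (1 - tau) + phi nu s - phi nu tau.
Proof.
move=> s0 st; have t0 := le_trans s0 st.
rewrite -(phi_splice_ge t0 (lexx _) tau1) -addrA.
rewrite (phiB nuA s0 st tau1) -[LHS](subrK (phi (splice nu tau M c) tau)).
rewrite (phiB inA_splice s0 st tau1) addrC; congr (_ + _).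
apply: eq_Rintegral => x; rewrite inE/= in_itv/= => /andP[_ xt].
by rewrite xt.
Qed.

End Splice.

Lemma inA_cst M c : 0 <= M -> 0 <= c -> inA (MkA (cst M) c).
Proof. by move=> M0 c0; apply: inA_intro => // t _; exact: cvg_cst. Qed.

Lemma phi_cst M c s : 0 <= M -> 0 <= c -> 0 <= s -> s <= 1 ->
  phi (MkA (cst M) c) s = c + M * (1 - s).
Proof.
move=> M0 c0 s0 s1; have nuA := inA_cst M0 c0.
have := le_phiB nuA s0 s1 (lexx _) (fun x _ => lexx M).
have := ge_phiB nuA s0 s1 (lexx _) (fun x _ => lexx M).
by rewrite phi1 /=; lra.
Qed.

End Constructions.

(** * The functional of the tail *)

Section LiminfExtra.
Variable R : realType.
Implicit Types u v : (\bar R)^nat.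

Lemma le_limn_einf u v : (forall n, (u n <= v n)%E) ->
  (limn_einf u <= limn_einf v)%E.
Proof.
move=> uv; rewrite !limn_einf_lim; apply: lee_lim; [exact: is_cvg_einfs..|].
near=> n; apply: le_ereal_inf_tmp => _ [m /= nm <-].
by apply: le_trans (uv m); apply: ereal_inf_lbound; exists m.
Unshelve. all: by end_near. Qed.

End LiminfExtra.

Section Inverse.
Context d (T : measurableType d) (R : realType).

Lemma measurable_inve (D : set T) (f : T -> R) : measurable D ->
  (forall x, D x -> 0 <= f x) -> measurable_fun D f ->
  measurable_fun D (fun x => ((f x)%:E^-1)%E).
Proof.
move=> mD f0 mf.
(* Away from 0 the inverse is exp(-ln), a composition of measurable maps; 0 is the one value sent to
   [+oo]. *)
apply: (eq_measurable_fun (fun x => if f x == 0 then +oo%E else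
    (expR (- ln (f x)))%:E)).
  move=> x; rewrite inE => Dx; rewrite inver; case: ifPn => // fx0.
  by rewrite expRN lnK// posrE lt_neqAle eq_sym fx0 f0.
apply: measurable_fun_if => //.
- exact: measurable_fun_eqr.
- apply: measurable_funS mD _ _ => //.
  apply/measurable_EFinP; apply: measurableT_comp => //.
  by apply: measurable_funN; apply: measurableT_comp.
Qed.

End Inverse.

Section Functional.
Variable R : realType.
Local Notation leb := lebesgue_measure.
Local Notation I01 := (`[0%R, 1%R[%classic : set R).
Implicit Types (w f g : R -> R) (H k s : R).

(* With w = xi'' and k = 1/beta this is F_beta seen as a functional of
   f = nu[.,1]; with k = 0 it is GS. *)
Definition Jint w H k f s : \bar R :=
  ((w s * f s + H * f 0)%:E + ((f s)%:E^-1 - (k / (1 - s))%:E))%E.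

Definition J w H k f : \bar R := (\int[leb]_(s in I01) Jint w H k f s)%E.

(** The second condition says that 1/f - k/(1-s) is nonnegative, which is what monotone comparison
    of integrals and Fatou's lemma require. *)
Definition tame k f := measurable_fun I01 f /\
  forall s, 0 <= s < 1 -> 0 <= f s /\ k * f s <= 1 - s.

Lemma invB_ge0 k f s : tame k f -> 0 <= s < 1 ->
  (0 <= (f s)%:E^-1 - (k / (1 - s))%:E)%E.
Proof.
move=> [_ tf] s01; have [f0 kf] := tf s s01.
rewrite inver; case: eqVneq => [_|fn0]; first by rewrite addye.
have fp : 0 < f s by rewrite lt_neqAle eq_sym fn0.
have s1 : 0 < 1 - s by case/andP: s01 => _; rewrite subr_gt0.
by rewrite -EFinB lee_fin subr_ge0 ler_pdivrMr// mulrC ler_pdivlMr.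
Qed.

Section Weights.
Variables (w : R -> R) (H : R).
Hypotheses (w0 : forall s, 0 <= s < 1 -> 0 <= w s) (mw : measurable_fun I01 w).
Hypothesis H0 : 0 <= H.

Lemma Jint_ge0 k f s : tame k f -> I01 s -> (0 <= Jint w H k f s)%E.
Proof.
move=> tf; rewrite /= in_itv/= => s01.
rewrite adde_ge0 ?invB_ge0// lee_fin addr_ge0// mulr_ge0// ?w0//.
  by have [] := tf.2 s s01.
by have [] := tf.2 0 (_ : 0 <= 0 < 1); rewrite ?lexx ?ltr01.
Qed.

Lemma measurable_Jint k f : tame k f -> measurable_fun I01 (Jint w H k f).
Proof.
move=> [mf tf]; apply: emeasurable_funD.
  apply/measurable_EFinP; apply: measurable_funD; last exact: measurable_cst.
  exact: measurable_funM.
apply: emeasurable_funD.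
  apply: measurable_inve => // s; rewrite /= in_itv/= => s01.
  by have [] := tf s s01.
apply: measurableT_comp => //; apply/measurable_EFinP.
apply: measurable_funM => //.
apply: (eq_measurable_fun (fun s => expR (- ln (1 - s)))).
  move=> s; rewrite inE/= in_itv/= => /andP[_ s1].
  by rewrite expRN lnK// posrE subr_gt0.
apply: measurableT_comp => //; apply: measurable_funN.
by apply: measurableT_comp => //; apply: measurable_funB.
Qed.

Lemma J_ge0 k f : tame k f -> (0 <= J w H k f)%E.
Proof. by move=> tf; apply: integral_ge0 => s; exact: Jint_ge0. Qed.

End Weights.

(** The exact gap is (a-b)^2 / (ab(a+b)), and ab(a+b) <= 2K^3. *)
Lemma inv_midpoint_gap (a b K : R) : 0 < a -> 0 < b -> a <= K -> b <= K ->
  ((a + b) / 2)^-1 + ((a + b) / 2)^-1 + (a - b) ^+ 2 / (2 * K ^+ 3) <= a^-1 + b^-1.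
Proof.
move=> a0 b0 aK bK; have K0 : 0 < K by exact: lt_le_trans aK.
have ab0 : 0 < a + b by rewrite addr_gt0.
have -> : a^-1 + b^-1 = ((a + b) / 2)^-1 + ((a + b) / 2)^-1 +
    (a - b) ^+ 2 / (a * b * (a + b)).
  by field; rewrite !gt_eqF.
rewrite lerD2l ler_wpM2l ?sqr_ge0// lef_pV2 ?posrE ?mulr_gt0// ?exprn_gt0//.
have -> : 2 * K ^+ 3 = K * K * (K + K) by ring.
by rewrite ler_pM ?mulr_ge0 ?ler_pM ?lerD// ltW.
Qed.

Lemma J_gap w H k f g m K : (forall s, 0 <= s < 1 -> 0 <= w s) ->
  measurable_fun I01 w -> 0 <= H -> 0 < K -> tame k f -> tame k g ->
  (forall s, 0 <= s < 1 -> f s <= K /\ g s <= K) ->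
  (forall s, 0 <= s < 1 -> m s = (f s + g s) / 2) ->
  (J w H k m + J w H k m +
    \int[leb]_(s in I01) ((f s - g s) ^+ 2 / (2 * K ^+ 3))%:E
   <= J w H k f + J w H k g)%E.
Proof.
move=> w0 mw H0 K0 tf tg fgK mE.
have tm : tame k m.
  split.
    apply: (eq_measurable_fun (fun s => (f s + g s) / 2)).
      by move=> s; rewrite inE/= in_itv/= => /mE.
    by apply: measurable_funM => //; apply: measurable_funD; [exact: tf.1|exact: tg.1].
  move=> s s01; have [f0 kf] := tf.2 s s01; have [g0 kg] := tg.2 s s01.
  by rewrite mE//; split; lra.
have mgap : measurable_fun I01 (fun s => ((f s - g s) ^+ 2 / (2 * K ^+ 3))%:E).
  apply/measurable_EFinP; apply: measurable_funM => //.
  apply: measurable_funX; apply: measurable_funB; [exact: tf.1|exact: tg.1].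
have gap0 s : I01 s -> (0 <= ((f s - g s) ^+ 2 / (2 * K ^+ 3))%:E)%E.
  by move=> _; rewrite lee_fin divr_ge0 ?sqr_ge0// mulr_ge0// exprn_ge0// ltW.
have Jm0 s := @Jint_ge0 w H w0 H0 k m s tm.
have mJm := measurable_Jint H mw tm.
have mI : measurable I01 by exact: measurable_itv.
have Jf0 s := @Jint_ge0 w H w0 H0 k f s tf.
have Jg0 s := @Jint_ge0 w H w0 H0 k g s tg.
have mJf := measurable_Jint H mw tf.
have mJg := measurable_Jint H mw tg.
have -> : (J w H k f + J w H k g =
    \int[leb]_(s in I01) (Jint w H k f s + Jint w H k g s))%E.
  by rewrite ge0_integralD.
have -> : (J w H k m + J w H k m =
    \int[leb]_(s in I01) (Jint w H k m s + Jint w H k m s))%E.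
  by rewrite ge0_integralD.
rewrite -ge0_integralD//; last 2 first.
- by move=> s Is; rewrite adde_ge0// Jm0.
- exact: emeasurable_funD.
apply: ge0_le_integral => //.
- by move=> s Is; rewrite adde_ge0 ?gap0// adde_ge0// Jm0.
- by apply: emeasurable_funD => //; exact: emeasurable_funD.
- by apply: emeasurable_funD; exact: measurable_Jint.
move=> s; rewrite /= in_itv/= => s01; rewrite /Jint.
have [f0 kf] := tf.2 s s01; have [g0 kg] := tg.2 s s01.
have [fK gK] := fgK s s01.
have m0E : m 0 = (f 0 + g 0) / 2 by rewrite mE ?lexx ?ltr01.
have Jy (r c : R) : (r%:E + ((0 : R)%:E^-1 - c%:E) = +oo)%E by rewrite inver eqxx.
have Jn h : tame k h ->
    ((w s * h s + H * h 0)%:E + ((h s)%:E^-1 - (k / (1 - s))%:E) != -oo)%E.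
  move=> th; rewrite -ltNye; apply: lt_le_trans (leeDl _ (invB_ge0 th s01)).
  exact: ltNyr.
(* Where [f] or [g] vanishes the right-hand side is [+oo], the other summand being different from
   [-oo] by [Jn]; elsewhere everything is real. *)
have [fs0|fn0] := eqVneq (f s) 0.
  by rewrite [X in (_ <= X + _)%E](_ : _ = +oo%E) ?addye ?leey ?Jn// fs0 Jy.
have [gs0|gn0] := eqVneq (g s) 0.
  by rewrite [X in (_ <= _ + X)%E](_ : _ = +oo%E) ?addey ?leey ?Jn// gs0 Jy.
have fp : 0 < f s by rewrite lt_neqAle eq_sym fn0.
have gp : 0 < g s by rewrite lt_neqAle eq_sym gn0.
have mp : 0 < m s by rewrite mE// divr_gt0// addr_gt0.
rewrite !inver !gt_eqF// -!EFinB -!EFinD lee_fin m0E mE//.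
have := inv_midpoint_gap fp gp fK gK.
set x := _^-1; set y := _^-1; set z := (f s)^-1; set t := _ / (2 * _).
lra.
Qed.

(** Almost minimizers are close in L^2: the two values exceed twice the lower bound v by at most 2a,
    while the gap carries the factor 1/(2K^3). *)
Lemma J_gap_le w H k f g m K v a : (forall s, 0 <= s < 1 -> 0 <= w s) ->
  measurable_fun I01 w -> 0 <= H -> 0 < K -> tame k f -> tame k g ->
  (forall s, 0 <= s < 1 -> f s <= K /\ g s <= K) ->
  (forall s, 0 <= s < 1 -> m s = (f s + g s) / 2) ->
  (v%:E <= J w H k m)%E -> (J w H k f <= (v + a)%:E)%E -> (J w H k g <= (v + a)%:E)%E ->
  (\int[leb]_(s in I01) ((f s - g s) ^+ 2)%:E <= (4 * K ^+ 3 * a)%:E)%E.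
Proof.
move=> w0 mw H0 K0 tf tg fgK mE vm fv gv.
have := J_gap w0 mw H0 K0 tf tg fgK mE.
have K3 : 0 < 2 * K ^+ 3 by rewrite mulr_gt0// exprn_gt0.
under eq_integral do rewrite mulrC EFinM.
rewrite ge0_integralZl//; last 3 first.
- apply/measurable_EFinP; apply: measurable_funX; apply: measurable_funB.
    exact: tf.1.
  exact: tg.1.
- by move=> s _; rewrite lee_fin sqr_ge0.
- by rewrite lee_fin invr_ge0 ltW.
move=> h.
set I := (\int[_]_(_ in _) _)%E in h *.
have {h} : ((v + v)%:E + ((2 * K ^+ 3)^-1)%:E * I <= (v + a + (v + a))%:E)%E.
  apply: (le_trans _ (le_trans h _)); last by rewrite EFinD leeD.
  by rewrite leeD2r// EFinD leeD.
rewrite -leeBrDl// -EFinB lee_pdivrMl// -EFinM => /le_trans; apply.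
by rewrite lee_fin; lra.
Qed.

(** If |f(s)| were at least d, the Lipschitz bound would keep |f| above d/2 on an interval inside
    [u,v] of length the minimum in the statement, and the integral would be too large. *)
Lemma L2_pointwise f u v s L d : 0 <= u -> u < v -> v <= 1 -> u <= s <= v -> 0 < L ->
  measurable_fun I01 f -> 0 < d ->
  (forall x y, u <= x -> x <= y -> y <= v -> `|f y - f x| <= L * (y - x)) ->
  (\int[leb]_(x in I01) ((f x) ^+ 2)%:E <
     ((d / 2) ^+ 2 * Num.min ((v - u) / 2) (d / (2 * L)))%:E)%E ->
  `|f s| < d.
Proof.
move=> u0 uv v1 /andP[us sv] L0 mf d0 fL; apply: contraTT; rewrite -!leNgt => dfs.
set l := Num.min _ _.
have l0 : 0 < l by rewrite lt_min !divr_gt0 ?subr_gt0// mulr_gt0.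
have [l1 l2] : l <= (v - u) / 2 /\ l <= d / (2 * L) by rewrite !ge_min !lexx orbT.
have Ll : L * l <= d / 2.
  by rewrite (le_trans (ler_wpM2l (ltW L0) l2))// -[leRHS]mul1r le_eqVlt; apply/orP; left; apply/eqP; field; rewrite gt_eqF.
(* The interval starts or ends at s; since l <= (v-u)/2, there is room on at least one side. *)
have [a [ua av as_]] : exists a, [/\ u <= a, a + l <= v & forall x, a <= x <= a + l -> `|f x - f s| <= d / 2].
  have [h|h] := leP ((v - u) / 2) (v - s).
    exists s; split => //; first lra.
    move=> x /andP[sx xl]; rewrite (le_trans (fL _ _ us sx _))//; first lra.
    by rewrite (le_trans _ Ll)// ler_wpM2l; lra.
  exists (s - l); split => //; [lra|lra|].
  move=> x /andP[sx xl]; rewrite distrC (le_trans (fL _ _ _ _ sv))//; [lra|lra|].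
  by rewrite (le_trans _ Ll)// ler_wpM2l; lra.
have sub : (`[a, a + l[ : set R) `<=` I01.
  by move=> x /=; rewrite !in_itv/=; lra.
apply: (@le_trans _ _ (\int[leb]_(x in (`[a, (a + l)%R[ : set R)) ((f x) ^+ 2)%:E)%E).
  apply: (@le_trans _ _ (\int[leb]_(x in (`[a, (a + l)%R[ : set R)) (cst ((d / 2) ^+ 2)%:E x))%E).
    rewrite integral_cst//= lebesgue_itvE; last by rewrite lerDl ltW.
    by rewrite addrAC subrr add0r -EFinM.
  apply: ge0_le_integral => //.
  - by move=> x _; rewrite lee_fin sqr_ge0.
  - apply/measurable_EFinP; apply: measurable_funX.
    exact: measurable_funS sub mf.
  - move=> x; rewrite /= in_itv/= => /andP[ax xal]; rewrite lee_fin.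
    have h := as_ x (introT andP (conj ax (ltW xal))).
    have h' : d / 2 <= `|f x|.
      have := ler_normD (f s - f x) (f x); rewrite subrK distrC; lra.
    by rewrite -[leRHS]real_normK ?num_real// lerXn2r ?nnegrE//; lra.
apply: ge0_subset_integral => //.
- by apply/measurable_EFinP; apply: measurable_funX.
- by move=> x _; rewrite lee_fin sqr_ge0.
Qed.

End Functional.

(** * Lower semicontinuity and existence of minimizers *)

Section LowerSemicontinuity.
Variable R : realType.
Local Notation leb := lebesgue_measure.
Local Notation I01 := (`[0%R, 1%R[%classic : set R).

Lemma cvg_inve (u : nat -> R) (l : R) : (forall n, 0 <= u n) ->
  u @ \oo --> l -> (fun n => (u n)%:E^-1)%E @ \oo --> (l%:E^-1)%E.
Proof.
move=> u0 ul.
have l0 : 0 <= l by apply: (cvgr_to_ge ul); near=> n.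
have [ln0|lp] := eqVneq l 0.
  rewrite ln0 inver eqxx; apply/cvgeyPgt => A; near=> n.
  rewrite inver; case: eqVneq => [_|un0]; first exact: ltry.
  have un : 0 < u n by rewrite lt_neqAle eq_sym un0 u0.
  have A1 : 0 < `|A| + 1 by rewrite ltr_wpDl.
  rewrite lte_fin (@lt_le_trans _ _ (`|A| + 1))//.
    by rewrite (le_lt_trans (ler_norm A))// ltrDl.
  rewrite -[leLHS]invrK lef_pV2 ?posrE ?invr_gt0//.
  near: n; apply: (cvgr_le l) => //.
  by rewrite ln0 invr_gt0.
have l1 : 0 < l by rewrite lt_neqAle eq_sym lp.
rewrite inver gt_eqF//.
apply: (@cvg_trans _ (((u n)^-1)%:E @[n --> \oo])).
  apply: near_eq_cvg; near=> n; rewrite inver gt_eqF//.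
  by near: n; apply: (cvgr_gt l).
by apply: cvg_EFin; [exact: nearW|exact: cvgV].
Unshelve. all: by end_near. Qed.

Lemma J_lsc (w_ : nat -> R -> R) w (H_ : nat -> R) H (k_ : nat -> R) k
    (f_ : nat -> R -> R) f (F : (\bar R)^nat) :
  (forall n s, 0 <= s < 1 -> 0 <= w_ n s) -> (forall n, measurable_fun I01 (w_ n)) ->
  (forall n, 0 <= H_ n) ->
  (forall s, 0 <= s < 1 -> w_ ^~ s @ \oo --> w s) -> H_ @ \oo --> H -> k_ @ \oo --> k ->
  (forall n s, 0 <= s < 1 -> 0 <= f_ n s) ->
  (forall s, 0 <= s < 1 -> f_ ^~ s @ \oo --> f s) ->
  (forall s, 0 <= s < 1 -> 0 <= w s) -> measurable_fun I01 w -> 0 <= H -> tame k f ->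
  (forall n, F n = +oo%E \/
     tame (k_ n) (f_ n) /\ F n = J (w_ n) (H_ n) (k_ n) (f_ n)) ->
  (J w H k f <= limn_einf F)%E.
Proof.
move=> w0_ mw_ H0_ cw cH ck f0_ cf w0 mw H0 tf FE.
(* Where [F n] is infinite, [f_ n] may fail to be tame; the constant integrand [+oo] keeps Fatou's
   lemma applicable to the whole sequence. *)
pose g n s : \bar R := if F n == +oo%E then +oo%E
  else Jint (w_ n) (H_ n) (k_ n) (f_ n) s.
have Fg n : (\int[leb]_(s in I01) g n s <= F n)%E.
  by rewrite /g; case: (F n =P +oo%E) => [->|Fn]; [exact: leey|case: (FE n) => // -[_ ->]].
have g0 n s : I01 s -> (0 <= g n s)%E.
  rewrite /g; case: (F n =P +oo%E) => // Fn Is; case: (FE n) => // -[tn _].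
  by apply: Jint_ge0 => //; exact: w0_.
have mg n : measurable_fun I01 (g n).
  rewrite /g; case: (F n =P +oo%E) => [_|Fn]; first exact: measurable_cst.
  by case: (FE n) => // -[tn _]; exact: measurable_Jint.
have mI : measurable I01 by exact: measurable_itv.
have mliminf : measurable_fun I01 (fun s => limn_einf (g ^~ s)).
  rewrite /limn_einf; apply: measurableT_comp => //.
  apply: measurable_fun_limn_esup => n.
  exact: measurableT_comp.
have fat := @fatou _ _ _ leb _ mI _ mg g0.
have le1 := le_limn_einf Fg.
refine (le_trans _ (le_trans fat le1)).
apply: ge0_le_integral => //.
- by move=> s; exact: Jint_ge0.
- exact: measurable_Jint.
move=> s; rewrite /= in_itv/= => s01.
have z01 : 0 <= (0 : R) < 1 by rewrite lexx ltr01.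
have c : (fun n => Jint (w_ n) (H_ n) (k_ n) (f_ n) s) @ \oo --> Jint w H k f s.
  apply: cvgeD.
  - by rewrite fin_num_adde_defr.
  - apply: cvg_EFin; first exact: nearW.
    by apply: cvgD; apply: cvgM => //; [exact: cw|exact: cf|exact: cf].
  - apply: cvgeB.
    + by rewrite fin_num_adde_defl.
    + by apply: cvg_inve; [move=> n; exact: f0_|exact: cf].
    + by apply: cvg_EFin; [exact: nearW|exact: cvgMl].
rewrite -(cvg_limn_einf_sup c).1; apply: le_limn_einf => n.
by rewrite /g; case: (F n =P +oo%E) => // _; exact: leey.
Qed.

End LowerSemicontinuity.

(** * Pointwise limits of tails are tails *)

Section TailLimit.
Variable R : realType.
Implicit Types (f g E : R -> R).

(** On a uniform grid with N+1 cells the bounds telescope to (g(1) - g(s))(1-s)/(N+1), which tends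
    to 0. This replaces differentiating E almost everywhere. *)
Lemma eq_of_monotone_increments E g s : s <= 1 ->
  (forall x y, s <= x -> x <= y -> y <= 1 ->
     `|E y - E x| <= (g y - g x) * (y - x)) -> E s = E 1.
Proof.
move=> s1 EH.
have bnd N : `|E 1 - E s| <= (g 1 - g s) * (1 - s) / N.+1%:R.
  pose x i := s + i%:R * ((1 - s) / N.+1%:R).
  have x0 : x 0%N = s by rewrite /x mul0r addr0.
  have xN : x N.+1 = 1 by rewrite /x mulrCA divff ?pnatr_eq0// mulr1 addrC subrK.
  have d0 : 0 <= (1 - s) / N.+1%:R by rewrite divr_ge0// subr_ge0.
  have xS i : x i.+1 = x i + (1 - s) / N.+1%:R.
    by rewrite /x -natr1; ring.
  have xm i j : (i <= j)%N -> x i <= x j.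
    by move=> ij; rewrite lerD2l ler_wpM2r// ler_nat.
  have -> : E 1 - E s = \sum_(0 <= i < N.+1) (E (x i.+1) - E (x i)).
    by rewrite (telescope_sumr (fun i => E (x i)))// x0 xN.
  have -> : (g 1 - g s) * (1 - s) / N.+1%:R =
      \sum_(0 <= i < N.+1) (g (x i.+1) - g (x i)) * ((1 - s) / N.+1%:R).
    by rewrite -mulr_suml (telescope_sumr (fun i => g (x i)))// x0 xN mulrA.
  apply: le_trans (ler_norm_sum _ _ _) _.
  rewrite big_nat [leRHS]big_nat; apply: ler_sum => i /andP[_ iN].
  have -> : (1 - s) / N.+1%:R = x i.+1 - x i by rewrite xS addrAC subrr add0r.
  by apply: EH; [rewrite -x0; exact: xm|exact: xm|rewrite -xN; exact: xm].
apply/eqP; rewrite eq_sym -subr_eq0 -normr_le0; apply/ler_addgt0Pr => e e0.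
rewrite add0r.
set c := (g 1 - g s) * (1 - s) in bnd.
have [N cN] : exists N : nat, c / e < N%:R.
  exists (Num.bound `|c / e|); rewrite (le_lt_trans (ler_norm _))//.
  exact: archi_boundP.
apply: (le_trans (bnd N)); rewrite ler_pdivrMr// mulrC -ler_pdivrMr//.
by rewrite (le_trans (ltW cN))// ler_nat.
Qed.

Section ConcaveToDensity.
Variables (f : R -> R) (M : R).
Hypothesis f1 : 0 <= f 1.
Hypothesis f_ni : forall s t, 0 <= s -> s <= t -> t <= 1 -> f t <= f s.
Hypothesis f_lip : forall s t, 0 <= s -> s <= t -> t <= 1 -> f s - f t <= M * (t - s).
Hypothesis f_concave : forall s t u, 0 <= s -> s <= t -> t <= u -> u <= 1 ->
  (f s - f t) * (u - t) <= (f t - f u) * (t - s).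

Let slopes t := [set (f t - f u) / (u - t) | u in `]t, 1]].
(** Minus the right derivative of the concave function f, written as an infimum of chord slopes.
    There is no chord to the right of 1; the default M dominates all slopes, so monotonicity
    persists. *)
Let m t := if t < 1 then inf (slopes t) else M.

Let slopes_ge0 t : 0 <= t -> lbound (slopes t) 0.
Proof.
move=> t0 y [u /=]; rewrite in_itv/= => /andP[tu u1] <-.
by rewrite divr_ge0// subr_ge0 ?f_ni// ltW.
Qed.

Let m_le t u : 0 <= t -> t < u -> u <= 1 -> m t * (u - t) <= f t - f u.
Proof.
move=> t0 tu u1; rewrite /m (lt_le_trans tu u1) -ler_pdivlMr ?subr_gt0//.
apply: ge_inf; first by exists 0; exact: slopes_ge0.
by exists u => //=; rewrite in_itv/= tu.
Qed.

Let m_ge s t : 0 <= s -> s < t -> t <= 1 -> f s - f t <= m t * (t - s).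
Proof.
move=> s0 st t1; rewrite /m; case: ifPn => t1'; last exact: f_lip (ltW st) t1.
rewrite -ler_pdivrMr ?subr_gt0//; apply: lb_le_inf.
  by exists ((f t - f 1) / (1 - t)); exists 1 => //=; rewrite in_itv/= t1' lexx.
move=> y [u /=]; rewrite in_itv/= => /andP[tu u1] <-.
rewrite ler_pdivlMr ?subr_gt0// mulrAC ler_pdivrMr ?subr_gt0//.
by rewrite f_concave// ltW.
Qed.

Let m_ge0 t : 0 <= t <= 1 -> 0 <= m t.
Proof.
move=> /andP[t0 t1]; rewrite /m; case: ifPn => t1'.
  apply: lb_le_inf; last exact: slopes_ge0.
  by exists ((f t - f 1) / (1 - t)); exists 1 => //=; rewrite in_itv/= t1' lexx.
have := f_lip (lexx 0) ler01 (lexx _); rewrite subr0 mulr1; apply: le_trans.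
by rewrite subr_ge0 f_ni.
Qed.

Let m_nd s t : 0 <= s -> s <= t -> t <= 1 -> m s <= m t.
Proof.
move=> s0; rewrite le_eqVlt => /predU1P[->//|st] t1.
have ts : 0 < t - s by rewrite subr_gt0.
by rewrite -(ler_pM2r ts) (le_trans (m_le s0 st t1))// m_ge.
Qed.

Let m_leM t : 0 <= t < 1 -> m t <= M.
Proof.
move=> /andP[t0 t1]; have t1' : 0 < 1 - t by rewrite subr_gt0.
by rewrite -(ler_pM2r t1') (le_trans (m_le t0 t1 _))// f_lip// ltW.
Qed.

(** A nearly optimal right endpoint u for t is still nearly optimal for x slightly above t, which
    bounds m(x) from above; monotonicity is the other half. *)
Let m_rcont t : 0 <= t < 1 -> m @ at_right t --> m t.
Proof.
move=> /andP[t0 t1]; apply/cvgrPdist_le => e e0.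
have [y [u utv yE] h] : exists2 x, slopes t x & x < m t + e.
  apply: inf_lt; last by rewrite /m t1 ltrDl.
  by exists ((f t - f 1) / (1 - t)); exists 1 => //=; rewrite in_itv/= t1 lexx.
rewrite -{}yE in h; move: utv; rewrite /= in_itv/= => /andP[tu u1].
have cq : (f t - f u) / (u - x) @[x --> t^'+] --> (f t - f u) / (u - t).
  apply: cvg_at_right_filter; apply: cvgMr; apply: cvgV.
    by rewrite subr_eq0 gt_eqF.
  by apply: cvgB; [exact: cvg_cst|exact: cvg_id].
near=> x.
have tx : t < x by near: x; exact: nbhs_right_gt.
have xu : x < u by near: x; exact: nbhs_right_lt.
have hx : (f t - f u) / (u - x) < m t + e by near: x; apply: (cvgr_lt _ cq).
have x0 := le_trans t0 (ltW tx).
rewrite distrC ger0_norm ?subr_ge0 ?m_nd ?(ltW tx)//; last first.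
  by rewrite (le_trans (ltW xu)).
rewrite lerBlDl (le_trans _ (ltW hx))// ler_pdivlMr ?subr_gt0//.
rewrite (le_trans (m_le x0 xu u1))// lerD2r f_ni// ?(ltW tx)//.
by rewrite (le_trans (ltW xu)).
Unshelve. all: by end_near. Qed.

Lemma concave_density : exists nu, [/\ inA nu,
  forall x, 0 <= x < 1 -> dens nu x <= M & forall s, 0 <= s <= 1 -> phi nu s = f s].
Proof.
exists (MkA m (f 1)); have nuA : inA (MkA m (f 1)) by exact: inA_intro.
split=> // s /andP[s0 s1]; apply/eqP; rewrite -subr_eq0; apply/eqP.
(* On [x,y] both f and the tail of m drop by an amount between m(x)(y-x) and m(y)(y-x), and both
   equal f(1) at 1. *)
pose E x := phi (MkA m (f 1)) x - f x.
have E1 : E 1 = 0 by rewrite /E phi1 subrr.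
rewrite -/(E s) -E1; apply: (@eq_of_monotone_increments _ m) => // x y sx xy y1.
have x0 := le_trans s0 sx.
move: xy; rewrite le_eqVlt => /predU1P[->|xy]; first by rewrite !subrr normr0 mul0r.
have h1 := m_le x0 xy y1; have h2 := m_ge x0 xy y1.
have := phi_chord_ge nuA x0 (ltW xy) y1; have := phi_chord_le nuA x0 (ltW xy) y1.
rewrite /= /E ler_norml => h3 h4.
by apply/andP; split; lra.
Qed.

End ConcaveToDensity.

(** The common bound M makes the limit Lipschitz up to 1. Without it the slope could blow up at 1,
    and no element of A has an unbounded density. *)
Lemma phi_limit (M : R) (nus : nat -> Aelt R) f :
  (forall n, inA (nus n)) ->
  (forall n x, 0 <= x < 1 -> dens (nus n) x <= M) ->
  (forall s, 0 <= s <= 1 -> (fun n => phi (nus n) s) @ \oo --> f s) ->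
  exists nu, [/\ inA nu,
    forall x, 0 <= x < 1 -> dens nu x <= M & forall s, 0 <= s <= 1 -> phi nu s = f s].
Proof.
move=> nA nM cf.
have c s (s0 : 0 <= s) (s1 : s <= 1) := cf s (introT andP (conj s0 s1)).
apply: concave_density.
- apply: (cvgr_to_ge (c 1 ler01 (lexx _))); near=> n; exact: phi_ge0.
- move=> s t s0 st t1.
  apply: (ler_cvg_to (c t _ _) (c s _ _)) => //; [exact: le_trans st|exact: le_trans t1|].
  by near=> n; exact: phi_ni.
- move=> s t s0 st t1.
  have t0 := le_trans s0 st; have s1 := le_trans st t1.
  apply: (cvgr_to_le (cvgB (c s s0 s1) (c t t0 t1))); near=> n.
  apply: le_phiB => // x /andP[sx xt].
  by rewrite nM// (le_trans s0)//= (lt_le_trans xt).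
- move=> s t u s0 st tu u1.
  have t0 := le_trans s0 st; have t1 := le_trans tu u1.
  have s1 := le_trans st t1; have u0 := le_trans t0 tu.
  have c1 := cvgM (cvgB (c s s0 s1) (c t t0 t1)) (cvg_cst (u - t)).
  have c2 := cvgM (cvgB (c t t0 t1) (c u u0 u1)) (cvg_cst (t - s)).
  apply: (ler_cvg_to (c1 _ _ _) (c2 _ _ _)).
  by near=> n; exact: phi_concave.
Unshelve. all: by end_near. Qed.

End TailLimit.

(** * Existence of minimizers among bounded densities *)

Section Existence.
Variable R : realType.
Local Notation leb := lebesgue_measure.
Local Notation I01 := (`[0%R, 1%R[%classic : set R).
Implicit Types (nu : Aelt R) (w : R -> R) (H k M : R).

(* The constraint [k * atom nu = 0] forbids an atom when k = 1/beta > 0 and is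
   void when k = 0; for M = beta and k = 1/beta this is X_beta. *)
Definition SM M k nu := [/\ inA nu,
  forall x, 0 <= x < 1 -> dens nu x <= M & k * atom nu = 0].

Lemma measurable_phi_I01 nu : inA nu -> measurable_fun I01 (phi nu).
Proof.
move=> nuA; apply: measurable_funS (measurable_phi nuA); first exact: measurable_itv.
by move=> x /=; rewrite !in_itv/= => /andP[-> /ltW].
Qed.

Lemma tame_SM M k nu : 0 <= k -> k * M <= 1 -> SM M k nu -> tame k (phi nu).
Proof.
move=> k0 kM [nuA nuM ka]; split; first exact: measurable_phi_I01.
move=> s /andP[s0 s1]; split; first by rewrite phi_ge0// ltW.
have h : phi nu s - phi nu 1 <= M * (1 - s).
  apply: le_phiB => //; first exact: ltW.
  by move=> x /andP[sx x1]; rewrite nuM// x1 (le_trans s0).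
rewrite phi1 lerBlDr in h.
apply: (le_trans (ler_wpM2l k0 h)); rewrite mulrDr ka addr0 mulrA.
by rewrite ler_piMl// subr_ge0 ltW.
Qed.

Lemma tame0_phi nu : inA nu -> tame 0 (phi nu).
Proof.
move=> nuA; split; first exact: measurable_phi_I01.
by move=> s /andP[s0 s1]; rewrite mul0r subr_ge0 (ltW s1) phi_ge0// ltW.
Qed.

Lemma SM_mid M k nu nu' : SM M k nu -> SM M k nu' -> SM M k (Amid nu nu').
Proof.
move=> [A1 B1 C1] [A2 B2 C2]; split; first exact: inA_mid.
  by move=> x x01 /=; rewrite ler_pdivrMr// mulr_natr mulr2n lerD// ?B1 ?B2.
by rewrite /= mulrA mulrDr C1 C2 addr0 mul0r.
Qed.

Section Coercive.
Variables (w : R -> R) (H w0 : R).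
Hypotheses (w_ge0 : forall s, 0 <= s < 1 -> 0 <= w s) (mw : measurable_fun I01 w).
Hypotheses (H0 : 0 <= H) (w0_gt0 : 0 < w0).
Hypothesis w_lb : forall s, 2^-1 <= s < 1 -> w0 <= w s.

(** By concavity phi(3/4) >= phi(0)/4, and w >= w0 on [1/2, 3/4], an interval of length 1/4;
    together these give the constant w0/16. *)
Lemma J_coercive k nu : inA nu -> tame k (phi nu) ->
  ((w0 / 16 * phi nu 0)%:E <= J w H k (phi nu))%E.
Proof.
move=> nuA tn.
have p0 : 0 <= phi nu 0 by rewrite phi_ge0.
have q34 : phi nu 0 / 4 <= phi nu (3 / 4).
  have := @phi_concave _ _ nuA 0 (3/4) 1 (lexx _) ltac:(lra) ltac:(lra) (lexx _).
  have : 0 <= phi nu 1 by rewrite phi_ge0.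
  lra.
pose A : set R := `[2^-1, (3 / 4)[.
have mA : measurable A by exact: measurable_itv.
have sub : A `<=` I01 by move=> x; rewrite /A /= !in_itv/=; lra.
apply: (@le_trans _ _ (\int[leb]_(s in A) Jint w H k (phi nu) s)%E); last first.
  apply: ge0_subset_integral => //; first exact: measurable_Jint.
  by move=> s; exact: Jint_ge0.
apply: (@le_trans _ _ (\int[leb]_(s in A) (cst (w0 * (phi nu 0 / 4))%:E s))%E).
  rewrite integral_cst//= lebesgue_itvE; last lra.
  by rewrite -EFinM lee_fin; lra.
apply: ge0_le_integral => //.
- by move=> s _; rewrite lee_fin !mulr_ge0// ltW.
- by apply: measurable_funS sub _ => //; exact: measurable_Jint.
move=> s As; have := sub s As; move: As; rewrite /A /= !in_itv/= => /andP[s2 s3] s01.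
rewrite -[leLHS]adde0 leeD ?invB_ge0// lee_fin.
have [s0 s1] := andP s01.
apply: ler_wpDr; first by rewrite mulr_ge0.
apply: ler_pM => //; [exact: ltW|by rewrite divr_ge0|by rewrite w_lb// s2|].
by apply: le_trans q34 _; apply: phi_ni => //; lra.
Qed.

Lemma J_bound k nu C : inA nu -> tame k (phi nu) ->
  (J w H k (phi nu) <= C%:E)%E -> phi nu 0 <= 16 * C / w0.
Proof.
move=> nuA tn JC; have := le_trans (J_coercive nuA tn) JC.
rewrite lee_fin ler_pdivlMr// => h.
have -> : phi nu 0 * w0 = 16 * (w0 / 16 * phi nu 0) by field.
by rewrite ler_wpM2l.
Qed.

Lemma cauchy_is_cvgn (u : nat -> R) :
  (forall e, 0 < e -> exists N, forall n m, (N <= n)%N -> (N <= m)%N -> `|u n - u m| < e) ->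
  cvgn u.
Proof.
move=> cu; apply/cauchy_cvgP/cauchy_exP => e e0.
have [N HN] := cu e e0; exists (u N); exists N => // n /= Nn.
by rewrite /ball/= HN.
Qed.

Section Minimizer.
Variables (M k : R).
Hypotheses (M0 : 0 <= M) (k0 : 0 <= k) (kM : k * M <= 1).

Lemma J_minimizer : exists nu, SM M k nu /\
  forall nu', SM M k nu' -> (J w H k (phi nu) <= J w H k (phi nu'))%E.
Proof.
set V := ereal_inf [set J w H k (phi nu) | nu in SM M k].
have Vle nu : SM M k nu -> (V <= J w H k (phi nu))%E.
  by move=> Sn; apply: ereal_inf_lbound; exists nu.
have V0 : (0 <= V)%E.
  apply: le_ereal_inf_tmp => _ [nu Sn <-]; apply: J_ge0 => //; exact: tame_SM k0 kM Sn.
(* If all values are infinite, any element is a minimizer; the zero measure is taken. *)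
have [Vy|Vy] := eqVneq V +oo%E.
  exists (MkA (cst 0) 0); split; first by split; [exact: inA_cst| |rewrite mulr0].
  by move=> nu' /Vle; rewrite Vy leye_eq => /eqP ->; exact: leey.
have Vfin : V \is a fin_num by rewrite ge0_fin_numE// ltey.
pose v := fine V; have VE : V = v%:E by rewrite fineK.
have v0 : 0 <= v by rewrite -lee_fin -VE.
have [nus nusP] : exists nus : nat -> Aelt R, forall n,
    SM M k (nus n) /\ (J w H k (phi (nus n)) <= (v + n.+1%:R^-1)%:E)%E.
  have h n : exists nu, SM M k nu /\ (J w H k (phi nu) <= (v + n.+1%:R^-1)%:E)%E.
    have n0 : 0 < n.+1%:R^-1 :> R by rewrite invr_gt0.
    have [_ [nu Sn <-] Jn] := lb_ereal_inf_adherent n0 Vfin.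
    by exists nu; split => //; rewrite EFinD -VE; exact: ltW.
  by exists (fun n => projT1 (cid (h n))) => n; exact: (projT2 (cid (h n))).
have nA n : inA (nus n) by have [[]] := nusP n.
have nM n x : 0 <= x < 1 -> dens (nus n) x <= M by have [[_ + _] _] := nusP n; exact.
have nt n : tame k (phi (nus n)) by exact: tame_SM k0 kM (nusP n).1.
pose K := 16 * (v + 1) / w0 + 1.
have K0 : 0 < K by rewrite ltr_wpDl// divr_ge0 ?(ltW w0_gt0)// mulr_ge0// addr_ge0.
have nK n s : 0 <= s < 1 -> phi (nus n) s <= K.
  move=> /andP[s0 s1]; apply: (@le_trans _ _ (phi (nus n) 0)).
    by rewrite phi_ni// ltW.
  apply: (@le_trans _ _ (16 * (v + 1) / w0)); last by rewrite lerDl.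
  apply: J_bound (nt n) _ => //; apply: le_trans (nusP n).2 _.
  by rewrite lee_fin lerD2l invf_le1// ler1n.
have cauchy s : 0 <= s <= 1 -> cvgn (fun n => phi (nus n) s).
  move=> s01; apply: cauchy_is_cvgn => e e0.
  (* The difference of two tails with densities at most M is 2M-Lipschitz; the added 1 keeps [L]
     positive when M = 0. *)
  pose L := 2 * M + 1.
  have L0 : 0 < L by rewrite ltr_wpDl// mulr_ge0.
  set r := (e / 2) ^+ 2 * Num.min ((1 - 0) / 2) (e / (2 * L)).
  have r0 : 0 < r.
    rewrite mulr_gt0 ?exprn_gt0 ?divr_gt0// lt_min subr0 divr_gt0//=.
    by rewrite divr_gt0// mulr_gt0.
  pose N := Num.bound (4 * K ^+ 3 / r).
  have NP : 4 * K ^+ 3 / r < N%:R.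
    apply: archi_boundP; rewrite divr_ge0 ?(ltW r0)// mulr_ge0// exprn_ge0//; exact: ltW.
  exists N => n m Nn Nm.
  apply: (@L2_pointwise _ (fun x => phi (nus n) x - phi (nus m) x) 0 1 s L) => //.
  - by apply: measurable_funB; exact: measurable_phi_I01.
  - move=> x y x0 xy y1.
    have l1 := @phi_lipschitz _ _ (nA n) M x y x0 xy y1.
    have l2 := @phi_lipschitz _ _ (nA m) M x y x0 xy y1.
    have dM i z : x <= z < y -> dens (nus i) z <= M.
      by move=> /andP[xz zy]; rewrite nM// (le_trans x0)//= (lt_le_trans zy).
    have {}l1 := l1 (dM n); have {}l2 := l2 (dM m).
    have -> : phi (nus n) y - phi (nus m) y - (phi (nus n) x - phi (nus m) x) =
       (phi (nus n) y - phi (nus n) x) - (phi (nus m) y - phi (nus m) x) by ring.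
    apply: (le_trans (ler_normB _ _)); apply: (le_trans (lerD l1 l2)).
    by rewrite -mulrDl ler_wpM2r ?subr_ge0// /L; lra.
  have vN i : (N <= i)%N -> (J w H k (phi (nus i)) <= (v + N.+1%:R^-1)%:E)%E.
    move=> Ni; apply: le_trans (nusP i).2 _.
    by rewrite lee_fin lerD2l lef_pV2 ?posrE// ler_nat.
  have Smid := SM_mid (nusP n).1 (nusP m).1.
  have vmid : (v%:E <= J w H k (phi (Amid (nus n) (nus m))))%E by rewrite -VE Vle.
  have := @J_gap_le _ w H k _ _ _ K v N.+1%:R^-1 w_ge0 mw H0 K0 (nt n) (nt m)
    (fun s h => conj (nK n s h) (nK m s h)) _ vmid (vN n Nn) (vN m Nm).
  move=> /(_ _)/le_lt_trans; apply.
    by move=> x /andP[x0 _]; rewrite phi_mid.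
  rewrite lte_fin -/r ltr_pdivrMr// -ltr_pdivrMl// mulrC.
  by rewrite (lt_trans NP)// ltr_nat.
have [nu [nuA nuM nuE]] := phi_limit nA nM cauchy.
have Snu : SM M k nu.
  (* For k nonzero no term of the sequence has an atom. Convergence also holds at 1, where the tail
     is the atom, so the limit has none either. *)
  split => //; have [->|kn0] := eqVneq k 0; first by rewrite mul0r.
  have a0 n : phi (nus n) 1 = 0.
    have [[_ _ ka0] _] := nusP n.
    by rewrite phi1; apply: (mulfI kn0); rewrite ka0 mulr0.
  rewrite -phi1 nuE ?ler01 ?lexx//.
  have -> : (fun n => phi (nus n) 1) = cst 0 by apply/funext => n; rewrite a0.
  by rewrite lim_cst// mulr0.
exists nu; split; first exact: Snu.
move=> nu' /Vle; apply: le_trans.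
have cV : (fun n => (v + n.+1%:R^-1)%:E) @ \oo --> V.
  rewrite VE; apply: cvg_EFin; first exact: nearW.
  rewrite -[X in _ --> X]addr0; apply: cvgD; first exact: cvg_cst.
  exact: cvg_harmonic.
rewrite -(cvg_limn_einf_sup cV).1.
refine (le_trans _ (le_limn_einf (fun n => (nusP n).2))).
apply: (@J_lsc _ (fun=> w) w (fun=> H) H (fun=> k) k (fun n => phi (nus n)) (phi nu)) => //.
- by move=> s _; exact: cvg_cst.
- exact: cvg_cst.
- exact: cvg_cst.
- by move=> n s /andP[s0 s1]; rewrite phi_ge0// ltW.
- by move=> s /andP[s0 s1]; rewrite nuE ?s0 ?ltW//; apply: cauchy; rewrite s0 ltW.
- exact: tame_SM k0 kM Snu.
- by move=> n; right.
Qed.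

End Minimizer.
End Coercive.
End Existence.

(** * Minimizing GS: truncation of the density *)

Section Truncation.
Variable R : realType.
Local Notation leb := lebesgue_measure.
Local Notation I01 := (`[0%R, 1%R[%classic : set R).
Implicit Types (nu : Aelt R) (f g w psi : R -> R).

Lemma lipschitz_within_continuous f (L a b : R) :
  (forall x y, a <= x -> x <= y -> y <= b -> `|f y - f x| <= L * (y - x)) ->
  {within `[a, b], continuous f}.
Proof.
move=> fL; apply/subspace_continuousP => x; rewrite /= in_itv/= => /andP[ax xb].
have fL' y : a <= y <= b -> `|f x - f y| <= `|L| * `|x - y|.
  move=> /andP[ay yb]; have [xy|/ltW yx] := leP x y.
    rewrite distrC (le_trans (fL _ _ ax xy yb))// distrC (ger0_norm (x := y - x)) ?subr_ge0//.
    by rewrite ler_wpM2r ?subr_ge0// ler_norm.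
  rewrite (le_trans (fL _ _ ay yx xb))// (ger0_norm (x := x - y)) ?subr_ge0//.
  by rewrite ler_wpM2r ?subr_ge0// ler_norm.
apply/cvgrPdist_le => e e0; rewrite near_withinE; near=> y => yab.
move: yab; rewrite /= in_itv/= => yab; apply: le_trans (fL' y yab) _.
have L1 : 0 < `|L| + 1 by rewrite ltr_wpDl.
have : `|x - y| <= e / (`|L| + 1).
  by near: y; apply: cvgr_dist_le; [exact: cvg_id|rewrite divr_gt0].
rewrite ler_pdivlMr// mulrDr mulr1 => /(le_trans _); apply.
by rewrite mulrC lerDl.
Unshelve. all: by end_near. Qed.

Lemma ler_dist_min (a b c d e : R) : `|a - c| <= e -> `|b - d| <= e ->
  `|Num.min a b - Num.min c d| <= e.
Proof.
rewrite !ler_norml !minElt => /andP[h1 h2] /andP[h3 h4].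
by apply/andP; case: ifPn => h5; case: ifPn => h6; rewrite -?leNgt in h5 h6; split; lra.
Qed.

(* Writing theta s = phi s + M s and vartheta s = psi s + M s, the new tail
   is phi until theta first reaches the level
   lam = max (min theta vartheta), and the line lam - M s from there on. *)
Lemma truncation nu psi (M : R) : inA nu -> phi nu 0 < M / 2 ->
  (forall s, 2^-1 <= s <= 1 -> 0 <= psi s) ->
  (forall x y, 2^-1 <= x -> x <= y -> y <= 1 -> `|psi y - psi x| <= M * (y - x)) ->
  exists nu', [/\ inA nu', forall x, 0 <= x < 1 -> dens nu' x <= M,
    phi nu' 0 = phi nu 0 &
    forall s, 0 <= s <= 1 -> phi nu' s = phi nu s \/
      [/\ 2^-1 <= s, phi nu s <= phi nu' s & phi nu' s <= psi s] \/
      [/\ 2^-1 <= s, psi s <= phi nu' s & phi nu' s <= phi nu s]].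
Proof.
move=> nuA phi0 psi0 psiL.
have phi00 : 0 <= phi nu 0 by rewrite phi_ge0.
have M0 : 0 < M by lra.
pose th s := phi nu s + M * s; pose vt s := psi s + M * s.
have vt_nd x y : 2^-1 <= x -> x <= y -> y <= 1 -> vt x <= vt y.
  move=> hx xy y1; have := psiL x y hx xy y1.
  by rewrite ler_norml /vt => /andP[h1 h2]; lra.
pose L := dens nu 1 + M + M.
have D0 : 0 <= dens nu 1 by rewrite dens_ge0.
have thL x y : 2^-1 <= x -> x <= y -> y <= 1 -> `|th y - th x| <= L * (y - x).
  move=> hx xy y1; have x0 : 0 <= x by lra.
  have h1 : 0 <= phi nu x - phi nu y by rewrite subr_ge0; exact: phi_ni.
  have h2 := phi_chord_le nuA x0 xy y1.
  have h3 : dens nu y * (y - x) <= dens nu 1 * (y - x).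
    by rewrite ler_wpM2r ?subr_ge0// dens_nd//; lra.
  have h4 : 0 <= M * (y - x) by rewrite mulr_ge0 ?subr_ge0// ltW.
  have h5 : 0 <= dens nu 1 * (y - x) by rewrite mulr_ge0 ?subr_ge0.
  by rewrite ler_norml /th /L; apply/andP; split; lra.
have vtL x y : 2^-1 <= x -> x <= y -> y <= 1 -> `|vt y - vt x| <= L * (y - x).
  move=> hx xy y1; have := psiL x y hx xy y1.
  have h4 : 0 <= M * (y - x) by rewrite mulr_ge0 ?subr_ge0// ltW.
  have h5 : 0 <= dens nu 1 * (y - x) by rewrite mulr_ge0 ?subr_ge0.
  by rewrite !ler_norml /vt /L => /andP[h1 h2]; apply/andP; split; lra.
have h12 : 2^-1 <= 1 :> R by lra.
(* [th] is concave, so it increases up to its maximum point [t0] and decreases afterwards; [B1],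
   [B2], [C1] and [C2] below express this. *)
have [t0] := EVT_max h12 (lipschitz_within_continuous thL).
rewrite in_itv/= => /andP[t0h t01] t0max.
have {}t0max s : 2^-1 <= s -> s <= 1 -> th s <= th t0.
  by move=> hs s1; apply: t0max; rewrite in_itv/= hs.
have [r] := EVT_max h12 (lipschitz_within_continuous
  (fun x y hx xy y1 => ler_dist_min (thL x y hx xy y1) (vtL x y hx xy y1))).
rewrite in_itv/= => /andP[rh r1] rmax.
set lam := Num.min (th r) (vt r) in rmax.
have {}rmax s : 2^-1 <= s -> s <= 1 -> Num.min (th s) (vt s) <= lam.
  by move=> hs s1; apply: rmax; rewrite in_itv/= hs.
have lamth : lam <= th r by rewrite ge_min lexx.
have lamvt : lam <= vt r by rewrite ge_min lexx orbT.
have Mlam : M <= lam.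
  apply: le_trans (rmax 1 h12 (lexx _)); rewrite le_min /th /vt mulr1.
  by rewrite !lerDr psi0 ?h12 ?lexx// phi_ge0.
have lamt0 : lam <= th t0 by rewrite (le_trans lamth)// t0max.
(* Here phi(0) < M/2 enters: [th] is below M at 1/2, while lam >= M because [psi] and the tail are
   nonnegative at 1. Hence the level is crossed after 1/2. *)
have th12 : th 2^-1 < lam.
  apply: lt_le_trans Mlam; rewrite /th.
  have h0 : 0 <= 2^-1 :> R by lra.
  by have := phi_ni nuA (lexx 0) h0 h12; lra.
have [tau] : exists2 c, c \in `[2^-1, t0]%R & th c = lam.
  apply: IVT => //.
    apply: (@lipschitz_within_continuous _ L) => x y hx xy yt.
    by apply: thL => //; exact: le_trans yt t01.
  by rewrite ge_min le_max (ltW th12) lamt0 orbT.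
rewrite in_itv/= => /andP[tauh taut] thtau.
have tau1 : tau <= 1 by exact: le_trans t01.
(* [t0] is maximal on [1/2, 1] only; points before 1/2 are handled by moving right to [s'] and using
   the monotonicity of the density. *)
have B1 s : 0 <= s -> s < t0 -> dens nu s <= M.
  move=> s0 st; pose s' := Num.max s 2^-1.
  have h0 : 2^-1 < t0.
    by rewrite lt_neqAle t0h andbT; apply/eqP => E; rewrite -E in lamt0; lra.
  have [s1 s2 s3] : [/\ s <= s', 2^-1 <= s' & s' < t0].
    by rewrite /s' !le_max !lexx orbT gt_max st h0.
  have s'0 : 0 <= s' by lra.
  have h1 := phi_chord_ge nuA s'0 (ltW s3) t01.
  have h2 := t0max s' s2 (le_trans (ltW s3) t01).
  apply: (@le_trans _ _ (dens nu s')); first by apply: dens_nd => //; lra.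
  have h3 : 0 < t0 - s' by rewrite subr_gt0.
  by rewrite -(ler_pM2r h3); move: h2; rewrite /th; lra.
have B2 s : t0 < s -> s <= 1 -> M <= dens nu s.
  move=> ts s1; have t00 : 0 <= t0 by lra.
  have h1 := phi_chord_le nuA t00 (ltW ts) s1.
  have h2 := t0max s (le_trans t0h (ltW ts)) s1.
  have h3 : 0 < s - t0 by rewrite subr_gt0.
  by rewrite -(ler_pM2r h3); move: h2; rewrite /th; lra.
have C1 x y : 0 <= x -> x <= y -> y <= t0 -> th x <= th y.
  move=> x0 xy yt.
  have : phi nu x - phi nu y <= M * (y - x).
    apply: le_phiB => //; first exact: le_trans t01.
    by move=> z /andP[xz zy]; apply: B1; [exact: le_trans xz|exact: lt_le_trans yt].
  by rewrite /th; lra.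
have C2 x y : t0 <= x -> x <= y -> y <= 1 -> th y <= th x.
  rewrite le_eqVlt => /predU1P[<- ty y1|tx xy y1].
    by apply: t0max => //; exact: le_trans ty.
  have x0 : 0 <= x by lra.
  have : M * (y - x) <= phi nu x - phi nu y.
    apply: ge_phiB => // z /andP[xz zy]; apply: B2; first exact: lt_le_trans xz.
    by rewrite (le_trans (ltW zy)).
  by rewrite /th; lra.
have nuM x : 0 <= x -> x < tau -> dens nu x <= M.
  by move=> x0 xt; apply: B1 => //; exact: lt_le_trans taut.
have c0 : 0 <= lam - M by rewrite subr_ge0.
pose nu' := splice nu tau M (lam - M).
have nuA' : inA nu' := inA_splice nuA (ltW M0) c0 nuM.
have phi_le s : 0 <= s -> s <= tau -> phi nu' s = phi nu s.
  move=> s0 st; rewrite /nu' (phi_splice_le nuA (ltW M0) c0 tau1 nuM s0 st).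
  by move: thtau; rewrite /th; lra.
have phi_ge s : tau <= s -> s <= 1 -> phi nu' s = lam - M * s.
  move=> ts s1; have s0 : 0 <= s by lra.
  by rewrite /nu' (phi_splice_ge nuA (ltW M0) c0 nuM s0 ts s1); ring.
have tau0 : 0 <= tau by lra.
exists nu'; split => //.
- by move=> x /andP[x0 x1] /=; case: ifPn => // xt; exact: nuM.
- exact: phi_le.
move=> s /andP[s0 s1]; have [st|ts] := leP s tau; first by left; exact: phi_le.
have hs : 2^-1 <= s by lra.
rewrite (phi_ge s (ltW ts) s1).
(* If [th s] exceeds [lam], maximality of [lam] puts [vt s] below it. If [th s] is smaller, s cannot
   precede r, since [th] is at least [lam] on all of [tau, r]; then [vt s] is at least [vt r], hence
   at least [lam]. *)
have [lth|thl|lamE] := ltgtP lam (th s); last first.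
- by left; move: lamE; rewrite /th; lra.
- right; left; split => //; first by move: thl; rewrite /th; lra.
  suff : lam <= vt s by rewrite /vt; lra.
  have [rs|sr] := leP r s; first by rewrite (le_trans lamvt)// vt_nd.
  have [st0|t0s] := leP s t0.
    by have := C1 tau s tau0 (ltW ts) st0; rewrite thtau leNgt thl.
  have := C2 s r (ltW t0s) (ltW sr) r1.
  by move=> /(le_trans lamth); rewrite leNgt thl.
- right; right; split => //; last by move: lth; rewrite /th; lra.
  by have := rmax s hs s1; rewrite ge_min leNgt lth/= /vt; lra.
Qed.

(** For fixed s the function w y + 1/y decreases up to y = psi(s) and increases afterwards, and the
    new tail lies between the old one and psi(s). The mass term is unchanged since both tails agree
    at 0. *)
Lemma J_improve w psi H k nu nu' : (forall s, 0 <= s < 1 -> 0 <= w s) ->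
  measurable_fun I01 w -> 0 <= H -> tame k (phi nu) -> tame k (phi nu') ->
  (forall s, 2^-1 <= s < 1 -> 0 < psi s /\ w s * psi s ^+ 2 = 1) ->
  phi nu' 0 = phi nu 0 ->
  (forall s, 0 <= s < 1 -> phi nu' s = phi nu s \/
      [/\ 2^-1 <= s, phi nu s <= phi nu' s & phi nu' s <= psi s] \/
      [/\ 2^-1 <= s, psi s <= phi nu' s & phi nu' s <= phi nu s]) ->
  (J w H k (phi nu') <= J w H k (phi nu))%E.
Proof.
move=> w0 mw H0 tn tn' psiP E0 cmp.
apply: ge0_le_integral => //.
- by move=> s; exact: Jint_ge0.
- exact: measurable_Jint.
- exact: measurable_Jint.
move=> s; rewrite /= in_itv/= => s01; rewrite /Jint E0.
have ws := w0 s s01.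
have [a0 _] := tn.2 s s01; have [b0 _] := tn'.2 s s01.
have [->//|cmp'] := cmp s s01.
set a := phi nu s in a0 cmp' *; set b := phi nu' s in b0 cmp' *.
have [a_eq0|an0] := eqVneq a 0; first by rewrite a_eq0 (inver 0) eqxx leey.
have ap : 0 < a by rewrite lt_neqAle eq_sym an0.
have key : 0 < b -> (b - a) * (w s * (a * b) - 1) <= 0 ->
  ((w s * b + H * phi nu 0)%:E + (b%:E^-1 - (k / (1 - s))%:E) <=
   (w s * a + H * phi nu 0)%:E + (a%:E^-1 - (k / (1 - s))%:E))%E.
  move=> bp h; rewrite !inver !gt_eqF// -!EFinB -!EFinD lee_fin.
  suff : w s * b + b^-1 <= w s * a + a^-1 by lra.
  rewrite -subr_ge0.
  have -> : w s * a + a^-1 - (w s * b + b^-1) =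
      - ((b - a) * (w s * (a * b) - 1)) / (a * b) by field; rewrite !gt_eqF.
  by rewrite divr_ge0 ?mulr_ge0// oppr_ge0.
have [[hs ab bpsi]|[hs psib ba]] := cmp'.
  have [psip psiE] : 0 < psi s /\ w s * psi s ^+ 2 = 1 by apply: psiP; rewrite hs; case/andP: s01.
  apply: key; first exact: lt_le_trans ab.
  rewrite mulr_ge0_le0 ?subr_ge0// subr_le0 -psiE ler_wpM2l// expr2.
  by rewrite ler_pM// (le_trans ab).
have [psip psiE] : 0 < psi s /\ w s * psi s ^+ 2 = 1 by apply: psiP; rewrite hs; case/andP: s01.
apply: key; first exact: lt_le_trans psib.
rewrite mulr_le0_ge0 ?subr_le0// subr_ge0 -psiE ler_wpM2l// expr2.
by rewrite ler_pM ?(ltW psip)// (le_trans psib).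
Qed.

End Truncation.

Section BoundedDensityMinimizer.
Variable R : realType.
Local Notation leb := lebesgue_measure.
Local Notation I01 := (`[0%R, 1%R[%classic : set R).
Implicit Types (nu : Aelt R) (w : R -> R) (H : R).

(** The test measure is delta_1, whose tail is identically 1. Its value is the threshold above which
    competitors can be discarded. *)
Lemma J0_unit_le w H (W : R) : (forall s, 0 <= s < 1 -> 0 <= w s) ->
  measurable_fun I01 w -> 0 <= H -> (forall s, 0 <= s < 1 -> w s <= W) ->
  (J w H 0 (phi (MkA (cst 0%R) 1%R)) <= (W + H + 1)%:E)%E.
Proof.
move=> w_ge0 mw H0 wW.
have nuA : inA (MkA (cst (0 : R)) 1) by exact: inA_cst.
have -> : (W + H + 1)%:E = (\int[leb]_(s in I01) (cst (W + H + 1)%:E s))%E.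
  by rewrite integral_cst//= lebesgue_itvE// subr0 mule1.
apply: ge0_le_integral => //.
- by move=> s; apply: Jint_ge0 => //; exact: tame0_phi.
- by apply: measurable_Jint => //; exact: tame0_phi.
move=> s; rewrite /= in_itv/= => s01; have /andP[s0 s1] := s01.
have E x : 0 <= x -> x <= 1 -> phi (MkA (cst (0 : R)) 1) x = 1.
  by move=> x0 x1; rewrite phi_cst// mul0r addr0.
rewrite /Jint !E ?(ltW s1)// mul0r sube0 inver oner_eq0 invr1 -EFinD lee_fin.
by rewrite !mulr1 lerD2r lerD2r wW.
Qed.

(* Any competitor can be replaced by one whose density is bounded by a constant
   depending only on w and on the mass; hence the minimum is attained. *)
Lemma J0_minimizer w H (w0 L : R) : (forall s, 0 <= s < 1 -> 0 <= w s) ->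
  measurable_fun I01 w -> 0 <= H -> 0 < w0 ->
  (forall s, 2^-1 <= s <= 1 -> w0 <= w s) ->
  (forall x y, 0 <= x -> x <= y -> y <= 1 -> `|w y - w x| <= L * (y - x)) ->
  exists nu, inA nu /\ forall nu', inA nu' -> (J w H 0 (phi nu) <= J w H 0 (phi nu'))%E.
Proof.
move=> w_ge0 mw H0 w0p w_lb w_lip.
have w_lb' s : 2^-1 <= s < 1 -> w0 <= w s.
  by move=> /andP[h s1]; rewrite w_lb// h ltW.
pose nu0 : Aelt R := MkA (cst 0) 1.
have nu0A : inA nu0 by exact: inA_cst.
pose C0 := w 0 + `|L| + H + 1.
have J0C : (J w H 0 (phi nu0) <= C0%:E)%E.
  apply: J0_unit_le => // s /andP[s0 s1].
  have := w_lip 0 s (lexx _) s0 (ltW s1); rewrite subr0 => h.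
  have h' : L * s <= `|L|.
    rewrite (le_trans (ler_wpM2r s0 (ler_norm L)))// ler_piMr//.
    exact: ltW.
  have h2 := ler_norm (w s - w 0).
  by lra.
have C0_ge0 : 0 <= C0.
  by rewrite -lee_fin; apply: le_trans J0C; apply: J_ge0 => //; exact: tame0_phi.
pose c := Num.sqrt w0; have c0 : 0 < c by rewrite sqrtr_gt0.
pose psi s := (Num.sqrt (w s))^-1.
(* The first entry makes the mass bound 16 C0/w0 smaller than M/2; the second is a Lipschitz
   constant of w^(-1/2) on [1/2, 1], where the square root of w is at least c. *)
pose M := Num.max (2 * (16 * C0 / w0) + 2) (`|L| / c ^+ 3).
have M1 : 2 * (16 * C0 / w0) + 2 <= M by rewrite le_max lexx.
have M2 : `|L| / c ^+ 3 <= M by rewrite le_max lexx orbT.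
have K0 : 0 <= 16 * C0 / w0 by rewrite divr_ge0 ?mulr_ge0// ltW.
have M0 : 0 <= M by apply: le_trans M1; lra.
have cw s : 2^-1 <= s <= 1 -> c <= Num.sqrt (w s).
  by move=> /w_lb; exact: ler_wsqrtr.
have psi_lip x y : 2^-1 <= x -> x <= y -> y <= 1 -> `|psi y - psi x| <= M * (y - x).
  move=> hx xy y1; have x0 : 0 <= x by lra.
  have px := cw x (introT andP (conj hx (le_trans xy y1))).
  have py := cw y (introT andP (conj (le_trans hx xy) y1)).
  have wx : 0 <= w x by apply: (le_trans (ltW w0p)); rewrite w_lb// hx (le_trans xy).
  have wy : 0 <= w y by apply: (le_trans (ltW w0p)); rewrite w_lb// y1 (le_trans hx).
  have := w_lip x y x0 xy y1.
  rewrite -{1}(sqr_sqrtr wx) -{1}(sqr_sqrtr wy) /psi.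
  move: px py; set p := Num.sqrt (w x); set q := Num.sqrt (w y) => px py h.
  have p0 := lt_le_trans c0 px; have q0 := lt_le_trans c0 py.
  have E : q ^+ 2 - p ^+ 2 = (q^-1 - p^-1) * - (p * q * (p + q)).
    by field; rewrite !gt_eqF.
  have pq : c ^+ 3 <= p * q * (p + q).
    have -> : c ^+ 3 = c * c * c by ring.
    by rewrite ler_pM ?mulr_ge0 ?ler_pM ?(ltW c0)//; rewrite (le_trans px)// lerDl ltW.
  apply: (@le_trans _ _ (`|L| / c ^+ 3 * (y - x))); last by rewrite ler_wpM2r// subr_ge0.
  rewrite mulrAC ler_pdivlMr ?exprn_gt0//.
  apply: (@le_trans _ _ (`|q^-1 - p^-1| * (p * q * (p + q)))).
    by rewrite ler_wpM2l.
  rewrite -[X in _ * X](ger0_norm (ltW (lt_le_trans (exprn_gt0 3 c0) pq))).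
  rewrite -[X in _ * X]normrN -normrM -E (le_trans h)// ler_wpM2r ?subr_ge0//.
  exact: ler_norm.
have kM : 0 * M <= 1 by rewrite mul0r.
have [nu [[nuA nuM _] nu_min]] := J_minimizer w_ge0 mw H0 w0p w_lb' M0 (lexx 0) kM.
exists nu; split; first exact: nuA.
move=> nu' nuA'.
case/orP: (le_total (J w H 0 (phi nu')) C0%:E) => [J'C|CJ']; last first.
  apply: le_trans CJ'; apply: le_trans J0C; apply: nu_min.
  by split => //; rewrite mul0r.
have b := J_bound w_ge0 mw H0 w0p w_lb' nuA' (tame0_phi nuA') J'C.
have p0 : phi nu' 0 < M / 2 by move: M1 b; clear; lra.
have ps0 s : 2^-1 <= s <= 1 -> 0 <= psi s by rewrite invr_ge0 sqrtr_ge0.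
have [t [tA tM t0 tE]] := truncation nuA' p0 ps0 psi_lip.
apply: (@le_trans _ _ (J w H 0 (phi t))).
  by apply: nu_min; split => //; rewrite mul0r.
apply: (@J_improve _ w psi) => //; [exact: tame0_phi|exact: tame0_phi| |].
  move=> s /w_lb' h; have ws := lt_le_trans w0p h.
  split; first by rewrite invr_gt0 sqrtr_gt0.
  by rewrite exprVn sqr_sqrtr ?ltW// divff// gt_eqF.
by move=> s /andP[s0 s1]; apply: tE; rewrite s0 ltW.
Qed.

End BoundedDensityMinimizer.

(** * Weak convergence *)

Section WeakConvergence.
Variable R : realType.
Local Notation leb := lebesgue_measure.
Implicit Types (nu : Aelt R) (f : R -> R) (s t : R).

Lemma uniform_continuity01 f e : 0 < e -> {within `[0, 1], continuous f} ->
  exists2 d, 0 < d & forall x y, 0 <= x <= 1 -> 0 <= y <= 1 -> `|y - x| < d ->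
    `|f y - f x| <= e.
Proof.
move=> e0 /subspace_continuousP cf.
pose A : set R := `[0, 1].
pose P (d x : R) := A x -> forall y, A y -> `|y - x| < d -> `|f y - f x| <= e.
have /compact_near_coveringP/(_ R (0^'+) P) : compact A by exact: segment_compact.
case=> [x Ax|].
  have /cvgrPdist_le/(_ (e / 2)) := cf x Ax.
  rewrite divr_gt0// => /(_ isT); rewrite near_withinE => -[d /= d0 dP].
  have dP' y : A y -> `|x - y| < d -> `|f x - f y| <= e / 2.
    by move=> Ay xy; apply: dP.
  exists (ball x (d / 2), [set r | r < d / 2]) => /=.
    split; first by exists (d / 2) => //=; rewrite divr_gt0.
    by apply: nbhs_right_lt; rewrite divr_gt0.
  move=> [x' r] /= [xx' rd] Ax' y Ay yx'.
  have h1 : `|x - x'| < d by apply: lt_trans xx' _; lra.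
  have h2 : `|x - y| < d.
    have := ler_distD x' x y; rewrite (distrC x' y) => h.
    by apply: le_lt_trans h _; move: xx'; rewrite /ball/= => xx'; lra.
  have := dP' _ Ax' h1; have := dP' _ Ay h2; have := ler_distD (f x) (f y) (f x').
  by rewrite (distrC (f y) (f x)); lra.
move=> d /= d0 dP.
exists (d / 2); first by rewrite divr_gt0.
move=> x y x01 y01 xy.
have d2 : 0 < d / 2 by rewrite divr_gt0.
apply: (dP (d / 2)) xy => //=.
by rewrite sub0r normrN gtr0_norm//; lra.
Qed.

Definition tailint nu f s :=
  \int[leb]_(x in `[s, 1]) (f x * dens nu x) + atom nu * f 1.

Lemma tailint0 nu f : tailint nu f 0 = Aint nu f.
Proof. by []. Qed.

Section Bounds.
Variables (nu : Aelt R) (f : R -> R).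
Hypotheses (nuA : inA nu) (cf : {within `[0, 1], continuous f}).

Let h01 : (0 : R) <= 1. Proof. exact: ler01. Qed.

Let integrable_prod b1 b2 s t : 0 <= s -> t <= 1 ->
  leb.-integrable [set` Interval (BSide b1 s) (BSide b2 t)]
    (EFin \o (fun x => f x * dens nu x)).
Proof.
move=> s0 t1.
have sub : [set` Interval (BSide b1 s) (BSide b2 t)] `<=` (`[0, 1] : set R).
  move=> x /=; rewrite in_itv => /andP[]; case: b1 b2 => -[] /= h1 h2;
  by rewrite in_itv/=; lra.
have [c1 _ c1P] := EVT_max h01 cf; have [c2 _ c2P] := EVT_min h01 cf.
apply: (@integrableS _ _ _ leb `[0, 1]) => //.
apply: (@bounded_integrable _ _ _ ((`|f c1| + `|f c2|) * dens nu 1)).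
- exact: measurable_itv.
- by rewrite /= lebesgue_itvE// ltry.
- apply: measurable_funM; last exact: measurable_dens.
  by apply: subspace_continuous_measurable_fun => //; exact: measurable_itv.
move=> x; rewrite /= in_itv/= => x01; have [x0 x1] := andP x01.
have xI : x \in `[0, 1]%R by rewrite in_itv.
rewrite normrM; apply: ler_pM => //; last by rewrite ger0_norm ?dens_ge0// dens_nd.
have := c1P x xI; have := c2P x xI.
rewrite ler_norml.
have := ler_norm (f c1); have := ler_norm (- f c2); rewrite normrN.
have := normr_ge0 (f c1); have := normr_ge0 (f c2).
by move=> *; apply/andP; split; lra.
Qed.

Lemma tailintB s t : 0 <= s -> s <= t -> t <= 1 ->
  tailint nu f s - tailint nu f t = \int[leb]_(x in `[s, t[) (f x * dens nu x).
Proof.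
move=> s0 st t1; rewrite /tailint.
have -> : (`[s, 1] : set R) = `[s, t[ `|` `[t, 1].
  by rewrite -itv_bndbnd_setU// bnd_simp.
rewrite Rintegral_setU//=.
- by rewrite opprD addrACA subrr addr0 addrK.
- by rewrite -itv_bndbnd_setU ?bnd_simp//; exact: integrable_prod.
- apply/disj_setPS => x /=; rewrite !in_itv/= => -[/andP[_ xt] /andP[tx _]].
  by rewrite ltNge tx in xt.
Qed.

Lemma le_tailintB c s t : 0 <= s -> s <= t -> t <= 1 ->
  (forall x, s <= x < t -> f x <= c) ->
  tailint nu f s - tailint nu f t <= c * (phi nu s - phi nu t).
Proof.
move=> s0 st t1 fc; rewrite tailintB// phiB//.
rewrite -RintegralZl//; last exact: integrable_dens.
apply: le_Rintegral => //; first exact: integrable_prod.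
  by apply: (integrableZl _ c (integrable_dens nuA true true s0 t1)).
move=> x; rewrite /= in_itv/= => xst; have /andP[sx xt] := xst.
rewrite ler_wpM2r ?fc// dens_ge0//; first exact: le_trans sx.
exact: le_trans (ltW xt) t1.
Qed.

Lemma ge_tailintB c s t : 0 <= s -> s <= t -> t <= 1 ->
  (forall x, s <= x < t -> c <= f x) ->
  c * (phi nu s - phi nu t) <= tailint nu f s - tailint nu f t.
Proof.
move=> s0 st t1 fc; rewrite tailintB// phiB//.
rewrite -RintegralZl//; last exact: integrable_dens.
apply: le_Rintegral => //; last 1 first.
- move=> x; rewrite /= in_itv/= => xst; have /andP[sx xt] := xst.
  rewrite ler_wpM2r ?fc// dens_ge0//; first exact: le_trans sx.
  exact: le_trans (ltW xt) t1.
- by apply: (integrableZl _ c (integrable_dens nuA true true s0 t1)).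
- exact: integrable_prod.
Qed.

Lemma tailint1 : tailint nu f 1 = atom nu * f 1.
Proof. by rewrite /tailint set_itv1 Rintegral_set1 add0r. Qed.

Lemma le_tailint c s : 0 <= s -> s <= 1 -> (forall x, s <= x <= 1 -> f x <= c) ->
  tailint nu f s <= c * phi nu s.
Proof.
move=> s0 s1 fc.
have h : tailint nu f s - tailint nu f 1 <= c * (phi nu s - phi nu 1).
  by apply: le_tailintB => // x /andP[sx /ltW x1]; rewrite fc// sx.
rewrite tailint1 phi1 mulrBr in h.
have : atom nu * f 1 <= atom nu * c.
  by rewrite ler_wpM2l ?atom_ge0// fc// s1 lexx.
by lra.
Qed.

Lemma ge_tailint c s : 0 <= s -> s <= 1 -> (forall x, s <= x <= 1 -> c <= f x) ->
  c * phi nu s <= tailint nu f s.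
Proof.
move=> s0 s1 fc.
have h : c * (phi nu s - phi nu 1) <= tailint nu f s - tailint nu f 1.
  by apply: ge_tailintB => // x /andP[sx /ltW x1]; rewrite fc// sx.
rewrite tailint1 phi1 mulrBr in h.
have : atom nu * c <= atom nu * f 1.
  by rewrite ler_wpM2l ?atom_ge0// fc// s1 lexx.
by lra.
Qed.

End Bounds.

Lemma Aint_cst1 nu : inA nu -> Aint nu (cst 1) = phi nu 0.
Proof.
move=> nuA; rewrite -tailint0.
have c1 : {within `[0, 1], continuous (cst 1 : R -> R)}.
  by apply: continuous_subspaceT => x; exact: cvg_cst.
have := le_tailint nuA c1 (lexx 0) ler01 (fun x _ => lexx 1).
have := ge_tailint nuA c1 (lexx 0) ler01 (fun x _ => lexx 1).
by rewrite mul1r => h1 h2; apply/eqP; rewrite eq_le h1 h2.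
Qed.

(** Zero up to s, affine on [s,t], one from t on: a continuous stand-in for the indicator of
    [s,1]. *)
Definition ramp s t x : R := (Num.min x t - Num.min x s) / (t - s).

Lemma ramp_continuous s t : s < t -> {within `[0, 1], continuous (ramp s t)}.
Proof.
move=> st; apply: (@lipschitz_within_continuous _ _ (2 / (t - s))) => x y _ xy _.
have H c : `|Num.min y c - Num.min x c| <= y - x.
  by apply: ler_dist_min; rewrite ?subrr ?normr0 ?subr_ge0// ger0_norm ?subr_ge0.
rewrite /ramp -mulrBl normrM normfV (gtr0_norm (x := t - s)) ?subr_gt0//.
rewrite mulrAC ler_pM2r ?invr_gt0 ?subr_gt0//.
have -> : Num.min y t - Num.min y s - (Num.min x t - Num.min x s) =
  (Num.min y t - Num.min x t) - (Num.min y s - Num.min x s) by ring.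
by apply: (le_trans (ler_normB _ _)); have := H t; have := H s; lra.
Qed.

Lemma ramp_Aint nu s t : inA nu -> 0 <= s -> s < t -> t <= 1 ->
  phi nu t <= Aint nu (ramp s t) <= phi nu s.
Proof.
move=> nuA s0 st t1; have cr := ramp_continuous st.
have ts : 0 < t - s by rewrite subr_gt0.
have r0 x : x <= s -> ramp s t x = 0.
  by move=> xs; rewrite /ramp !min_l ?subrr ?mul0r// (le_trans xs (ltW st)).
have r1 x : t <= x -> ramp s t x = 1.
  move=> tx; rewrite /ramp !min_r ?divff ?gt_eqF//.
  by rewrite (le_trans (ltW st)).
have r01 x : 0 <= ramp s t x <= 1.
  rewrite /ramp !minElt ler_pdivlMr// ler_pdivrMr// mul0r mul1r.
  by case: ifPn => h1; case: ifPn => h2; rewrite -?leNgt in h1 h2; apply/andP; split; lra.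
have t0 : 0 <= t by lra.
have s1 : s <= 1 by lra.
rewrite -tailint0; apply/andP; split.
  have h1 : 1 * phi nu t <= tailint nu (ramp s t) t.
    by apply: ge_tailint => // x /andP[tx _]; rewrite r1.
  have h2 := @ge_tailintB _ _ nuA cr 0 0 t (lexx _) t0 t1 (fun x _ => proj1 (andP (r01 x))).
  by rewrite mul0r in h2; lra.
have h1 := @le_tailint _ _ nuA cr 1 s s0 s1 (fun x _ => proj2 (andP (r01 x))).
have h2 : tailint nu (ramp s t) 0 - tailint nu (ramp s t) s <= 0 * (phi nu 0 - phi nu s).
  by apply: le_tailintB => // x /andP[_ /ltW xs]; rewrite r0.
by rewrite mul0r in h2; lra.
Qed.

(** Ramps placed just before and just after s squeeze the tails, because the limit tail is
    continuous. There is no ramp before 0, where the test function 1 is used instead; at 1 the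
    conclusion may fail, as mass can flow into the atom. *)
Lemma wconv_phi (nus : nat -> Aelt R) nu s : inA nu -> (forall n, inA (nus n)) ->
  wconv nus nu -> 0 <= s < 1 -> (fun n => phi (nus n) s) @ \oo --> phi nu s.
Proof.
move=> nuA nusA cw /andP[s0 s1].
have [->|sn0] := eqVneq s 0.
  rewrite -(Aint_cst1 nuA).
  under eq_fun do rewrite -(Aint_cst1 (nusA _)).
  by apply: cw; apply: continuous_subspaceT => x; exact: cvg_cst.
have sp : 0 < s by rewrite lt_neqAle eq_sym sn0.
pose D := dens nu 1 + 1.
have D0 : 0 < D by rewrite ltr_wpDl// dens_ge0.
have lip x y : 0 <= x -> x <= y -> y <= 1 -> phi nu x - phi nu y <= D * (y - x).
  move=> x0 xy y1; apply: le_phiB => // z /andP[xz zy].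
  by rewrite /D (@le_trans _ _ (dens nu 1)) ?lerDl// dens_nd//; lra.
apply/cvgrPdist_lt => e e0.
have eD : 0 < e / (2 * D) by rewrite divr_gt0// mulr_gt0.
pose da := Num.min s (e / (2 * D)); pose db := Num.min (1 - s) (e / (2 * D)).
have da0 : 0 < da by rewrite lt_min sp.
have db0 : 0 < db by rewrite lt_min subr_gt0 s1.
have [da1 da2] : da <= s /\ da <= e / (2 * D) by rewrite !ge_min !lexx orbT.
have [db1 db2] : db <= 1 - s /\ db <= e / (2 * D) by rewrite !ge_min !lexx orbT.
have De d : d <= e / (2 * D) -> D * d <= e / 2.
  move=> h; apply: (le_trans (ler_wpM2l (ltW D0) h)).
  by rewrite le_eqVlt; apply/orP; left; apply/eqP; field; rewrite gt_eqF.
have ha := lip (s - da) s ltac:(lra) ltac:(lra) (ltW s1).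
have hb := lip s (s + db) s0 ltac:(lra) ltac:(lra).
have ea := De _ da2; have eb := De _ db2.
have La : phi nu (s - da) < phi nu s + e.
  by lra.
have Lb : phi nu s - e < phi nu (s + db).
  by lra.
have ca := cw _ (@ramp_continuous (s - da) s ltac:(lra)).
have cb := cw _ (@ramp_continuous s (s + db) ltac:(lra)).
have /andP[_ ua] := @ramp_Aint nu (s - da) s nuA ltac:(lra) ltac:(lra) (ltW s1).
have /andP[lb _] := @ramp_Aint nu s (s + db) nuA s0 ltac:(lra) ltac:(lra).
near=> n.
have /andP[l1 _] := @ramp_Aint (nus n) (s - da) s (nusA n) ltac:(lra) ltac:(lra) (ltW s1).
have /andP[_ l2] := @ramp_Aint (nus n) s (s + db) (nusA n) s0 ltac:(lra) ltac:(lra).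
have n1 : Aint (nus n) (ramp (s - da) s) < phi nu s + e.
  by near: n; apply: (cvgr_lt _ ca); exact: le_lt_trans La.
have n2 : phi nu s - e < Aint (nus n) (ramp s (s + db)).
  by near: n; apply: (cvgr_gt _ cb); exact: lt_le_trans lb.
by rewrite distrC ltr_norml; apply/andP; split; lra.
Unshelve. all: by end_near. Qed.

End WeakConvergence.

(** * Convergence of tails implies weak convergence *)

Section TailDeterminesWeakLimit.
Variable R : realType.
Implicit Types (nu : Aelt R) (f : R -> R) (e : R).

(** The default 0 at index N, instead of the tail at 1, assigns the atom to the last cell; only
    tails at points below 1 then occur. *)
Definition grid_tail nu (N i : nat) : R :=
  if (i < N)%N then phi nu (i%:R / N%:R) else 0.

Definition grid_sum nu f (N : nat) :=
  \sum_(0 <= i < N) f (i%:R / N%:R) * (grid_tail nu N i - grid_tail nu N i.+1).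

Lemma telescope_sumrN (u : nat -> R) n :
  \sum_(0 <= i < n) (u i - u i.+1) = u 0%N - u n.
Proof.
rewrite -[RHS]opprB -telescope_sumr// -sumrN.
by apply: eq_bigr => i _; rewrite opprB.
Qed.

Lemma Aint_grid nu f e d N : inA nu -> {within `[0, 1], continuous f} ->
  (forall x y, 0 <= x <= 1 -> 0 <= y <= 1 -> `|y - x| < d -> `|f y - f x| <= e) ->
  N.+1%:R^-1 < d ->
  `|Aint nu f - grid_sum nu f N.+1| <= e * phi nu 0.
Proof.
move=> nuA cf fe Nd.
pose x i : R := i%:R / N.+1%:R.
have N0 : 0 < N.+1%:R :> R by [].
have x0 i : 0 <= x i by rewrite /x divr_ge0.
have x1 i : (i < N.+1)%N -> x i <= 1.
  by move=> iN; rewrite /x ler_pdivrMr// mul1r ler_nat ltnW.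
have xS i : x i.+1 = x i + N.+1%:R^-1 by rewrite /x -natr1 mulrDl mul1r.
pose A i := if (i < N.+1)%N then tailint nu f (x i) else 0.
have xN : x N.+1 = 1 by rewrite /x divff// gt_eqF.
have A0 : Aint nu f = \sum_(0 <= i < N.+1) (A i - A i.+1).
  by rewrite telescope_sumrN /A ltnn subr0 /= /x mul0r tailint0.
have P0 : e * phi nu 0 = \sum_(0 <= i < N.+1)
    e * (grid_tail nu N.+1 i - grid_tail nu N.+1 i.+1).
  by rewrite -mulr_sumr telescope_sumrN /grid_tail ltnn subr0 /= mul0r.
rewrite A0 P0 /grid_sum -sumrB; apply: le_trans (ler_norm_sum _ _ _) _.
rewrite big_nat [leRHS]big_nat; apply: ler_sum => i /andP[_ iN].
have cell z : x i <= z -> z <= x i.+1 -> z <= 1 -> `|f z - f (x i)| <= e.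
  move=> xz zx z1; apply: fe; rewrite ?x0 ?x1// ?(le_trans (x0 i))//.
  by rewrite ger0_norm ?subr_ge0// (le_lt_trans _ Nd)// lerBlDl -xS.
rewrite -/(x i) /A /grid_tail iN -/(x i) -/(x i.+1).
have xiS : x i <= x i.+1 by rewrite xS lerDl invr_ge0 ltW.
have [iN'|iN'] := ltnP i.+1 N.+1.
  have b1 z : x i <= z < x i.+1 -> f (x i) - e <= f z /\ f z <= f (x i) + e.
    move=> /andP[xz /ltW zx]; have := cell z xz zx (le_trans zx (x1 _ iN')).
    by rewrite ler_norml => /andP[h1 h2]; split; lra.
  have h1 := le_tailintB nuA cf (x0 i) xiS (x1 _ iN') (fun z h => proj2 (b1 z h)).
  have h2 := ge_tailintB nuA cf (x0 i) xiS (x1 _ iN') (fun z h => proj1 (b1 z h)).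
  by rewrite ler_norml; apply/andP; split; lra.
(* The last cell is closed at 1 and contains the atom. *)
have iE : i.+1 = N.+1 by apply/eqP; rewrite eqn_leq iN' iN.
have b1 z : x i <= z <= 1 -> f (x i) - e <= f z /\ f z <= f (x i) + e.
  move=> /andP[xz z1]; have := cell z xz; rewrite iE xN => /(_ z1 z1).
  by rewrite ler_norml => /andP[h1 h2]; split; lra.
have h1 := le_tailint nuA cf (x0 i) (x1 _ iN) (fun z h => proj2 (b1 z h)).
have h2 := ge_tailint nuA cf (x0 i) (x1 _ iN) (fun z h => proj1 (b1 z h)).
by rewrite !subr0 ler_norml; apply/andP; split; lra.
Qed.

Lemma cvg_grid_sum {I : Type} {F : set_system I} {FF : Filter F}
    (nus : I -> Aelt R) nu f N :
  (forall s, 0 <= s < 1 -> phi (nus i) s @[i --> F] --> phi nu s) ->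
  grid_sum (nus i) f N @[i --> F] --> grid_sum nu f N.
Proof.
move=> cphi.
have ct i0 : grid_tail (nus i) N i0 @[i --> F] --> grid_tail nu N i0.
  rewrite /grid_tail; case: ifPn => [iN|_]; last exact: cvg_cst.
  have N0 : 0 < N%:R :> R by rewrite ltr0n (leq_ltn_trans _ iN).
  by apply: cphi; rewrite divr_ge0//= ltr_pdivrMr// mul1r ltr_nat.
have cs n : \sum_(0 <= j < n) f (j%:R / N%:R) *
      (grid_tail (nus i) N j - grid_tail (nus i) N j.+1) @[i --> F] -->
    \sum_(0 <= j < n) f (j%:R / N%:R) * (grid_tail nu N j - grid_tail nu N j.+1).
  elim: n => [|n IH].
    by under eq_fun do rewrite big_geq//; rewrite big_geq//; exact: cvg_cst.
  under eq_fun do rewrite big_nat_recr//=.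
  rewrite big_nat_recr//=; apply: cvgD; first exact: IH.
  by apply: cvgM; [exact: cvg_cst|apply: cvgB; exact: ct].
exact: cs.
Qed.

(** The general filter covers both sequences and beta tending to infinity. The grid depends on f and
    e but not on i, so tails are compared at finitely many points. *)
Lemma phi_wconv {I : Type} {F : set_system I} {FF : Filter F}
    (nus : I -> Aelt R) nu f : inA nu -> (\forall i \near F, inA (nus i)) ->
  (forall s, 0 <= s < 1 -> phi (nus i) s @[i --> F] --> phi nu s) ->
  {within `[0, 1], continuous f} -> Aint (nus i) f @[i --> F] --> Aint nu f.
Proof.
move=> nuA nusA cphi cf; apply/cvgrPdist_le => e e0.
have p0 : 0 <= phi nu 0 by rewrite phi_ge0.
(* Eventually the two masses add up to at most [c], so the two grid errors together are at most
   e/2. *)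
pose c := 2 * (phi nu 0 + 1).
have c0 : 0 < c by rewrite mulr_gt0// ltr_wpDl.
have e2 : 0 < e / 2 / c by rewrite !divr_gt0.
have [d d0 dP] := uniform_continuity01 e2 cf.
pose N := Num.bound d^-1.
have Nd : N.+1%:R^-1 < d.
  rewrite invf_plt ?posrE//.
  have h : d^-1 < N%:R by apply: archi_boundP; rewrite invr_ge0 ltW.
  by rewrite (lt_trans h)// ltr_nat.
have z01 : 0 <= (0 : R) < 1 by rewrite lexx ltr01.
near=> i.
have iA : inA (nus i) by near: i.
have g1 := Aint_grid nuA cf dP Nd.
have g2 := Aint_grid iA cf dP Nd.
have h0 : phi (nus i) 0 <= phi nu 0 + 1.
  apply: ltW; near: i; apply: (cvgr_lt _ (cphi 0 z01)); by rewrite ltrDl.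
have hg : `|grid_sum nu f N.+1 - grid_sum (nus i) f N.+1| <= e / 2.
  near: i; apply: cvgr_dist_le; first exact: cvg_grid_sum.
  by rewrite divr_gt0.
have m1 : e / 2 / c * phi nu 0 + e / 2 / c * phi (nus i) 0 <= e / 2.
  rewrite -mulrDr -mulrA ler_piMr ?divr_ge0 ?(ltW e0)// mulrC ler_pdivrMr// mul1r /c.
  by lra.
have -> : Aint nu f - Aint (nus i) f = (Aint nu f - grid_sum nu f N.+1) +
   (grid_sum nu f N.+1 - grid_sum (nus i) f N.+1) -
   (Aint (nus i) f - grid_sum (nus i) f N.+1) by ring.
apply: (le_trans (ler_normB _ _)).
apply: (@le_trans _ _ (e / 2 / c * phi nu 0 + e / 2 + e / 2 / c * phi (nus i) 0)).
  by apply: lerD => //; apply: (le_trans (ler_normD _ _)); exact: lerD.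
by move: m1; clear; lra.
Unshelve. all: by end_near. Qed.

End TailDeterminesWeakLimit.

(** * Probability measures and X_beta *)

Section ProbabilityFromCdf.
Variable R : realType.
Variable F : R -> R.
Hypotheses (F_nd : nondecreasing F) (F_rc : right_continuous F).
Hypotheses (F_0 : F @ -oo --> (0 : R)) (F_1 : F @ +oo --> (1 : R)).

#[local] HB.instance Definition _ := isCumulative.Build R _ R F F_nd F_rc.
#[local] HB.instance Definition _ :=
  isCumulativeBounded.Build R 0 1 F F_0 F_1.

Let idTR : measurableTypeR R -> R := idfun.

#[local] HB.instance Definition _ :=
  @isMeasurableFun.Build _ _ _ _ idTR (@measurable_id _ _ setT).

Let lsf := lebesgue_stieltjes_measure F.

(* [probability R R] and Stieltjes measures use two displays for the Borel sets
   of R; the pushforward by the identity converts between them. *)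
Lemma probability_of_cdf : exists P : probability R R,
  forall r, P `]-oo, r]%classic = (F r)%:E.
Proof.
exists (distribution lsf (idTR : {RV lsf >-> R})) => r.
exact: cdf_lebesgue_stieltjes_id.
Qed.

End ProbabilityFromCdf.

Section ProbabilityCdf.
Variables (R : realType) (mu : probability R R).

Let idR : R -> R := idfun.

#[local] HB.instance Definition _ :=
  @isMeasurableFun.Build _ _ _ _ idR (@measurable_id _ _ setT).

Lemma itvNyc_right_continuous (r : R) :
  mu `]-oo, u]%classic @[u --> r^'+] --> mu `]-oo, r]%classic.
Proof. exact: (@cdf_right_continuous _ _ _ mu (idR : {RV mu >-> R}) r). Qed.

End ProbabilityCdf.

Section ProbabilityOnUnitInterval.
Variables (R : realType) (mu : probability R R).
Local Notation leb := lebesgue_measure.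

Lemma PrI_itv t : PrI mu -> 0 <= t -> mu `[0%R, t]%classic = mu `]-oo, t]%classic.
Proof.
move=> mu1 t0.
have m1 : measurable (`[0%R, 1%R]%classic : set R) by exact: measurable_itv.
have neg0 : mu `]-oo, 0%R[%classic = 0%E.
  apply/eqP; rewrite eq_le measure_ge0 andbT.
  have <- : mu (~` `[0%R, 1%R]%classic) = 0%E.
    by rewrite probability_setC// mu1 subee.
  apply: le_measure; rewrite ?inE; [exact: measurable_itv|exact: measurableC|].
  by move=> x /=; rewrite !in_itv/=; case: leP.
have -> : (`]-oo, t] : set R) = `[0, t] `|` `]-oo, 0[.
  by rewrite setUC -itv_bndbnd_setU// bnd_simp.
by rewrite measureU0//; exact: measurable_itv.
Qed.

Definition cdfI t := fine (mu `[0%R, t]%classic).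

Lemma cdfIE t : (cdfI t)%:E = mu `[0%R, t]%classic.
Proof. by rewrite /cdfI fineK// fin_num_measure//; exact: measurable_itv. Qed.

Lemma cdfI_ge0 t : 0 <= cdfI t.
Proof. by rewrite -lee_fin cdfIE measure_ge0. Qed.

Lemma cdfI_le1 t : cdfI t <= 1.
Proof. by rewrite -lee_fin cdfIE probability_le1//; exact: measurable_itv. Qed.

Lemma cdfI_nd s t : s <= t -> cdfI s <= cdfI t.
Proof.
move=> st; rewrite -lee_fin !cdfIE; apply: le_measure; rewrite ?inE.
- exact: measurable_itv.
- exact: measurable_itv.
- by apply: subset_itvl; rewrite bnd_simp.
Qed.

Definition nu_of (beta : R) : Aelt R := MkA (fun t => beta * cdfI t) 0.

Section NuOf.
Variable beta : R.
Hypotheses (beta0 : 0 < beta) (muI : PrI mu).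

Lemma inA_nu_of : inA (nu_of beta).
Proof.
apply: inA_intro => //.
- by move=> t _; rewrite mulr_ge0 ?cdfI_ge0// ltW.
- by move=> s t _ st _; rewrite ler_wpM2l ?(ltW beta0)// cdfI_nd.
- move=> t /andP[t0 t1]; apply: cvgM; first exact: cvg_cst.
  have /fine_cvg : (cdfI u)%:E @[u --> t^'+] --> (cdfI t)%:E; last exact.
  rewrite cdfIE PrI_itv//.
  refine (cvg_trans _ (@itvNyc_right_continuous _ mu t)).
  apply: near_eq_cvg; near=> u; rewrite cdfIE PrI_itv//.
  by apply: (le_trans t0); near: u; exact: nbhs_right_ge.
Unshelve. all: by end_near. Qed.

Lemma SM_nu_of : SM beta beta^-1 (nu_of beta).
Proof.
split; [exact: inA_nu_of| |by rewrite /= mulr0].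
by move=> x _ /=; rewrite ler_piMr ?(ltW beta0)// cdfI_le1.
Qed.

Lemma Ameas_nu_of (B : set R) :
  Ameas (nu_of beta) B =
  (\int[leb]_(x in B `&` `[0%R, 1%R]) (beta%:E * mu `[0%R, x]%classic))%E.
Proof.
rewrite /Ameas /= mul0r adde0; apply: eq_integral => x _.
by rewrite EFinM cdfIE.
Qed.

Lemma inXwith_nu_of : inXwith beta (nu_of beta) mu.
Proof. by split; [exact: inA_nu_of|split => // B _; exact: Ameas_nu_of]. Qed.

Lemma phi_nu_of s : 0 <= s -> s <= 1 ->
  (phi (nu_of beta) s)%:E = (beta%:E * muhat mu s)%E.
Proof.
move=> s0 s1; rewrite -(nuintE inA_nu_of s0 s1) /nuint Ameas_nu_of.
have -> : `[s, 1] `&` `[0, 1] = (`[s, 1] : set R).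
  by apply/setIidl => x /=; rewrite !in_itv/=; lra.
rewrite /muhat ge0_integralZl//.
- have : measurable_fun (`[s, 1] : set R) cdfI.
    apply: nondecreasing_measurable; first exact: measurable_itv.
    exact: cdfI_nd.
  move=> /measurable_EFinP; apply: eq_measurable_fun => x _.
  by rewrite /= cdfIE.
- by rewrite lee_fin ltW.
Qed.

Lemma muhatE s : 0 <= s -> s <= 1 ->
  muhat mu s = (beta^-1 * phi (nu_of beta) s)%:E.
Proof.
move=> s0 s1; rewrite EFinM phi_nu_of// muleA -EFinM mulVf ?gt_eqF//.
by rewrite mul1e.
Qed.

End NuOf.

(** Membership in X_beta is an equality of measures; tested on the intervals [s,1] it gives equal
    tails, hence equal densities below 1 and equal atoms. *)
Lemma inXwith_phi beta nu : 0 < beta -> inXwith beta nu mu ->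
  SM beta beta^-1 nu /\ forall s, 0 <= s < 1 -> phi nu s = phi (nu_of beta) s.
Proof.
move=> beta0 [nuA [muI H]].
have E s : 0 <= s < 1 -> phi nu s = phi (nu_of beta) s.
  move=> /andP[s0 /ltW s1]; apply: EFin_inj.
  have nuA' := inA_nu_of beta0 muI.
  rewrite -(nuintE nuA s0 s1) -(nuintE nuA' s0 s1) /nuint.
  by rewrite Ameas_nu_of H//; exact: measurable_itv.
split => //; have [E1 E2] := phi_inj nuA (inA_nu_of beta0 muI) E.
split => //; last by rewrite E2 mulr0.
by move=> x x01; rewrite E1//=; have [_ + _] := SM_nu_of beta0 muI; exact.
Qed.

End ProbabilityOnUnitInterval.

Section MuOf.
Variable R : realType.

Lemma exists_inXwith (beta : R) nu : 0 < beta -> SM beta beta^-1 nu ->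
  exists mu : probability R R, inXwith beta nu mu.
Proof.
move=> beta0 [nuA nuM /eqP]; rewrite mulf_eq0 invr_eq0 gt_eqF//= => /eqP a0.
(* The candidate distribution function of mu: its jump at 1 supplies the mass that m/beta has not
   reached before 1. *)
pose F x : R := if x < 0 then 0 else if x < 1 then beta^-1 * dens nu x else 1.
have bi0 : 0 < beta^-1 by rewrite invr_gt0.
have F01 x : 0 <= F x <= 1.
  rewrite /F; case: ltP => [_|x0]; first by rewrite lexx ler01.
  case: ltP => [x1|_]; last by rewrite ler01 lexx.
  rewrite mulr_ge0 ?(ltW bi0) ?dens_ge0 ?(ltW x1)//=.
  by rewrite ler_pdivrMl// mulr1 nuM// x0.
have Fnd : nondecreasing F.
  move=> x y xy; rewrite {2}/F.
  case: ltP => [y0|y0]; first by rewrite /F (le_lt_trans xy y0).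
  case: ltP => [y1|y1]; last by have /andP[] := F01 x.
  rewrite /F; case: ltP => [x0|x0].
    by rewrite mulr_ge0 ?(ltW bi0)// dens_ge0// ltW.
  by rewrite (le_lt_trans xy y1) ler_wpM2l ?(ltW bi0)// dens_nd// ltW.
have Frc : right_continuous F.
  move=> x; have [x0|x0] := ltP x 0.
    apply: cvg_near_cst; near=> y.
    have y0 : y < 0 by near: y; exact: nbhs_right_lt.
    by rewrite /F x0 y0.
  have [x1|x1] := ltP x 1; last first.
    apply: cvg_near_cst; near=> y.
    have xy : x <= y by near: y; exact: nbhs_right_ge.
    by rewrite /F !ifF//; apply/negbTE; rewrite -leNgt ?(le_trans x0) ?(le_trans x1).
  have -> : F x = beta^-1 * dens nu x by rewrite /F x1 ifF// ltNge x0.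
  have x01 : 0 <= x < 1 by rewrite x0.
  apply: cvg_trans (cvgM (cvg_cst _) (dens_rcont nuA x01)).
  apply: near_eq_cvg; near=> y.
  have xy : x <= y by near: y; exact: nbhs_right_ge.
  have y1 : y < 1 by near: y; exact: nbhs_right_lt.
  by rewrite /F y1 ifF//; apply/negbTE; rewrite -leNgt (le_trans x0).
have F0 : F @ -oo --> (0 : R).
  apply: cvg_near_cst; near=> y; rewrite /F.
  have y0 : y < 0 by near: y; exact: nbhs_ninfty_lt.
  by rewrite y0.
have F1 : F @ +oo --> (1 : R).
  apply: cvg_near_cst; near=> y; rewrite /F.
  have y1 : 1 <= y by near: y; exact: nbhs_pinfty_ge.
  by rewrite !ifF//; apply/negbTE; rewrite -leNgt// (le_trans ler01).
have [mu muE] := probability_of_cdf Fnd Frc F0 F1.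
(* No mass lies on the negative half-line, an increasing union of half-lines ending at -1/(n+1), on
   which [F] vanishes. *)
have muI : PrI mu.
  pose G n : set R := `]-oo, (- n.+1%:R^-1)].
  have GU : \bigcup_n G n = `]-oo, 0%R[%classic.
    apply/seteqP; split=> [x [n _]|x]; rewrite /G /= !in_itv/= => xn.
      by rewrite (le_lt_trans xn)// oppr_lt0 invr_gt0.
    exists (Num.bound `|x^-1|) => //; rewrite /G /= in_itv/= lerNr.
    have nx : 0 < - x by rewrite oppr_gt0.
    rewrite -[leRHS]invrK lef_pV2 ?posrE ?invr_gt0//.
    have h := archi_boundP (normr_ge0 x^-1).
    rewrite (le_trans _ (_ : (Num.bound `|x^-1|)%:R <= _)) ?ler_nat// ltW//.
    by rewrite (le_lt_trans _ h)// invrN -normrN ler_norm.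
  have neg0 : mu `]-oo, 0%R[%classic = 0%E.
    rewrite -GU.
    have c : mu \o G @ \oo --> mu (\bigcup_n G n).
      apply: nondecreasing_cvg_mu.
      - by move=> n; exact: measurable_itv.
      - by apply: bigcup_measurable => n _; exact: measurable_itv.
      - move=> n m nm; apply/subsetPset; apply: subset_itvl.
        by rewrite bnd_simp lerN2 lef_pV2 ?posrE// ler_nat.
    have G0 : mu \o G = cst 0%E.
      apply/funext => n; rewrite /= /G muE /F.
      have n0 : - n.+1%:R^-1 < 0 :> R by rewrite oppr_lt0 invr_gt0.
      by rewrite n0.
    by rewrite G0 in c; rewrite -(cvg_lim _ c)// lim_cst.
  have : mu `]-oo, 1%R]%classic = 1%E by rewrite muE /F ltNge ler01 ltxx.
  have -> : (`]-oo, 1] : set R) = `[0, 1] `|` `]-oo, 0[.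
    by rewrite setUC -itv_bndbnd_setU// bnd_simp.
  by rewrite measureU0//; exact: measurable_itv.
exists mu; have nuA' := inA_nu_of beta0 muI.
have E : Aeq nu (nu_of mu beta).
  apply: Aeq_dens => // s /andP[s0 s1] /=.
  rewrite /cdfI PrI_itv// muE /F s1 ifF/=; last by apply/negbTE; rewrite -leNgt.
  by rewrite mulrA divff ?mul1r// gt_eqF.
by split => //; split => // B mB; rewrite E// Ameas_nu_of.
Unshelve. all: by end_near. Qed.

End MuOf.

(** * Both functionals as integrals of the tail *)

Section FunctionalsViaTail.
Variable R : realType.
Local Notation leb := lebesgue_measure.
Local Notation I01 := (`[0%R, 1%R[%classic : set R).
Implicit Types (nu : Aelt R) (b : nat -> R) (h beta : R).

Lemma J_ext (w f g : R -> R) H k : (forall s, 0 <= s < 1 -> f s = g s) ->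
  J w H k f = J w H k g.
Proof.
move=> fg; apply: eq_integral => s; rewrite inE/= in_itv/= => s01.
by rewrite /Jint !fg// lexx ltr01.
Qed.

Lemma measurable_xi2 b : model b -> measurable_fun I01 (xi2 b).
Proof.
move=> mb; have [L L0 Llip] := xi2_lipschitz mb.
apply: (@measurable_funS _ _ _ _ (`[0, 1] : set R)).
- exact: measurable_itv.
- by move=> x /=; rewrite !in_itv/= => /andP[-> /ltW].
apply: subspace_continuous_measurable_fun; first exact: measurable_itv.
exact: (lipschitz_within_continuous Llip).
Qed.

Lemma xi2_ge0_I01 b : model b -> forall s, 0 <= s < 1 -> 0 <= xi2 b s.
Proof. by move=> mb s /andP[s0 /ltW s1]; rewrite xi2_ge0// s0. Qed.

Lemma integral_I01 (f : R -> \bar R) : measurable_fun I01 f ->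
  (\int[leb]_(s in `[0%R, 1%R]) f s = \int[leb]_(s in I01) f s)%E.
Proof. by move=> mf; rewrite -integral_itv_bndo_bndc. Qed.

Lemma integral_I01_cst (r : \bar R) : (\int[leb]_(s in I01) cst r s = r)%E.
Proof. by rewrite integral_cst//= lebesgue_itvE// subr0 mule1. Qed.

(** The separate value at nu = 0 agrees with [J], whose integrand is then [+oo] everywhere. The mass
    term is absorbed as the integral of a constant over the unit interval. *)
Lemma GS_J b h nu : model b -> inA nu ->
  GS h b nu = J (xi2 b) (h ^+ 2) 0 (phi nu).
Proof.
move=> mb nuA; rewrite /GS; case: asboolP => [_|null]; last first.
  have null' B : measurable B -> Ameas nu B = 0%E.
    by move=> mB; apply: contrapT => /eqP n0; apply: null; exists B.
  have phi0 s : 0 <= s < 1 -> phi nu s = 0.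
    move=> /andP[s0 /ltW s1]; apply: EFin_inj; rewrite -(nuintE nuA s0 s1).
    by apply: null'; exact: measurable_itv.
  rewrite -[LHS]integral_I01_cst; apply: eq_integral => s.
  by rewrite inE/= in_itv/= => s01; rewrite /Jint phi0// inver eqxx.
have t0 := tame0_phi nuA.
have m1 : measurable_fun I01 (fun s => ((xi2 b s * phi nu s)%:E + (phi nu s)%:E^-1)%E).
  apply: emeasurable_funD.
    apply/measurable_EFinP; apply: measurable_funM; first exact: measurable_xi2.
    exact: measurable_phi_I01.
  apply: measurable_inve; [exact: measurable_itv| |exact: measurable_phi_I01].
  by move=> s; rewrite /= in_itv/= => s01; have [] := t0.2 s s01.
have mE : measurable_fun I01 (fun s => ((xi2 b s)%:E * nuint nu s + (nuint nu s)^-1)%E).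
  apply: eq_measurable_fun m1 => s; rewrite inE/= in_itv/= => /andP[s0 /ltW s1].
  by rewrite nuintE.
rewrite integral_I01// nuintE// -EFinM -[X in (_ + X)%E]integral_I01_cst.
rewrite -ge0_integralD//.
- apply: eq_integral => s; rewrite inE/= in_itv/= => /andP[s0 /ltW s1].
  by rewrite /Jint nuintE// mul0r sube0 -EFinM EFinD addeAC.
- move=> s; rewrite /= in_itv/= => s01; have /andP[s0 /ltW s1] := s01.
  by rewrite nuintE// -EFinM adde_ge0// ?inve_ge0 lee_fin ?mulr_ge0 ?phi_ge0// xi2_ge0_I01.
- by move=> s _; rewrite lee_fin mulr_ge0 ?sqr_ge0// phi_ge0.
Qed.

(** Substituting [muhat] = phi/beta, a factor beta comes out of each of the three terms; in
    particular 1/[muhat] - 1/(1-s) = beta (1/phi - beta^-1/(1-s)). *)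
Lemma CS_J b h beta (mu : probability R R) : model b -> 0 < beta -> PrI mu ->
  CS beta h b mu =
  ((beta / 2)%:E * J (xi2 b) ((h / beta) ^+ 2) beta^-1 (phi (nu_of mu beta)))%E.
Proof.
move=> mb beta0 muI.
have nuA := inA_nu_of beta0 muI; have Snu := SM_nu_of beta0 muI.
have bi0 : 0 < beta^-1 by rewrite invr_gt0.
have bb : beta^-1 * beta <= 1 by rewrite mulVf// gt_eqF.
have tn := tame_SM (ltW bi0) bb Snu.
pose f := phi (nu_of mu beta).
have f0 s : 0 <= s < 1 -> 0 <= f s by move=> s01; have [] := tn.2 s s01.
have mf : measurable_fun I01 f by exact: measurable_phi_I01.
have mw := measurable_xi2 mb; have w0 := xi2_ge0_I01 mb.
have muE := muhatE beta0 muI.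
have -> : (beta / 2)%:E = ((2^-1)%:E * beta%:E)%E by rewrite -EFinM mulrC.
rewrite /CS -muleA -/f; congr (_ * _)%E.
have mI : measurable I01 by exact: measurable_itv.
have -> : (beta%:E * J (xi2 b) ((h / beta) ^+ 2) beta^-1 f =
    \int[leb]_(s in I01) (beta%:E * Jint (xi2 b) ((h / beta) ^+ 2) beta^-1 f s))%E.
  rewrite ge0_integralZl//.
  - exact: measurable_Jint.
  - by move=> s; apply: Jint_ge0 => //; exact: sqr_ge0.
  - by rewrite lee_fin ltW.
have m1 : measurable_fun I01 (fun s => ((beta ^+ 2 * xi2 b s)%:E * muhat mu s)%E).
  apply: (eq_measurable_fun (fun s => (beta ^+ 2 * xi2 b s * (beta^-1 * f s))%:E)).
    move=> s; rewrite inE/= in_itv/= => /andP[s0 /ltW s1].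
    by rewrite muE// -EFinM.
  apply/measurable_EFinP; apply: measurable_funM.
    by apply: measurable_funM.
  by apply: measurable_funM.
have E2 s : 0 <= s < 1 -> ((muhat mu s)^-1 - (1 - s)%:E^-1 =
    beta%:E * ((f s)%:E^-1 - (beta^-1 / (1 - s))%:E))%E.
  move=> s01; have /andP[s0 s1] := s01.
  rewrite muE// ?ltW// -/f (inver (1 - s)) gt_eqF ?subr_gt0//.
  rewrite !inver mulf_eq0 gt_eqF//=.
  case: ifPn => [_|fn0]; first by rewrite addye// gt0_muley// lte_fin.
  rewrite -!EFinB -EFinM; congr EFin.
  field; apply/and3P; split => //.
    by rewrite gt_eqF// subr_gt0.
  by rewrite gt_eqF.
have m2 : measurable_fun I01 (fun s => ((muhat mu s)^-1 - (1 - s)%:E^-1)%E).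
  apply: (eq_measurable_fun (fun s => beta%:E * ((f s)%:E^-1 - (beta^-1 / (1 - s))%:E))%E).
    by move=> s; rewrite inE/= in_itv/= => /E2.
  apply: measurable_funeM.
  have mz : measurable_fun I01 (fun=> 0 : R) by exact: measurable_cst.
  have := measurable_Jint 0 mz tn.
  apply: eq_measurable_fun => s _.
  by rewrite /Jint !mul0r addr0 add0e.
have z01 : 0 <= (0 : R) < 1 by rewrite lexx ltr01.
rewrite integral_I01// muE// -/f -EFinM -[X in (_ + X)%E]integral_I01_cst.
have p2 s : I01 s -> (0 <= (muhat mu s)^-1 - (1 - s)%:E^-1)%E.
  rewrite /= in_itv/= => s01; rewrite E2// mule_ge0 ?lee_fin ?(ltW beta0)//.
  exact: invB_ge0 tn s01.
have p1 s : I01 s -> (0 <= (beta ^+ 2 * xi2 b s)%:E * muhat mu s)%E.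
  rewrite /= in_itv/= => s01; have /andP[s0 /ltW s1] := s01.
  by rewrite muE// -EFinM lee_fin !mulr_ge0 ?(ltW beta0) ?w0 ?(ltW bi0) ?f0.
rewrite -ge0_integralD// -ge0_integralD//; last 3 first.
- by move=> s Is; rewrite adde_ge0 ?p1 ?p2.
- exact: emeasurable_funD.
- by move=> s _; rewrite lee_fin mulr_ge0 ?sqr_ge0// mulr_ge0 ?(ltW bi0) ?f0.
apply: eq_integral => s; rewrite inE/= in_itv/= => s01.
have /andP[s0 /ltW s1] := s01.
rewrite E2// muE// -/f /Jint [RHS]muleDr//.
rewrite -addeA [X in (_ + X)%E]addeC addeA -EFinM -EFinD -EFinM.
congr (_%:E + _)%E; field; by rewrite gt_eqF.
Qed.

(** The value depends on mu only through the tail, so the infimum is over a singleton. *)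
Lemma Ffun_SM b h beta nu : model b -> 0 < beta -> SM beta beta^-1 nu ->
  Ffun beta h b nu = J (xi2 b) ((h / beta) ^+ 2) beta^-1 (phi nu).
Proof.
move=> mb beta0 Snu; have [mu muX] := exists_inXwith beta0 Snu.
have val m : inXwith beta nu m ->
    ((2 / beta)%:E * CS beta h b m = J (xi2 b) ((h / beta) ^+ 2) beta^-1 (phi nu))%E.
  move=> mX; have [_ [mI _]] := mX; rewrite CS_J// muleA -EFinM.
  have -> : 2 / beta * (beta / 2) = 1 by field; rewrite gt_eqF.
  rewrite mul1e; apply: J_ext => s s01.
  by have [_ ->] := inXwith_phi beta0 mX.
rewrite /Ffun (_ : [set _ | _ in _] = [set J (xi2 b) ((h / beta) ^+ 2) beta^-1 (phi nu)]).
  by rewrite ereal_inf1.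
apply/seteqP; split => [x [m mX <-]|x ->]; first exact: val.
by exists mu => //; exact: val.
Qed.

Lemma Ffun_notSM b h beta nu : 0 < beta -> ~ SM beta beta^-1 nu ->
  Ffun beta h b nu = +oo%E.
Proof.
move=> beta0 nS; rewrite /Ffun (_ : inXwith beta nu = set0) ?image_set0 ?ereal_inf0//.
by apply/seteqP; split => // mu /(inXwith_phi beta0)[].
Qed.

End FunctionalsViaTail.

(** * The limit of zero temperature *)

Section Comparison.
Variable R : realType.
Local Notation leb := lebesgue_measure.
Local Notation I01 := (`[0%R, 1%R[%classic : set R).
Implicit Types (nu : Aelt R).

Lemma le_J_add (w w' f g E : R -> R) (H H' k k' e : R) :
  (forall s, 0 <= s < 1 -> 0 <= w s) -> measurable_fun I01 w -> 0 <= H -> tame k f ->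
  (forall s, 0 <= s < 1 -> 0 <= w' s) -> measurable_fun I01 w' -> 0 <= H' -> tame k' g ->
  measurable_fun I01 E -> (forall s, 0 <= s < 1 -> 0 <= E s) ->
  (\int[leb]_(s in I01) (E s)%:E <= e%:E)%E ->
  (forall s, 0 <= s < 1 -> (Jint w H k f s <= Jint w' H' k' g s + (E s)%:E)%E) ->
  (J w H k f <= J w' H' k' g + e%:E)%E.
Proof.
move=> w0 mw H0 tf w0' mw' H0' tg mE E0 Ee fg.
have mI : measurable I01 by exact: measurable_itv.
have mE' : measurable_fun I01 (fun s => (E s)%:E) by apply/measurable_EFinP.
have E0' s : I01 s -> (0 <= (E s)%:E)%E.
  by rewrite /= in_itv/= => s01; rewrite lee_fin E0.
have Jg0 s : I01 s -> (0 <= Jint w' H' k' g s)%E by exact: Jint_ge0.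
have mJg := measurable_Jint H' mw' tg.
apply: (@le_trans _ _ (J w' H' k' g + \int[leb]_(s in I01) (E s)%:E)%E); last first.
  exact: leeD2l.
rewrite /J -ge0_integralD//; apply: ge0_le_integral => //.
- by move=> s; exact: Jint_ge0.
- exact: measurable_Jint.
- exact: emeasurable_funD.
Qed.

Section TwoWeights.
Variables (w wb : R -> R) (H Hb W om eta beta : R).
Hypotheses (w0 : forall s, 0 <= s < 1 -> 0 <= w s) (mw : measurable_fun I01 w).
Hypotheses (wb0 : forall s, 0 <= s < 1 -> 0 <= wb s) (mwb : measurable_fun I01 wb).
Hypotheses (H0 : 0 <= H) (Hb0 : 0 <= Hb) (beta0 : 0 < beta).
Hypothesis wW : forall s, 0 <= s < 1 -> w s <= W.
Hypotheses (om0 : 0 <= om) (eta0 : 0 <= eta).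

Section Recovery.
Hypotheses (wbw : forall s, 0 <= s < 1 -> wb s <= w s + om) (HbH : Hb <= H + eta).
Variables (nu : Aelt R) (M delta : R).
Hypotheses (nuA : inA nu) (nuM : forall x, 0 <= x < 1 -> dens nu x <= M).
Hypotheses (M0 : 0 <= M) (Mbeta : M <= beta) (delta0 : 0 < delta).
Hypothesis cbeta : atom nu + delta <= beta.

Let c := atom nu + delta.
Let q := 1 - c / beta.
Let rec := splice nu q beta 0.

Let c0 : 0 < c. Proof. by rewrite /c ltr_wpDl// atom_ge0. Qed.
Let q0 : 0 <= q. Proof. by rewrite /q subr_ge0 ler_pdivrMr// mul1r. Qed.
Let q1 : q <= 1. Proof. by rewrite /q gerBl divr_ge0// ltW. Qed.

Let nuq x : 0 <= x -> x < q -> dens nu x <= beta.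
Proof. by move=> x0 xq; rewrite (le_trans (nuM _))// x0 (lt_le_trans xq). Qed.

Let recA : inA rec. Proof. exact: inA_splice (ltW beta0) (lexx 0) nuq. Qed.

Lemma SM_recovery : SM beta beta^-1 rec.
Proof.
split=> //; last by rewrite /= mulr0.
move=> x /andP[x0 x1] /=; case: ifPn => // xq; exact: nuq.
Qed.

Let rec_ge s : q <= s -> s <= 1 -> phi rec s = beta * (1 - s).
Proof.
move=> qs s1; have s0 := le_trans q0 qs.
by rewrite /rec (phi_splice_ge nuA (ltW beta0) (lexx 0) nuq s0 qs s1) add0r.
Qed.

Let rec_le s : 0 <= s -> s <= q -> phi rec s = c + phi nu s - phi nu q.
Proof.
move=> s0 sq.
rewrite /rec (phi_splice_le nuA (ltW beta0) (lexx 0) q1 nuq s0 sq) add0r.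
by congr (_ + _ - _); rewrite /q opprB addrCA subrr addr0 mulrC divfK// gt_eqF.
Qed.

Let phi_q : phi nu q - atom nu <= M * (c / beta).
Proof.
rewrite -phi1 (le_trans (@le_phiB _ _ nuA M q 1 q0 q1 (lexx _) _))//.
  by move=> x /andP[qx x1]; rewrite nuM// x1 (le_trans q0).
by rewrite /q opprB addrCA subrr addr0.
Qed.

Let atom_q : atom nu <= phi nu q. Proof. exact: atom_le_phi. Qed.

(** Two effects: the added mass delta, and the loss of the part of [nu] with density on [q,1], which
    has mass at most M c/beta. *)
Lemma dist_recovery s : 0 <= s -> s <= q ->
  `|phi rec s - phi nu s| <= delta + M * (c / beta).
Proof.
move=> s0 sq; rewrite rec_le//.
have -> : c + phi nu s - phi nu q - phi nu s = delta - (phi nu q - atom nu) by rewrite /c; ring.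
apply: (le_trans (ler_normB _ _)).
by rewrite (gtr0_norm delta0) lerD2l ger0_norm ?subr_ge0.
Qed.

Let rec_ub s : 0 <= s -> s <= 1 -> phi rec s <= phi nu s + delta.
Proof.
move=> s0 s1; have [sq|/ltW qs] := leP s q.
  by rewrite rec_le// /c; move: atom_q; lra.
rewrite rec_ge// (@le_trans _ _ c)//.
  rewrite (@le_trans _ _ (beta * (1 - q)))//.
    by rewrite ler_wpM2l ?(ltW beta0)// lerD2l lerN2.
  by rewrite /q opprB addrCA subrr addr0 mulrC divfK// gt_eqF.
by rewrite /c lerD2r atom_le_phi.
Qed.

(** Past q the new tail is beta(1-s), and 1/phi - beta^-1/(1-s) vanishes. Before q it is at least c
    and drops below the old tail by at most M c/beta, so 1/phi grows by at most (M c/beta)/c^2 <=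
    M/(delta beta). *)
Lemma J_recovery : (J wb Hb beta^-1 (phi rec) <= J w H 0 (phi nu) +
  ((W + H) * delta + (om + eta) * (phi nu 0 + delta) + M / (delta * beta))%:E)%E.
Proof.
have bi0 : 0 < beta^-1 by rewrite invr_gt0.
have bb : beta^-1 * beta <= 1 by rewrite mulVf// gt_eqF.
have tr := tame_SM (ltW bi0) bb SM_recovery.
have p0 : 0 <= phi nu 0 by rewrite phi_ge0.
have W0 : 0 <= W.
  have z : 0 <= (0 : R) < 1 by rewrite lexx ltr01.
  exact: le_trans (w0 z) (wW z).
set E := _ + _ + _.
have E1 : 0 <= (W + H) * delta + (om + eta) * (phi nu 0 + delta).
  exact: (addr_ge0 (mulr_ge0 (addr_ge0 W0 H0) (ltW delta0))
    (mulr_ge0 (addr_ge0 om0 eta0) (addr_ge0 p0 (ltW delta0)))).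
have E2 : 0 <= M / (delta * beta).
  by rewrite divr_ge0// mulr_ge0 ?(ltW delta0) ?(ltW beta0).
have E0 : 0 <= E by rewrite addr_ge0.
apply: (@le_J_add _ _ _ _ (fun=> E)) => //.
- exact: tame0_phi.
- by rewrite [leLHS](integral_I01_cst E%:E).
move=> s s01; have /andP[s0 s1] := s01; rewrite /Jint mul0r sube0.
have [phis0|phin0] := eqVneq (phi nu s) 0.
  by rewrite phis0 (inver 0) eqxx leey.
have fs : 0 < phi nu s by rewrite lt_neqAle eq_sym phin0 phi_ge0// ltW.
have s1' : 0 < 1 - s by rewrite subr_gt0.
have linear : wb s * phi rec s + Hb * phi rec 0 <=
    w s * phi nu s + H * phi nu 0 + ((W + H) * delta + (om + eta) * (phi nu 0 + delta)).
  have rs0 := phi_ge0 recA s0 (ltW s1).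
  have r00 := phi_ge0 recA (lexx 0) ler01.
  have h1 : wb s * phi rec s <= (w s + om) * (phi nu s + delta).
    by rewrite ler_pM ?wb0 ?wbw// rec_ub// ltW.
  have h2 : Hb * phi rec 0 <= (H + eta) * (phi nu 0 + delta).
    by rewrite ler_pM// rec_ub.
  have h3 : w s * delta <= W * delta by rewrite ler_wpM2r ?wW// ltW.
  have h4 : om * (phi nu s + delta) <= om * (phi nu 0 + delta).
    by rewrite ler_wpM2l// lerD2r phi_ni// ltW.
  by move: h1 h2 h3 h4; lra.
have inverse : ((phi rec s)%:E^-1 - (beta^-1 / (1 - s))%:E <=
    (phi nu s)^-1%:E + (M / (delta * beta))%:E)%E.
  have [qs|sq] := leP q s.
    rewrite rec_ge ?(ltW s1)// inver mulf_eq0 !gt_eqF//= invfM -EFinB subrr.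
    by rewrite -EFinD lee_fin addr_ge0// invr_ge0 ltW.
  have rc : c <= phi rec s.
    by rewrite rec_le ?(ltW sq)// -addrA lerDl subr_ge0 phi_ni// ltW.
  have rp : 0 < phi rec s by exact: lt_le_trans rc.
  rewrite inver gt_eqF// -EFinB -EFinD lee_fin.
  apply: (@le_trans _ _ (phi rec s)^-1).
    by rewrite gerBl mulr_ge0 ?invr_ge0 ?(ltW s1') ?(ltW beta0).
  have [le|lt] := leP (phi nu s) (phi rec s).
    by rewrite (le_trans (_ : _ <= (phi nu s)^-1)) ?lerDl// lef_pV2.
  rewrite -lerBlDl.
  have -> : (phi rec s)^-1 - (phi nu s)^-1 =
      (phi nu s - phi rec s) / (phi nu s * phi rec s) by field; rewrite !gt_eqF.
  have num : phi nu s - phi rec s <= M * (c / beta).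
    rewrite rec_le ?(ltW sq)//; move: phi_q; rewrite /c; move: delta0; lra.
  have den : c * c <= phi nu s * phi rec s.
    by rewrite ler_pM ?(ltW c0)// (le_trans rc)// ltW.
  have cc : 0 < c * c by rewrite mulr_gt0.
  rewrite ler_pdivrMr ?(lt_le_trans cc)//; apply: (le_trans num).
  apply: (@le_trans _ _ (M / (delta * beta) * (c * c))); last by rewrite ler_wpM2l.
  have -> : M / (delta * beta) * (c * c) = M * (c / beta) * (c / delta).
    by field; rewrite !gt_eqF.
  rewrite ler_peMr//; first by rewrite mulr_ge0// divr_ge0// ltW.
  by rewrite ler_pdivlMr// mul1r /c lerDr atom_ge0.
have lin : ((wb s * phi rec s + Hb * phi rec 0)%:E <= (w s * phi nu s + H * phi nu 0 +
   ((W + H) * delta + (om + eta) * (phi nu 0 + delta)))%:E)%E by rewrite lee_fin.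
rewrite (inver (phi nu s)) gt_eqF//.
refine (le_trans (leeD lin inverse) _).
by rewrite -!EFinD lee_fin /E; lra.
Qed.

End Recovery.

Section Lower.
Hypotheses (wwb : forall s, 0 <= s < 1 -> w s <= wb s + om) (HHb : H <= Hb + eta).
Variables (nu : Aelt R) (delta eps : R).
Hypotheses (nuS : SM beta beta^-1 nu) (delta0 : 0 < delta) (eps0 : 0 < eps) (eps1 : eps < 1).

(** Up to 1 - eps, omitting beta^-1/(1-s) costs at most beta^-1/eps. On the remaining interval of
    length eps the atom caps 1/phi by 1/delta, which costs eps/delta in total. *)
Lemma J_shift_le : (J w H 0 (phi (MkA (dens nu) (atom nu + delta)))
  <= J wb Hb beta^-1 (phi nu) +
  ((om + eta) * phi nu 0 + (W + H) * delta + beta^-1 / eps + eps / delta)%:E)%E.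
Proof.
have [nuA _ _] := nuS.
have bi0 : 0 < beta^-1 by rewrite invr_gt0.
have bb : beta^-1 * beta <= 1 by rewrite mulVf// gt_eqF.
have tr := tame_SM (ltW bi0) bb nuS.
have p0 : 0 <= phi nu 0 by rewrite phi_ge0.
have W0 : 0 <= W.
  have z : 0 <= (0 : R) < 1 by rewrite lexx ltr01.
  exact: le_trans (w0 z) (wW z).
have shA : inA (MkA (dens nu) (atom nu + delta)) by apply: inA_shift => //; exact: ltW.
pose A : set R := `[1 - eps, 1[.
set e := _ + _ + _ + _.
pose e1 := (om + eta) * phi nu 0 + (W + H) * delta + beta^-1 / eps.
have e10 : 0 <= e1.
  apply: addr_ge0; last by rewrite mulr_ge0 ?(ltW bi0) ?invr_ge0 ?(ltW eps0).
  exact: (addr_ge0 (mulr_ge0 (addr_ge0 om0 eta0) p0)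
    (mulr_ge0 (addr_ge0 W0 H0) (ltW delta0))).
pose E s := e1 + delta^-1 * \1_A s.
have mA : measurable A by exact: measurable_itv.
have d0 : 0 <= delta^-1 by rewrite invr_ge0 ltW.
have mInd : measurable_fun I01 (fun s => delta^-1 * \1_A s).
  by apply: measurable_funM => //; exact: measurable_indic.
apply: (@le_J_add _ _ _ _ E) => //.
- exact: tame0_phi.
- by apply: measurable_funD.
- by move=> s _; rewrite /E addr_ge0// mulr_ge0.
- under eq_integral do rewrite EFinD.
  rewrite ge0_integralD//; last 2 first.
  + by move=> s _; rewrite lee_fin mulr_ge0.
  + exact/measurable_EFinP.
  rewrite [X in (X + _ <= _)%E](integral_I01_cst e1%:E).
  under eq_integral do rewrite EFinM.
  rewrite ge0_integralZl//; last first.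
  + by apply/measurable_EFinP; exact: measurable_indic.
  rewrite integral_indic//.
  have -> : A `&` I01 = A.
    by apply/setIidl => x; rewrite /A /= !in_itv/= => /andP[h ->]; rewrite andbT (le_trans _ h)// subr_ge0 ltW.
  rewrite /= /A lebesgue_itvE; last by rewrite gerBl ltW.
  have -> : 1 - (1 - eps) = eps by ring.
  by rewrite -EFinM -EFinD lee_fin /e /e1 [delta^-1 * _]mulrC.
move=> s s01; have /andP[s0 s1] := s01; rewrite /Jint mul0r sube0 !phi_shift.
have [phis0|phin0] := eqVneq (phi nu s) 0.
  by rewrite phis0 (inver 0) eqxx leey.
have fs : 0 < phi nu s by rewrite lt_neqAle eq_sym phin0 phi_ge0// ltW.
have s1' : 0 < 1 - s by rewrite subr_gt0.
have fd : 0 < phi nu s + delta by rewrite addr_gt0.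
have linear : w s * (phi nu s + delta) + H * (phi nu 0 + delta) <=
    wb s * phi nu s + Hb * phi nu 0 + ((om + eta) * phi nu 0 + (W + H) * delta).
  have h1 : w s * phi nu s <= (wb s + om) * phi nu s.
    by rewrite ler_wpM2r ?wwb// ltW.
  have h2 : H * phi nu 0 <= (Hb + eta) * phi nu 0 by rewrite ler_wpM2r.
  have h3 : w s * delta <= W * delta by rewrite ler_wpM2r ?wW// ltW.
  have h4 : om * phi nu s <= om * phi nu 0 by rewrite ler_wpM2l// phi_ni// ltW.
  by lra.
have k0 : 0 <= (phi nu s)^-1 - beta^-1 / (1 - s).
  have := invB_ge0 tr s01.
  by rewrite inver gt_eqF// -EFinB lee_fin.
have inverse : (phi nu s + delta)^-1 <= (phi nu s)^-1 - beta^-1 / (1 - s) +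
    (beta^-1 / eps + delta^-1 * \1_A s).
  have [sA|sA] := ltP s (1 - eps).
    have -> : \1_A s = 0 :> R.
      rewrite indicE memNset//= => -[]; rewrite /A /= in_itv/= => /andP[+ _].
      by rewrite leNgt sA.
    have h1 : (phi nu s + delta)^-1 <= (phi nu s)^-1.
      by rewrite lef_pV2// lerDl ltW.
    have h2 : beta^-1 / (1 - s) <= beta^-1 / eps.
      by rewrite ler_wpM2l ?(ltW bi0)// lef_pV2 ?posrE//; lra.
    by rewrite mulr0; lra.
  have -> : \1_A s = 1 :> R.
    by rewrite indicE mem_set//= /A /= in_itv/= sA.
  have h1 : (phi nu s + delta)^-1 <= delta^-1.
    by rewrite lef_pV2// lerDr ltW.
  have h2 : 0 <= beta^-1 / eps by rewrite mulr_ge0 ?(ltW bi0)// invr_ge0 ltW.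
  by rewrite mulr1; lra.
rewrite !inver !gt_eqF// -!EFinB -!EFinD lee_fin /E /e1.
move: linear inverse.
set a := _^-1; set a' := (phi nu s)^-1; set y := delta^-1 * _.
set z := beta^-1 / _; set z' := beta^-1 / eps.
by lra.
Qed.

End Lower.
End TwoWeights.
End Comparison.

Lemma lipschitz_bounded (R : realType) (w : R -> R) (L : R) : 0 <= L ->
  (forall s t, 0 <= s -> s <= t -> t <= 1 -> `|w t - w s| <= L * (t - s)) ->
  exists2 W, 0 <= W & forall s, 0 <= s < 1 -> w s <= W.
Proof.
move=> L0 wlip; exists (`|w 0| + L); first by rewrite addr_ge0.
move=> s /andP[s0 s1]; have := wlip 0 s (lexx _) s0 (ltW s1); rewrite subr0 => h.
have h2 : L * s <= L by rewrite ler_piMr// ltW.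
by have := ler_norm (w s - w 0); have := ler_norm (w 0); lra.
Qed.

Section Asymptotics.
Variables (R : realType) (b : nat -> R) (hbar : R) (h : R -> R) (bs : R -> nat -> R).
Hypothesis mb : model b.
Hypothesis (mbs : forall beta, 0 < beta -> model (bs beta)).
Hypothesis hcv : (fun beta => h beta / beta) @ +oo --> hbar.
Hypothesis ucv : forall e : R, 0 < e -> \forall beta \near +oo,
  forall s, 0 <= s <= 1 -> `|xi2 (bs beta) s - xi2 b s| < e.
Implicit Types (nu : Aelt R) (beta e : R).

Local Notation J0 nu := (J (xi2 b) (hbar ^+ 2) 0 (phi nu)).
Local Notation Jb beta nu :=
  (J (xi2 (bs beta)) ((h beta / beta) ^+ 2) beta^-1 (phi nu)).

Lemma xi2_bounded : exists2 W, 0 <= W & forall s, 0 <= s < 1 -> xi2 b s <= W.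
Proof.
have [L L0 Llip] := xi2_lipschitz mb; exact: lipschitz_bounded L0 Llip.
Qed.

Lemma near_close e : 0 < e -> \forall beta \near +oo,
  [/\ 0 < beta, forall s, 0 <= s < 1 -> `|xi2 (bs beta) s - xi2 b s| <= e &
   `|(h beta / beta) ^+ 2 - hbar ^+ 2| <= e].
Proof.
move=> e0; have h2 : (fun beta => (h beta / beta) ^+ 2) @ +oo --> hbar ^+ 2.
  by apply: cvgM.
near=> beta; split.
- by near: beta; exact: nbhs_pinfty_gt.
- move=> s /andP[s0 s1]; apply: ltW.
  have H : forall s, 0 <= s <= 1 -> `|xi2 (bs beta) s - xi2 b s| < e.
    by near: beta; exact: ucv.
  by apply: H; rewrite s0 ltW.
- by rewrite distrC; near: beta; exact: cvgr_dist_le.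
Unshelve. all: by end_near. Qed.

Lemma dist_bounds (x y e : R) : `|x - y| <= e -> x <= y + e /\ y <= x + e.
Proof. by rewrite ler_norml => /andP[h1 h2]; split; lra. Qed.

(** Both delta and M/(delta beta) must tend to 0; with this choice the latter equals M delta. *)
Let delta beta : R := (Num.sqrt beta)^-1.

Let near_delta e : 0 < e -> \forall beta \near +oo, 0 < beta /\ delta beta <= e.
Proof.
move=> e0; near=> beta.
have B0 : 0 < beta by near: beta; exact: nbhs_pinfty_gt.
split=> //; rewrite /delta -[leRHS]invrK lef_pV2 ?posrE ?sqrtr_gt0 ?invr_gt0//.
rewrite -[leLHS]gtr0_norm ?invr_gt0// -sqrtr_sqr; apply: ler_wsqrtr.
by near: beta; apply: nbhs_pinfty_ge; exact: num_real.
Unshelve. all: by end_near. Qed.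

Lemma near_delta_inv e c : 0 < e -> 0 <= c -> \forall beta \near +oo, c / beta <= e.
Proof.
move=> e0 c0; near=> beta.
have B0 : 0 < beta by near: beta; exact: nbhs_pinfty_gt.
by rewrite ler_pdivrMr// mulrC -ler_pdivrMr.
Unshelve. all: by end_near. Qed.

(* The extra mass delta beta keeps the tail of the recovery sequence away from
   0, so that no case distinction on atom nu = 0 is needed. *)
Definition recov nu beta :=
  if [&& 0 < beta, dens nu 1 <= beta & atom nu + delta beta <= beta]
  then splice nu (1 - (atom nu + delta beta) / beta) beta 0 else nu.

Section Recov.
Variable nu : Aelt R.
Hypothesis nuA : inA nu.

Let nuM x : 0 <= x < 1 -> dens nu x <= dens nu 1.
Proof. by move=> /andP[x0 /ltW x1]; rewrite dens_nd. Qed.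

Let M0 : 0 <= dens nu 1. Proof. by rewrite dens_ge0. Qed.

Let near_recov : \forall beta \near +oo,
  [/\ 0 < beta, 0 < delta beta, dens nu 1 <= beta, atom nu + delta beta <= beta &
     recov nu beta = splice nu (1 - (atom nu + delta beta) / beta) beta 0].
Proof.
have nd := near_delta (@ltr01 R).
near=> beta.
have [B0 d1] : 0 < beta /\ delta beta <= 1 by near: beta; exact: nd.
have M : dens nu 1 <= beta by near: beta; apply: nbhs_pinfty_ge; exact: num_real.
have A1 : atom nu + 1 <= beta by near: beta; apply: nbhs_pinfty_ge; exact: num_real.
have A : atom nu + delta beta <= beta by rewrite (le_trans _ A1)// lerD2l.
by split => //; rewrite ?invr_gt0 ?sqrtr_gt0// /recov B0 M A.
Unshelve. all: by end_near. Qed.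

(** Valid for every beta, thanks to the fallback on [nu]: a recovery sequence must lie in A at all
    indices, not just eventually. *)
Lemma inA_recov beta : inA (recov nu beta).
Proof.
rewrite /recov; case: ifPn => // /and3P[B0 MB cB].
apply: inA_splice => //; first exact: ltW.
move=> x x0 xq; rewrite (le_trans _ MB)// nuM// x0 (lt_le_trans xq)// gerBl.
rewrite divr_ge0 ?(ltW B0)// addr_ge0 ?atom_ge0// invr_ge0.
exact: sqrtr_ge0.
Qed.

Lemma recov_upper e : 0 < e -> \forall beta \near +oo,
  SM beta beta^-1 (recov nu beta) /\
  (Jb beta (recov nu beta) <= J0 nu + e%:E)%E.
Proof.
move=> e0; have [W W0 wW] := xi2_bounded.
set H := hbar ^+ 2; have H0 : 0 <= H by exact: sqr_ge0.
have p0 : 0 <= phi nu 0 by rewrite phi_ge0.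
(* The coefficient of [delta beta] in the error, made positive by the added 1; [om] below takes care
   of the remaining term. Each part gets e/2. *)
pose S := W + H + dens nu 1 + 1.
have S0 : 0 < S by exact: ltr_wpDl (addr_ge0 (addr_ge0 W0 H0) M0) ltr01.
pose d := Num.min 1 (e / (2 * S)).
have d0 : 0 < d by rewrite lt_min ltr01 divr_gt0// mulr_gt0.
pose om := e / (4 * (phi nu 0 + 1)).
have p1 : 0 < phi nu 0 + 1 by rewrite ltr_wpDl.
have om0 : 0 < om by rewrite divr_gt0// mulr_gt0.
have nd := near_delta d0; have nc := near_close om0.
near=> beta.
have [B0 db0 MB cB ->] : [/\ 0 < beta, 0 < delta beta, dens nu 1 <= beta,
  atom nu + delta beta <= beta &
     recov nu beta = splice nu (1 - (atom nu + delta beta) / beta) beta 0].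
  by near: beta; exact: near_recov.
have [_ dd] : 0 < beta /\ delta beta <= d by near: beta; exact: nd.
have [_ wc Hc] : [/\ 0 < beta, forall s, 0 <= s < 1 -> `|xi2 (bs beta) s - xi2 b s| <= om &
   `|(h beta / beta) ^+ 2 - hbar ^+ 2| <= om] by near: beta; exact: nc.
split; first exact: (SM_recovery B0 nuA nuM).
apply: (le_trans (@J_recovery _ (xi2 b) (xi2 (bs beta)) H ((h beta / beta) ^+ 2) W om om beta
  (xi2_ge0_I01 mb) (measurable_xi2 mb) (xi2_ge0_I01 (mbs B0)) (measurable_xi2 (mbs B0))
  H0 (sqr_ge0 _) B0 wW (ltW om0) (ltW om0) (fun s s01 => (dist_bounds (wc s s01)).1)
  (dist_bounds Hc).1 nu (dens nu 1) (delta beta) nuA nuM M0 MB db0 cB)).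
rewrite leeD2l// lee_fin.
have [d1 d2] : delta beta <= 1 /\ delta beta <= e / (2 * S).
  by move: dd; rewrite le_min => /andP[].
have E1 : (om + om) * (phi nu 0 + delta beta) <= e / 2.
  apply: (@le_trans _ _ ((om + om) * (phi nu 0 + 1))).
    by rewrite ler_wpM2l ?addr_ge0 ?(ltW om0)// lerD2l.
  by rewrite le_eqVlt; apply/orP; left; apply/eqP; rewrite /om; field; rewrite gt_eqF.
have E2 : dens nu 1 / (delta beta * beta) = dens nu 1 * delta beta.
  congr (_ * _); rewrite /delta -{2}(sqr_sqrtr (ltW B0)).
  by field; rewrite gt_eqF// sqrtr_gt0.
have E3 : S * delta beta <= e / 2.
  have -> : e / 2 = S * (e / (2 * S)) by field; rewrite gt_eqF.
  by rewrite ler_wpM2l// ltW.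
have E4 : S * delta beta = (W + H) * delta beta + dens nu 1 * delta beta + delta beta.
  by rewrite /S; ring.
rewrite E2; lra.
Unshelve. all: by end_near. Qed.

Lemma recov_cvg s : 0 <= s < 1 -> phi (recov nu beta) s @[beta --> +oo] --> phi nu s.
Proof.
move=> /andP[s0 s1]; apply/cvgrPdist_le => e e0.
have M1 : 0 < dens nu 1 + 1 by rewrite ltr_wpDl.
pose d := Num.min (1 - s) (e / (2 * (dens nu 1 + 1))).
have d0 : 0 < d by rewrite lt_min subr_gt0 s1 divr_gt0// mulr_gt0.
have e2 : 0 < e / 2 by rewrite divr_gt0.
have a1 : 0 <= atom nu + 1 by rewrite addr_ge0// atom_ge0.
have nd := near_delta e2; have nd1 := near_delta (@ltr01 R).
have ni := near_delta_inv d0 a1.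
near=> beta.
have [B0 db0 MB cB ->] : [/\ 0 < beta, 0 < delta beta, dens nu 1 <= beta,
  atom nu + delta beta <= beta &
     recov nu beta = splice nu (1 - (atom nu + delta beta) / beta) beta 0].
  by near: beta; exact: near_recov.
have [_ d1] : 0 < beta /\ delta beta <= 1 by near: beta; exact: nd1.
have [_ d2] : 0 < beta /\ delta beta <= e / 2 by near: beta; exact: nd.
have d3 : (atom nu + 1) / beta <= d by near: beta; exact: ni.
have cd : (atom nu + delta beta) / beta <= d.
  by rewrite (le_trans _ d3)// ler_pM2r ?invr_gt0// lerD2l.
have [c1 c2] : (atom nu + delta beta) / beta <= 1 - s /\
    (atom nu + delta beta) / beta <= e / (2 * (dens nu 1 + 1)).
  by move: cd; rewrite le_min => /andP[].
have sq : s <= 1 - (atom nu + delta beta) / beta by lra.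
rewrite distrC; apply: (le_trans (dist_recovery B0 nuA nuM MB db0 cB s0 sq)).
have : dens nu 1 * ((atom nu + delta beta) / beta) <= e / 2.
  apply: (@le_trans _ _ ((dens nu 1 + 1) * (e / (2 * (dens nu 1 + 1))))); last first.
    by rewrite le_eqVlt; apply/orP; left; apply/eqP; field; rewrite gt_eqF.
  rewrite ler_pM ?lerDl// divr_ge0 ?(ltW B0)// addr_ge0 ?atom_ge0//.
  exact: ltW.
by move: d2; lra.
Unshelve. all: by end_near. Qed.

End Recov.

End Asymptotics.

(** * Stability and uniqueness of minimizers *)

Section Closeness.
Variable R : realType.
Local Notation leb := lebesgue_measure.
Local Notation I01 := (`[0%R, 1%R[%classic : set R).
Implicit Types (nu : Aelt R) (s d K : R).

(* On [s, (1 + s)/2] the tails are 2K/(1 - s)-Lipschitz, whence this radius. *)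
Definition L2_radius K s d : R :=
  (d / 2) ^+ 2 * Num.min (((1 + s) / 2 - s) / 2) (d / (2 * (4 * K / (1 - s) + 1))).

Lemma L2_radius_gt0 K s d : 0 <= K -> s < 1 -> 0 < d -> 0 < L2_radius K s d.
Proof.
move=> K0 s1 d0; have s1' : 0 < 1 - s by rewrite subr_gt0.
have L0 : 0 < 4 * K / (1 - s) + 1 by rewrite ltr_wpDl// divr_ge0 ?mulr_ge0// ltW.
rewrite /L2_radius mulr_gt0// ?exprn_gt0 ?divr_gt0// lt_min; apply/andP; split.
  by rewrite divr_gt0//; lra.
by rewrite divr_gt0// mulr_gt0.
Qed.

(** Only the masses are bounded here. For z below (1+s)/2 the density is at most K/(1-z) <=
    2K/(1-s), so the difference of the tails is 4K/(1-s)-Lipschitz on that side of the midpoint. *)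
Lemma phi_L2_close nu nu' K s d : inA nu -> inA nu' -> 0 <= K ->
  phi nu 0 <= K -> phi nu' 0 <= K -> 0 <= s < 1 -> 0 < d ->
  (\int[leb]_(x in I01) ((phi nu x - phi nu' x) ^+ 2)%:E < (L2_radius K s d)%:E)%E ->
  `|phi nu s - phi nu' s| < d.
Proof.
move=> nuA nuA' K0 nK nK' /andP[s0 s1] d0.
have s1' : 0 < 1 - s by rewrite subr_gt0.
set v := (1 + s) / 2; have [sv v1] : s < v /\ v < 1 by rewrite /v; split; lra.
have lipK m x y : inA m -> phi m 0 <= K -> s <= x -> x <= y -> y <= v ->
    `|phi m y - phi m x| <= 2 * K / (1 - s) * (y - x).
  move=> mA mK sx xy yv.
  have x0 := le_trans s0 sx; have y1 := le_trans yv (ltW v1).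
  apply: phi_lipschitz => // z /andP[xz zy].
  have z0 := le_trans x0 xz; have z1 : z < 1 by exact: lt_le_trans zy y1.
  apply: (le_trans (dens_phi0 mA z0 z1)).
  rewrite ler_pdivrMr ?subr_gt0//.
  have -> : 2 * K / (1 - s) * (1 - z) = K * (2 * (1 - z) / (1 - s)) by ring.
  apply: (le_trans mK); rewrite ler_peMr// ler_pdivlMr// mul1r.
  by have zv := le_trans (ltW zy) yv; rewrite /v in zv; lra.
apply: (@L2_pointwise _ (fun x => phi nu x - phi nu' x) s v s (4 * K / (1 - s) + 1) d) => //.
- exact: ltW.
- by rewrite lexx ltW.
- by rewrite ltr_wpDl// divr_ge0 ?mulr_ge0// ltW.
- by apply: measurable_funB; exact: measurable_phi_I01.
move=> x y sx xy yv.
have -> : phi nu y - phi nu' y - (phi nu x - phi nu' x) =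
    (phi nu y - phi nu x) - (phi nu' y - phi nu' x) by ring.
apply: (le_trans (ler_normB _ _)).
apply: (le_trans (lerD (lipK nu x y nuA nK sx xy yv) (lipK nu' x y nuA' nK' sx xy yv))).
rewrite -mulrDl ler_wpM2r ?subr_ge0//.
have -> : 4 * K / (1 - s) = 2 * K / (1 - s) + 2 * K / (1 - s) by ring.
by rewrite lerDl.
Qed.

Lemma near_min_close (w : R -> R) (H k : R) nu nu' K v a s d :
  (forall s, 0 <= s < 1 -> 0 <= w s) -> measurable_fun I01 w -> 0 <= H ->
  inA nu -> inA nu' -> tame k (phi nu) -> tame k (phi nu') -> 0 < K ->
  phi nu 0 <= K -> phi nu' 0 <= K -> (v%:E <= J w H k (phi (Amid nu nu')))%E ->
  (J w H k (phi nu) <= (v + a)%:E)%E -> (J w H k (phi nu') <= (v + a)%:E)%E ->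
  0 <= s < 1 -> 0 < d -> 4 * K ^+ 3 * a < L2_radius K s d ->
  `|phi nu s - phi nu' s| < d.
Proof.
move=> w0 mw H0 nuA nuA' tn tn' K0 nK nK' vm fv gv s01 d0 aK.
apply: (phi_L2_close nuA nuA' (ltW K0) nK nK' s01 d0).
have bK m x : inA m -> phi m 0 <= K -> 0 <= x < 1 -> phi m x <= K.
  by move=> mA mK /andP[x0 /ltW x1]; apply: le_trans mK; exact: phi_ni.
have := @J_gap_le _ w H k (phi nu) (phi nu') (phi (Amid nu nu')) K v a w0 mw H0 K0 tn tn'
  (fun x x01 => conj (bK nu x nuA nK x01) (bK nu' x nuA' nK' x01)) _ vm fv gv.
move=> /(_ _)/le_lt_trans; apply; last by rewrite lte_fin.
by move=> x /andP[x0 _]; rewrite phi_mid.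
Qed.

Lemma minimizer_unique (w : R -> R) (H k : R) nu nu' v :
  (forall s, 0 <= s < 1 -> 0 <= w s) -> measurable_fun I01 w -> 0 <= H ->
  inA nu -> inA nu' -> tame k (phi nu) -> tame k (phi nu') ->
  (v%:E <= J w H k (phi (Amid nu nu')))%E ->
  (J w H k (phi nu) <= v%:E)%E -> (J w H k (phi nu') <= v%:E)%E -> Aeq nu nu'.
Proof.
move=> w0 mw H0 nuA nuA' tn tn' vm fv gv; apply: Aeq_phi => // s s01.
pose K := phi nu 0 + phi nu' 0 + 1.
have [p0 p0'] : 0 <= phi nu 0 /\ 0 <= phi nu' 0 by rewrite !phi_ge0.
have [K0 K1 K2] : [/\ 0 < K, phi nu 0 <= K & phi nu' 0 <= K] by rewrite /K; split; lra.
apply/eqP; rewrite -subr_eq0 -normr_le0; apply/ler_addgt0Pr => d d0; rewrite add0r.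
apply/ltW; apply: (@near_min_close w H k nu nu' K v 0) => //; rewrite ?addr0//.
by rewrite mulr0 L2_radius_gt0// ?(ltW K0)//; case/andP: s01.
Qed.

(** This element corresponds to mu = delta_0. Its tail beta(1-s) cancels the singular part, so
    F_beta is finite somewhere. *)
Lemma J_uniform_le (w : R -> R) (H W beta : R) : 0 < beta ->
  (forall s, 0 <= s < 1 -> 0 <= w s) -> measurable_fun I01 w -> 0 <= H ->
  (forall s, 0 <= s < 1 -> w s <= W) ->
  SM beta beta^-1 (MkA (cst beta) 0) /\
  (J w H beta^-1 (phi (MkA (cst beta) 0%R)) <= (W * beta + H * beta)%:E)%E.
Proof.
move=> beta0 w0 mw H0 wW; have nuA := inA_cst (ltW beta0) (lexx (0 : R)).
have S : SM beta beta^-1 (MkA (cst beta) 0) by split=> //; rewrite mulr0.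
have bb : beta^-1 * beta <= 1 by rewrite mulVf// gt_eqF.
have bi0 : 0 <= beta^-1 by rewrite invr_ge0 ltW.
have tn := tame_SM bi0 bb S.
split => //; rewrite -[leRHS](integral_I01_cst (W * beta + H * beta)%:E).
apply: ge0_le_integral => //.
- by move=> s; exact: Jint_ge0.
- exact: measurable_Jint.
move=> s; rewrite /= in_itv/= => s01; have /andP[s0 s1] := s01.
have s1' : 0 < 1 - s by rewrite subr_gt0.
rewrite /Jint !phi_cst ?lexx ?(ltW beta0) ?(ltW s1)// !add0r subr0 mulr1.
rewrite inver mulf_eq0 !gt_eqF//= invfM -EFinB subrr adde0 lee_fin lerD2r.
have W0 : 0 <= w s by exact: w0.
apply: (@le_trans _ _ (w s * beta)); last by rewrite ler_wpM2r ?wW ?(ltW beta0).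
by rewrite ler_wpM2l// ler_piMr ?(ltW beta0)// gerBl.
Qed.

End Closeness.

(** * Convergence of the values and of the minimizers *)

Section Limit.
Variables (R : realType) (b : nat -> R) (hbar : R) (h : R -> R) (bs : R -> nat -> R).
Hypothesis mb : model b.
Hypothesis (mbs : forall beta, 0 < beta -> model (bs beta)).
Hypothesis hcv : (fun beta => h beta / beta) @ +oo --> hbar.
Hypothesis ucv : forall e : R, 0 < e -> \forall beta \near +oo,
  forall s, 0 <= s <= 1 -> `|xi2 (bs beta) s - xi2 b s| < e.
Implicit Types (nu : Aelt R) (beta e : R).

Local Notation J0 nu := (J (xi2 b) (hbar ^+ 2) 0 (phi nu)).
Local Notation Jb beta nu :=
  (J (xi2 (bs beta)) ((h beta / beta) ^+ 2) beta^-1 (phi nu)).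
Local Notation shift nu d := (MkA (dens nu) (atom nu + d)).

(** The order of choices matters: K depends on C only, by coercivity with xi_beta'' >= w0/2 on [1/2,
    1); then d is chosen from e, eps from d and e, and beta last, uniformly in nu. Each of the four
    error terms of [J_shift_le] gets e/4. *)
Lemma near_lower (C : R) : 0 <= C -> exists2 K, 0 <= K & forall e, 0 < e ->
  exists d, [/\ 0 < d, d <= e & \forall beta \near +oo, forall nu,
    SM beta beta^-1 nu -> (Jb beta nu <= C%:E)%E ->
    (J0 (shift nu d) <= Jb beta nu + e%:E)%E /\ phi nu 0 <= K].
Proof.
move=> C0; have [w0 w0p w_lb] := xi2_gt0 mb.
have [W W0 wW] := xi2_bounded mb.
have H0 : 0 <= hbar ^+ 2 by exact: sqr_ge0.
pose K := 16 * C / (w0 / 2).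
have K0 : 0 <= K.
  by apply: divr_ge0; [exact: mulr_ge0|rewrite divr_ge0// ltW].
exists K => // e e0.
pose S := W + hbar ^+ 2 + 1.
have S0 : 0 < S by exact: ltr_wpDl (addr_ge0 W0 H0) ltr01.
pose d := Num.min e (e / (4 * S)).
have d0 : 0 < d by rewrite lt_min e0 divr_gt0// mulr_gt0.
have [d1 d2] : d <= e /\ d <= e / (4 * S) by rewrite !ge_min !lexx orbT.
exists d; split => //.
pose eps := Num.min (2^-1) (d * e / 4).
have eps0 : 0 < eps by rewrite lt_min invr_gt0 ltr0n divr_gt0// mulr_gt0.
have [eps1 eps2] : eps <= 2^-1 /\ eps <= d * e / 4 by rewrite !ge_min !lexx orbT.
have eps_lt1 : eps < 1 by move: eps1; lra.
have e4 : 0 < e / 4 by rewrite divr_gt0.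
have ieps0 : 0 <= eps^-1 by rewrite invr_ge0 ltW.
pose om := Num.min (w0 / 2) (e / (8 * (K + 1))).
have K1 : 0 < K + 1 by rewrite ltr_wpDl.
have om0 : 0 < om by rewrite lt_min !divr_gt0// mulr_gt0.
have [om1 om2] : om <= w0 / 2 /\ om <= e / (8 * (K + 1)) by rewrite !ge_min !lexx orbT.
have ni := near_delta_inv e4 ieps0; have nc := near_close hcv ucv om0.
near=> beta.
have ib : eps^-1 / beta <= e / 4 by near: beta; exact: ni.
have [B0 wc Hc] : [/\ 0 < beta, forall s, 0 <= s < 1 -> `|xi2 (bs beta) s - xi2 b s| <= om &
   `|(h beta / beta) ^+ 2 - hbar ^+ 2| <= om] by near: beta; exact: nc.
move=> nu nuS JC; have [nuA _ _] := nuS.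
have bi0 : 0 <= beta^-1 by rewrite invr_ge0 ltW.
have bb : beta^-1 * beta <= 1 by rewrite mulVf// gt_eqF.
have tn := tame_SM bi0 bb nuS.
have w2 : 0 < w0 / 2 by rewrite divr_gt0.
have w0_om : w0 / 2 + om <= w0 by move: om1; move: (w0) (om) => x y; lra.
have wb_lb s : 2^-1 <= s < 1 -> w0 / 2 <= xi2 (bs beta) s.
  move=> /andP[s2 s1]; have s01 : 0 <= s < 1 by rewrite s1 andbT; apply: le_trans s2; rewrite invr_ge0.
  have [_ wl] := dist_bounds (wc s s01).
  have wl2 : w0 <= xi2 b s by apply: w_lb; rewrite s2 ltW.
  by rewrite -(lerD2r om) (le_trans _ wl)// (le_trans w0_om).
have nuK : phi nu 0 <= K.
  exact: (J_bound (xi2_ge0_I01 (mbs B0)) (measurable_xi2 (mbs B0)) (sqr_ge0 _) w2 wb_lb nuA tn JC).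
split => //.
have p0 : 0 <= phi nu 0 by rewrite phi_ge0.
refine (le_trans (@J_shift_le _ (xi2 b) (xi2 (bs beta)) (hbar ^+ 2)
  ((h beta / beta) ^+ 2) W om om beta (xi2_ge0_I01 mb) (measurable_xi2 mb)
  (xi2_ge0_I01 (mbs B0)) (measurable_xi2 (mbs B0)) H0 (sqr_ge0 _) B0 wW (ltW om0) (ltW om0)
  (fun s s01 => (dist_bounds (wc s s01)).2) (dist_bounds Hc).2 nu d eps nuS d0 eps0 eps_lt1) _).
rewrite leeD2l// lee_fin.
have E1 : (om + om) * phi nu 0 <= e / 4.
  apply: (@le_trans _ _ ((e / (8 * (K + 1)) + e / (8 * (K + 1))) * (K + 1))).
    apply: ler_pM => //; [exact: addr_ge0 (ltW om0) (ltW om0)|exact: lerD|].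
    by rewrite (le_trans nuK)// lerDl.
  by rewrite le_eqVlt; apply/orP; left; apply/eqP; field; rewrite gt_eqF.
have E2 : (W + hbar ^+ 2) * d <= e / 4.
  apply: (@le_trans _ _ (S * (e / (4 * S)))).
    by rewrite ler_pM ?(ltW d0) ?(addr_ge0 W0 H0)// /S lerDl.
  by rewrite le_eqVlt; apply/orP; left; apply/eqP; field; rewrite gt_eqF.
have E3 : eps / d <= e / 4 by rewrite ler_pdivrMr// mulrC mulrA.
rewrite (mulrC beta^-1).
by move: E1 E2 E3 ib; move: (_ * phi nu 0) (_ * d) (eps / d) (_ / beta) => x1 x2 x3 x4; lra.
Unshelve. all: by end_near. Qed.

Lemma GS_minimizer : exists nu v, [/\ inA nu, 0 <= v, J0 nu = v%:E &
  forall nu', inA nu' -> (v%:E <= J0 nu')%E].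
Proof.
have [L L0 Llip] := xi2_lipschitz mb; have [w0 w0p w_lb] := xi2_gt0 mb.
have [W W0 wW] := xi2_bounded mb.
have H0 : 0 <= hbar ^+ 2 by exact: sqr_ge0.
have [nu [nuA nu_min]] := J0_minimizer (xi2_ge0_I01 mb) (measurable_xi2 mb) H0 w0p w_lb Llip.
have Jge0 : (0 <= J0 nu)%E.
  exact: (J_ge0 (xi2_ge0_I01 mb) H0 (tame0_phi nuA)).
have Jfin : J0 nu \is a fin_num.
  rewrite ge0_fin_numE//.
  apply: le_lt_trans (nu_min _ (inA_cst (lexx (0 : R)) (@ler01 R))) _.
  apply: le_lt_trans (J0_unit_le (xi2_ge0_I01 mb) (measurable_xi2 mb) H0 wW) _.
  exact: ltry.
have [v vE] : exists v, J0 nu = v%:E by exists (fine (J0 nu)); rewrite fineK.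
exists nu, v; split; [exact: nuA|by rewrite -lee_fin -vE|exact: vE|].
by move=> nu' nuA'; rewrite -vE; exact: (nu_min nu' nuA').
Qed.

Section WithMinimizer.
Variables (nus : Aelt R) (v : R).
Hypotheses (nusA : inA nus) (v0 : 0 <= v) (nusv : J0 nus = v%:E).
Hypothesis vmin : forall nu, inA nu -> (v%:E <= J0 nu)%E.

Lemma near_value e : 0 < e -> \forall beta \near +oo, [/\ 0 < beta,
  SM beta beta^-1 (recov nus beta), (Jb beta (recov nus beta) <= (v + e)%:E)%E &
  forall nu, SM beta beta^-1 nu -> ((v - e)%:E <= Jb beta nu)%E].
Proof.
move=> e0; have [K K0 KP] := near_lower v0.
have [d [d0 _ nd]] := KP e e0.
have nr := recov_upper mb mbs hcv ucv nusA e0.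
near=> beta.
have B0 : 0 < beta by near: beta; exact: nbhs_pinfty_gt.
have [S1 S2] : SM beta beta^-1 (recov nus beta) /\
  (Jb beta (recov nus beta) <= J0 nus + e%:E)%E by near: beta; exact: nr.
have low : forall nu, SM beta beta^-1 nu -> (Jb beta nu <= v%:E)%E ->
    (J0 (shift nu d) <= Jb beta nu + e%:E)%E /\ phi nu 0 <= K by near: beta; exact: nd.
split => //; first by rewrite EFinD -nusv.
move=> nu nuS; case/orP: (le_total (Jb beta nu) v%:E) => Jv; last first.
  by apply: le_trans Jv; rewrite lee_fin gerBl ltW.
have [lo _] := low nu nuS Jv.
have [nuA _ _] := nuS.
have vs := vmin (inA_shift nuA (ltW d0)).
by rewrite EFinB leeBlDr//; exact: le_trans vs lo.
Unshelve. all: by end_near. Qed.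

(** The selected minimizer with an atom d added has GS value at most v + 2e: one e comes from the
    recovery sequence, one from the shift. The convexity inequality for GS then compares it with
    [nus], and d <= c/2 pays for removing the shift. *)
Lemma minimizers_cvg (sel : R -> Aelt R) s :
  (\forall beta \near +oo, SM beta beta^-1 (sel beta) /\
     forall nu, SM beta beta^-1 nu -> (Jb beta (sel beta) <= Jb beta nu)%E) ->
  0 <= s < 1 -> phi (sel beta) s @[beta --> +oo] --> phi nus s.
Proof.
move=> selP s01; have /andP[s0 s1] := s01; apply/cvgrPdist_le => c c0.
have v1 : 0 <= v + 1 by rewrite addr_ge0.
have [K1 K10 KP] := near_lower v1.
have ps0 : 0 <= phi nus 0 by rewrite phi_ge0.
pose K := K1 + 1 + phi nus 0.
have K0 : 0 < K by rewrite /K; move: (phi nus 0) ps0 K10 => x; lra.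
have c2 : 0 < c / 2 by rewrite divr_gt0.
have r0 := L2_radius_gt0 (ltW K0) s1 c2.
set r := L2_radius K s (c / 2) in r0.
have K3 : 0 < K ^+ 3 by rewrite exprn_gt0.
(* The last entry gives 4 K^3 (2e) <= r/2, strictly below the radius [r]; the first keeps the values
   below v + 1, for which [K1] was obtained. *)
pose e := Num.min 1 (Num.min (c / 2) (r / (16 * K ^+ 3))).
have e0 : 0 < e by rewrite !lt_min ltr01 c2 divr_gt0// mulr_gt0.
have [e1 e2 e3] : [/\ e <= 1, e <= c / 2 & e <= r / (16 * K ^+ 3)].
  by rewrite /e !ge_min !lexx !orbT.
have [d [d0 de nd]] := KP e e0.
have nv := near_value e0.
near=> beta.
have [selS sel_min] : SM beta beta^-1 (sel beta) /\
     forall nu, SM beta beta^-1 nu -> (Jb beta (sel beta) <= Jb beta nu)%E.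
  by near: beta; exact: selP.
have [B0 rS rJ _] : [/\ 0 < beta,
  SM beta beta^-1 (recov nus beta), (Jb beta (recov nus beta) <= (v + e)%:E)%E &
  forall nu, SM beta beta^-1 nu -> ((v - e)%:E <= Jb beta nu)%E] by near: beta; exact: nv.
have low : forall nu, SM beta beta^-1 nu -> (Jb beta nu <= (v + 1)%:E)%E ->
    (J0 (shift nu d) <= Jb beta nu + e%:E)%E /\ phi nu 0 <= K1 by near: beta; exact: nd.
have selJ : (Jb beta (sel beta) <= (v + e)%:E)%E by exact: le_trans (sel_min _ rS) rJ.
have selJ1 : (Jb beta (sel beta) <= (v + 1)%:E)%E.
  by apply: le_trans selJ _; rewrite lee_fin lerD2l.
have [lo pK] := low _ selS selJ1.
have [selA _ _] := selS.
have shA := inA_shift selA (ltW d0).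
have loJ : (J0 (shift (sel beta) d) <= (v + (e + e))%:E)%E.
  apply: (le_trans lo); rewrite addrA [in leRHS]EFinD.
  by rewrite leeD2r.
have nusJ : (J0 nus <= (v + (e + e))%:E)%E.
  by rewrite nusv lee_fin lerDl addr_ge0// ltW.
have shK : phi (shift (sel beta) d) 0 <= K.
  rewrite phi_shift /K; move: pK (le_trans de e1) ps0.
  by move: (phi (sel beta) 0) (phi nus 0) => x y; lra.
have nusK : phi nus 0 <= K by rewrite /K; move: (phi nus 0) K10 => x; lra.
have small : 4 * K ^+ 3 * (e + e) < r.
  apply: (@le_lt_trans _ _ (r / 2)); last by move: (r) r0 => x; lra.
  have -> : r / 2 = 8 * K ^+ 3 * (r / (16 * K ^+ 3)) by field; rewrite gt_eqF.
  have -> : 4 * K ^+ 3 * (e + e) = 8 * K ^+ 3 * e by ring.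
  by rewrite ler_wpM2l// mulr_ge0// ltW.
have := near_min_close (xi2_ge0_I01 mb) (measurable_xi2 mb) (sqr_ge0 hbar) shA nusA
  (tame0_phi shA) (tame0_phi nusA) K0 shK nusK (vmin (inA_mid shA nusA)) loJ nusJ s01 c2 small.
rewrite phi_shift distrC.
move: (le_trans de e2) d0; move: (phi (sel beta) s) (phi nus s) => x y dc d0'.
by rewrite ltr_norml ler_norml => /andP[h1 h2]; apply/andP; split; lra.
Unshelve. all: by end_near. Qed.

End WithMinimizer.

End Limit.

Lemma limn_esup_le (R : realType) (u : (\bar R)^nat) (G : \bar R) :
  (forall e : R, 0 < e -> \forall n \near \oo, (u n <= G + e%:E)%E) ->
  (limn_esup u <= G)%E.
Proof.
move=> uG; apply/lee_addgt0Pr => e e0; rewrite limn_esup_lim.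
have [N _ NP] := uG e e0.
apply: lime_le; first exact: is_cvg_esups.
exists N => // n /= Nn; apply: ge_ereal_sup => _ [m /= nm <-].
by apply: NP; exact: leq_trans nm.
Qed.

Lemma cvg_real_ereal (R : realType) {I : Type} {F : set_system I} {FF : Filter F}
    (u : I -> \bar R) (l : R) :
  (forall e : R, 0 < e -> \forall i \near F, ((l - e)%:E <= u i <= (l + e)%:E)%E) ->
  u @ F --> l%:E.
Proof.
move=> ul.
have fin i e : ((l - e)%:E <= u i <= (l + e)%:E)%E -> u i \is a fin_num.
  by move=> /andP[h1 h2]; rewrite fin_numElt (lt_le_trans (ltNyr _) h1) (le_lt_trans h2 (ltry _)).
apply/fine_cvgP; split; first by apply: filterS (ul 1 ltr01) => i; exact: fin.
apply/cvgrPdist_le => e e0; apply: filterS (ul e e0) => i ui /=.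
move: (ui); rewrite -(fineK (fin _ _ ui)) !lee_fin => /andP[h1 h2].
by rewrite distrC ler_norml; apply/andP; split; lra.
Qed.

(** * Minimizers at a fixed temperature *)

Section FixedTemperature.
Variables (R : realType) (b : nat -> R) (beta h : R).
Hypotheses (mb : model b) (beta0 : 0 < beta).
Implicit Types nu : Aelt R.

Local Notation Jbeta nu := (J (xi2 b) ((h / beta) ^+ 2) beta^-1 (phi nu)).

Let bi0 : 0 <= beta^-1. Proof. by rewrite invr_ge0 ltW. Qed.
Let bb : beta^-1 * beta <= 1. Proof. by rewrite mulVf// gt_eqF. Qed.

Lemma Jbeta_minimizer : exists nu, SM beta beta^-1 nu /\
  forall nu', SM beta beta^-1 nu' -> (Jbeta nu <= Jbeta nu')%E.
Proof.
have [w0 w0p w_lb] := xi2_gt0 mb.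
apply: (@J_minimizer _ (xi2 b) ((h / beta) ^+ 2) w0 (xi2_ge0_I01 mb) (measurable_xi2 mb)
  (sqr_ge0 _) w0p _ beta beta^-1 (ltW beta0) bi0 bb).
by move=> s /andP[h1 /ltW h2]; apply: w_lb; rewrite h1.
Qed.

Lemma CS_nu nu (mu : probability R R) : inXwith beta nu mu ->
  CS beta h b mu = ((beta / 2)%:E * Jbeta nu)%E.
Proof.
move=> muX; have [_ [muI _]] := muX; have [_ E] := inXwith_phi beta0 muX.
by rewrite (J_ext (xi2 b) ((h / beta) ^+ 2) beta^-1 E); exact: CS_J.
Qed.

Lemma CS_minimizer : exists2 mu : probability R R, PrI mu &
  forall mu', PrI mu' -> (CS beta h b mu <= CS beta h b mu')%E.
Proof.
have [nu [nuS nu_min]] := Jbeta_minimizer.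
have [mu muX] := exists_inXwith beta0 nuS.
exists mu; first by have [_ []] := muX.
move=> mu' muI'; have muX' := inXwith_nu_of beta0 muI'.
rewrite (CS_nu muX) (CS_nu muX'); apply: lee_wpmul2l.
  by rewrite lee_fin divr_ge0// ltW.
by apply: nu_min; exact: SM_nu_of.
Qed.

(** Since F_beta is finite somewhere, a minimizer cannot lie outside X_beta, where the value is
    [+oo]. *)
Lemma isminA_Ffun nu : isminA (Ffun beta h b) nu <->
  SM beta beta^-1 nu /\ forall nu', SM beta beta^-1 nu' -> (Jbeta nu <= Jbeta nu')%E.
Proof.
have [W W0 wW] := xi2_bounded mb.
have [S0 J0] := J_uniform_le beta0 (xi2_ge0_I01 mb) (measurable_xi2 mb)
  (sqr_ge0 (h / beta)) wW.
split => [[nuA nu_min]|[nuS nu_min]].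
  have nuS : SM beta beta^-1 nu.
    apply: contrapT => nS; have [S0A _ _] := S0.
    have := nu_min _ S0A; rewrite (Ffun_notSM _ _ beta0 nS) (Ffun_SM _ mb beta0 S0).
    move=> /le_trans/(_ J0); rewrite leye_eq.
    by [].
  split; first exact: nuS.
  move=> nu' nuS'; have [nuA' _ _] := nuS'.
  by have := nu_min nu' nuA'; rewrite (Ffun_SM h mb beta0 nuS) (Ffun_SM h mb beta0 nuS').
have [nuA _ _] := nuS; split; first exact: nuA.
move=> nu' nuA'.
have [nuS'|nS'] := pselect (SM beta beta^-1 nu').
  rewrite (Ffun_SM h mb beta0 nuS) (Ffun_SM h mb beta0 nuS').
  exact: (nu_min nu' nuS').
by rewrite (Ffun_notSM _ _ beta0 nS') leey.
Qed.

Lemma Ffun_minimizer :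
  (exists nu, isminA (Ffun beta h b) nu) /\
  (forall nu nu', isminA (Ffun beta h b) nu -> isminA (Ffun beta h b) nu' -> Aeq nu nu').
Proof.
split.
  by have [nu nuP] := Jbeta_minimizer; exists nu; exact/isminA_Ffun.
move=> nu nu' /isminA_Ffun[nuS nu_min] /isminA_Ffun[nuS' nu_min'].
have [W W0 wW] := xi2_bounded mb.
have [S0 J0] := J_uniform_le beta0 (xi2_ge0_I01 mb) (measurable_xi2 mb)
  (sqr_ge0 (h / beta)) wW.
have [nuA _ _] := nuS; have [nuA' _ _] := nuS'.
have tn := tame_SM bi0 bb nuS; have tn' := tame_SM bi0 bb nuS'.
have Jge0 : (0 <= Jbeta nu)%E := J_ge0 (xi2_ge0_I01 mb) (sqr_ge0 _) tn.
have Jlty : (Jbeta nu < +oo)%E by apply: le_lt_trans (le_trans (nu_min _ S0) J0) (ltry _).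
have [v vE] : exists v, Jbeta nu = v%:E.
  by exists (fine (Jbeta nu)); rewrite fineK// ge0_fin_numE.
have vmid : (v%:E <= Jbeta (Amid nu nu'))%E.
  by rewrite -vE; exact: (nu_min _ (SM_mid nuS nuS')).
have vle : (Jbeta nu <= v%:E)%E by rewrite vE.
have vle' : (Jbeta nu' <= v%:E)%E by rewrite -vE; exact: (nu_min' _ nuS).
exact: (minimizer_unique (xi2_ge0_I01 mb) (measurable_xi2 mb) (sqr_ge0 _)
  nuA nuA' tn tn' vmid vle vle').
Qed.

End FixedTemperature.

(** * Gamma-convergence and its consequences *)

Section GammaLimit.
Variables (R : realType) (b : nat -> R) (hbar : R) (h : R -> R) (bs : R -> nat -> R).
Hypothesis mb : model b.
Hypothesis (mbs : forall beta, 0 < beta -> model (bs beta)).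
Hypothesis hcv : (fun beta => h beta / beta) @ +oo --> hbar.
Hypothesis ucv : forall e : R, 0 < e -> \forall beta \near +oo,
  forall s, 0 <= s <= 1 -> `|xi2 (bs beta) s - xi2 b s| < e.

Lemma Gamma_convergence (betas : nat -> R) :
  (forall n, 0 < betas n) -> betas @ \oo --> +oo ->
  GammaSeq (fun n => Ffun (betas n) (h (betas n)) (bs (betas n))) (GS hbar b).
Proof.
move=> betas0 betasy; split.
  move=> nu nus nuA nusA cw; rewrite (GS_J _ mb nuA).
  (* The lower bound is Fatou's lemma with k = 1/beta_n tending to 0; terms outside X_beta count as
     [+oo]. *)
  apply: (@J_lsc _ (fun n => xi2 (bs (betas n))) (xi2 b)
    (fun n => (h (betas n) / betas n) ^+ 2) (hbar ^+ 2)
    (fun n => (betas n)^-1) 0 (fun n => phi (nus n)) (phi nu)).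
  - by move=> n; exact: (xi2_ge0_I01 (mbs (betas0 n))).
  - by move=> n; exact: (measurable_xi2 (mbs (betas0 n))).
  - by move=> n; exact: sqr_ge0.
  - move=> s /andP[s0 /ltW s1]; apply/cvgrPdist_lt => e e0.
    have s01 : 0 <= s <= 1 by rewrite s0.
    have near_e : \forall n \near \oo, forall s, 0 <= s <= 1 ->
      `|xi2 (bs (betas n)) s - xi2 b s| < e := betasy _ (ucv e0).
    have sym (x y : R) : `|x - y| < e -> `|y - x| < e by rewrite distrC.
    by apply: filterS near_e => n near_n; exact: (sym _ _ (near_n s s01)).
  - have hc := cvg_comp _ _ betasy hcv.
    exact: (cvgM hc hc).
  - apply/cvgrPdist_le => e e0.
    have near_e : \forall n \near \oo, 1 / betas n <= e :=
      betasy _ (near_delta_inv e0 (@ler01 R)).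
    apply: filterS near_e => n.
    by rewrite sub0r normrN mul1r gtr0_norm// invr_gt0.
  - by move=> n s /andP[s0 /ltW s1]; rewrite phi_ge0.
  - by move=> s s01; exact: wconv_phi.
  - exact: xi2_ge0_I01.
  - exact: measurable_xi2.
  - exact: sqr_ge0.
  - exact: tame0_phi.
  move=> n; have [nS|nS] := pselect (SM (betas n) (betas n)^-1 (nus n)); last first.
    by left; exact: Ffun_notSM.
  right; split; last exact: (Ffun_SM _ (mbs (betas0 n)) (betas0 n) nS).
  apply: (tame_SM _ _ nS); first by rewrite invr_ge0 ltW.
  by rewrite mulVf// gt_eqF.
move=> nu nuA; exists (fun n => recov nu (betas n)); split.
  by move=> n; exact: inA_recov.
split.
  move=> f cf; apply: phi_wconv => //.
    by apply: nearW => n; exact: inA_recov.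
  move=> s s01; exact: (cvg_comp _ _ betasy (recov_cvg nuA s01)).
apply: limn_esup_le => e e0; rewrite (GS_J _ mb nuA).
have near_e : \forall n \near \oo, SM (betas n) (betas n)^-1 (recov nu (betas n)) /\
  (J (xi2 (bs (betas n))) ((h (betas n) / betas n) ^+ 2) (betas n)^-1
     (phi (recov nu (betas n))) <= J (xi2 b) (hbar ^+ 2) 0 (phi nu) + e%:E)%E :=
  betasy _ (recov_upper mb mbs hcv ucv nuA e0).
apply: filterS near_e => n [S1 S2].
by rewrite (Ffun_SM _ (mbs (betas0 n)) (betas0 n) S1).
Qed.

Lemma cvg_min_CS :
  (fun beta => ereal_inf [set ((beta^-1)%:E * CS beta (h beta) (bs beta) mu)%E | mu in @PrI R])
    @ +oo --> ereal_inf [set ((2^-1)%:E * GS hbar b nu)%E | nu in @inA R].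
Proof.
have [nus [v [nusA v0 nusv vmin]]] := GS_minimizer hbar mb.
have -> : ereal_inf [set ((2^-1)%:E * GS hbar b nu)%E | nu in @inA R] = (v / 2)%:E.
  apply/eqP; rewrite eq_le; apply/andP; split.
    apply: ereal_inf_lbound; exists nus => //.
    by rewrite (GS_J _ mb nusA) nusv -EFinM mulrC.
  apply: le_ereal_inf_tmp => _ [nu nuA <-].
  rewrite (GS_J _ mb nuA) mulrC EFinM; apply: lee_wpmul2l; last exact: (vmin nu nuA).
  by rewrite lee_fin invr_ge0.
apply: cvg_real_ereal => e e0.
apply: filterS (near_value mb mbs hcv ucv nusA v0 nusv vmin e0) => beta [B0 rS rJ low].
have half (mu : probability R R) nu : inXwith beta nu mu ->
    ((beta^-1)%:E * CS beta (h beta) (bs beta) mu =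
     (2^-1)%:E * J (xi2 (bs beta)) ((h beta / beta) ^+ 2) beta^-1 (phi nu))%E.
  move=> muX; rewrite (CS_nu _ (mbs B0) B0 muX) muleA -EFinM.
  by congr (_%:E * _)%E; field; rewrite gt_eqF.
have i2 : (0 <= (2^-1 : R)%:E)%E by rewrite lee_fin invr_ge0.
apply/andP; split.
  apply: le_ereal_inf_tmp => _ [mu muI <-].
  rewrite (half mu _ (inXwith_nu_of B0 muI)).
  apply: (@le_trans _ _ ((2^-1)%:E * (v - e)%:E)%E).
    by rewrite -EFinM lee_fin; lra.
  apply: lee_wpmul2l i2 _ _ _; apply: low; exact: SM_nu_of.
have [mu muX] := exists_inXwith B0 rS.
have [_ [muI _]] := muX.
apply: (@le_trans _ _ ((beta^-1)%:E * CS beta (h beta) (bs beta) mu)%E).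
  by apply: ereal_inf_lbound; exists mu.
rewrite (half mu _ muX).
apply: (le_trans (lee_wpmul2l i2 rJ)).
by rewrite -EFinM lee_fin; lra.
Qed.

Lemma GS_minimizer_limit : exists nu, isminA (GS hbar b) nu /\
  (forall nu', isminA (GS hbar b) nu' -> Aeq nu' nu) /\
  (forall sel : R -> Aelt R,
     (forall beta, 0 < beta -> isminA (Ffun beta (h beta) (bs beta)) (sel beta)) ->
     wconvR sel nu).
Proof.
have [nus [v [nusA v0 nusv vmin]]] := GS_minimizer hbar mb.
exists nus; split.
  split; first exact: nusA.
  by move=> nu' nuA'; rewrite (GS_J _ mb nusA) (GS_J _ mb nuA') nusv; exact: (vmin nu' nuA').
split.
  move=> nu [nuA nu_min].
  have nuv : (J (xi2 b) (hbar ^+ 2) 0 (phi nu) <= v%:E)%E.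
    by have := nu_min nus nusA; rewrite (GS_J _ mb nusA) (GS_J _ mb nuA) nusv.
  have nusv' : (J (xi2 b) (hbar ^+ 2) 0 (phi nus) <= v%:E)%E by rewrite nusv.
  exact: (minimizer_unique (xi2_ge0_I01 mb) (measurable_xi2 mb) (sqr_ge0 _) nuA nusA
    (tame0_phi nuA) (tame0_phi nusA) (vmin _ (inA_mid nuA nusA)) nuv nusv').
move=> sel selP f cf; apply: phi_wconv => //.
  near=> beta; have B0 : 0 < beta by near: beta; exact: nbhs_pinfty_gt.
  by have [] := selP beta B0.
move=> s s01; apply: (minimizers_cvg mb mbs hcv ucv nusA v0 nusv vmin _ s01).
near=> beta; have B0 : 0 < beta by near: beta; exact: nbhs_pinfty_gt.
exact/(isminA_Ffun _ (mbs B0) B0)/(selP beta B0).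
Unshelve. all: by end_near. Qed.

End GammaLimit.

Unset Implicit Arguments.

Theorem theorem1p3 (R : realType) (b : nat -> R) (hbar : R)
  (h : R -> R) (bs : R -> nat -> R) :
  model b -> 0 <= hbar ->
  (forall beta, 0 < beta -> 0 <= h beta) ->
  (forall beta, 0 < beta -> model (bs beta)) ->
  (fun beta => h beta / beta) @ +oo --> hbar ->
  (forall e : R, 0 < e -> \forall beta \near +oo,
     forall s, 0 <= s <= 1 -> `|xi2 (bs beta) s - xi2 b s| < e) ->
  (* sequential Gamma-convergence along every sequence beta_n -> +oo *)
  (forall betas : nat -> R, (forall n, 0 < betas n) -> betas @ \oo --> +oo ->
     GammaSeq (fun n => Ffun (betas n) (h (betas n)) (bs (betas n)))
              (GS hbar b)) /\
  (* the minimum over Pr([0,1]) of the Crisanti--Sommers functional exists *)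
  (forall beta, 0 < beta -> exists2 mu, PrI mu &
     forall mu', PrI mu' -> (CS beta (h beta) (bs beta) mu <= CS beta (h beta) (bs beta) mu')%E) /\
  (* convergence of the minimal values *)
  ((fun beta => ereal_inf [set ((beta^-1)%:E * CS beta (h beta) (bs beta) mu)%E | mu in @PrI R])
     @ +oo --> ereal_inf [set ((2^-1)%:E * GS hbar b nu)%E | nu in @inA R]) /\
  (* F_beta has a unique minimizer (as a measure) *)
  (forall beta, 0 < beta ->
     (exists nu, isminA (Ffun beta (h beta) (bs beta)) nu) /\
     (forall nu nu', isminA (Ffun beta (h beta) (bs beta)) nu ->
        isminA (Ffun beta (h beta) (bs beta)) nu' -> Aeq nu nu')) /\
  (* GS attains its minimum, at a unique nu, and minimizers of F_beta converge weakly to it *)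
  (exists nu, isminA (GS hbar b) nu /\
     (forall nu', isminA (GS hbar b) nu' -> Aeq nu' nu) /\
     (forall sel : R -> Aelt R,
        (forall beta, 0 < beta -> isminA (Ffun beta (h beta) (bs beta)) (sel beta)) ->
        wconvR sel nu)).
Proof.
move=> mb hbar0 h0 mbs hcv ucv; split; [|split; [|split; [|split]]].
- move=> betas betas0 betasy; exact: (Gamma_convergence mb mbs hcv ucv betas0 betasy).
- move=> beta beta0; exact: (CS_minimizer (h beta) (mbs beta beta0) beta0).
- exact: (cvg_min_CS mb mbs hcv ucv).
- move=> beta beta0; exact: (Ffun_minimizer (h beta) (mbs beta beta0) beta0).
- exact: (GS_minimizer_limit mb mbs hcv ucv).
Qed.
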